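(* Let $n,p$ be positive integers with $n-p-1>0$ and let $0\le\gamma<p^2+p$. For $N>0$ observe $Y\in\mathbb{R}^{n\times p}$ with independent entries $Y_{ai}\sim\mathrm N(M_{ai},N^{-1})$. Let $\hat M_{\mathrm{SVS}}$ and $\hat M_{\mathrm{MSVS1}}$ be the generalized Bayes estimators with respect to $\pi_{\mathrm{SVS}}(M)=\det(M^\top M)^{-(n-p-1)/2}$ and $\pi_{\mathrm{MSVS1}}(M)=\pi_{\mathrm{SVS}}(M)\|M\|_{\mathrm F}^{-\gamma}$. Then for every $M$ with $K=M^\top M$ nonsingular, $$N^2\left(\mathrm E_M[(\hat M_{\mathrm{MSVS1}}-M)^\top(\hat M_{\mathrm{MSVS1}}-M)]-\mathrm E_M[(\hat M_{\mathrm{SVS}}-M)^\top(\hat M_{\mathrm{SVS}}-M)]\right)\to \gamma(\mathrm{tr}K)^{-2}\left(-2(p+1)(\mathrm{tr}K)I_p+(\gamma+4)K\right)$$ as $N\to\infty$. Consequently, if $p\ge2$ and $0<\gamma<2p-2$, then $\hat M_{\mathrm{MSVS1}}$ asymptotically dominates $\hat M_{\mathrm{SVS}}$ under the matrix quadratic loss, i.e., the limit matrix is negative definite for every such $M$.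
   Context: The generalized Bayes estimator with respect to a nonnegative function $\pi$ with finite marginal $m_\pi(Y)=\int p(Y\mid M)\pi(M)\,\mathrm dM$ is the posterior mean $\int M p(Y\mid M)\pi(M)\,\mathrm dM/m_\pi(Y)$; these marginals are finite for $0\le\gamma<p^2+p$. The matrix quadratic loss of $\hat M$ is the $p\times p$ matrix $(\hat M-M)^\top(\hat M-M)$. *)

(* Defs.v *)
From HB Require Import structures.
From mathcomp Require Import all_boot all_order all_algebra.
From mathcomp Require Import all_classical all_reals all_analysis.
Set Implicit Arguments. Unset Strict Implicit. Unset Printing Implicit Defensive.
Import Order.TTheory GRing.Theory Num.Theory.
Import numFieldNormedType.Exports.
Local Open Scope ring_scope.

Section Defs.
Variable R : realType.

Fixpoint iint (k : nat) (f : seq R -> \bar R) : \bar R :=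
  match k with
  | 0 => f [::]
  | k'.+1 => (\int[@lebesgue_measure R]_x iint k' (fun s => f (x :: s)))%E
  end.

Definition mx_of_seq (n p : nat) (s : seq R) : 'M[R]_(n, p) :=
  \matrix_(a < n, i < p) nth 0 s (a * p + i).

Definition mxint (n p : nat) (F : 'M[R]_(n, p) -> R) : \bar R :=
  iint (n * p) (fun s => (F (mx_of_seq n p s))%:E).

Definition frob2 (n p : nat) (A : 'M[R]_(n, p)) : R :=
  \sum_(a < n) \sum_(i < p) A a i ^+ 2.

Definition gauss_density (n p : nat) (N : R) (Y M : 'M[R]_(n, p)) : R :=
  (N / (2 * pi)) `^ ((n * p)%:R / 2) * expR (- (N * frob2 (Y - M)) / 2).

Definition pi_SVS (n p : nat) (M : 'M[R]_(n, p)) : R :=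
  (\det (M^T *m M)) `^ (- ((n%:R - p%:R - 1) / 2)).

Definition pi_MSVS1 (gamma : R) (n p : nat) (M : 'M[R]_(n, p)) : R :=
  pi_SVS M * (Num.sqrt (frob2 M)) `^ (- gamma).

Definition gen_bayes (n p : nat) (prior : 'M[R]_(n, p) -> R) (N : R)
    (Y : 'M[R]_(n, p)) : 'M[R]_(n, p) :=
  \matrix_(a < n, i < p)
    (fine (mxint (fun M => M a i * gauss_density N Y M * prior M)) /
     fine (mxint (fun M => gauss_density N Y M * prior M))).

Definition risk_mx (n p : nat) (est : 'M[R]_(n, p) -> 'M[R]_(n, p)) (N : R)
    (M : 'M[R]_(n, p)) : 'M[R]_p :=
  \matrix_(i < p, j < p)
    fine (mxint (fun Y => gauss_density N Y M *
                          ((est Y - M)^T *m (est Y - M)) i j)).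

Definition limit_mx (p : nat) (gamma : R) (K : 'M[R]_p) : 'M[R]_p :=
  (gamma * (\tr K) ^- 2) *:
    (- ((2 * (p%:R + 1) * \tr K) *: 1%:M) + (gamma + 4) *: K).

Definition neg_def (p : nat) (A : 'M[R]_p) : Prop :=
  forall v : 'cV[R]_p, v != 0 -> (v^T *m A *m v) 0 0 < 0.

End Defs.

(* Main.v *)
(* Write [r = sqrt N], [Y = M + z / r] and [rho x = pi (M + x) / pi M].  In these
   coordinates the posterior mean is [M + (z + E / B) / r], where [B] and [E] are
   Gaussian means over [v] of [rho ((z + v) / r)] and [v * rho ((z + v) / r)].
   If [rho x = 1 + a.x + x.Hx / 2 + O(|x|^3)] then [E / B] is
   [a / r + (H - a a^T) z / r^2] up to errors that are integrable in [z], so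

     [N^2 R_ij = N n delta_ij + sum_b (2 H - a a^T)_(bi)(bj) + o(1)].

   The remainder is controlled globally because both priors are Gaussian
   integrable: [det(M^T M)^(-1/2)] is a constant times the integral of
   [exp (- |M x|^2 / 2)] over [x], which lets the exponent of the determinant go
   up one half at a time, and [|M|^(-gamma)] is summed over dyadic shells.

   Subtracting the expansions for the two priors, the Hessian of [pi_SVS]
   cancels, and its gradient enters only through [sum_b a_bi M_bj], which is
   [-(n - p - 1) delta_ij] since [pi_SVS (M T) = |det T|^-(n-p-1) * pi_SVS M]. *)

Require Import Defs.
From HB Require Import structures.
From mathcomp Require Import all_boot all_order all_algebra.
From mathcomp Require Import all_classical all_reals all_analysis.
From mathcomp Require Import measurable_realfun ring lra zify.
Import Order.TTheory GRing.Theory Num.Theory.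
Import numFieldNormedType.Exports.
Local Open Scope classical_set_scope.
Local Open Scope ring_scope.
Set Implicit Arguments. Unset Strict Implicit. Unset Printing Implicit Defensive.

(** * Lebesgue measure on tuples and matrices *)

(** Two obstacles shape the proof. The integrals are iterated one-dimensional ones read through
    [fine], so they carry information only once integrability is known; hence the measure [lebmx] on
    matrices and the integrability conditions carried throughout. The priors are also singular on
    matrices of deficient rank, so no pointwise upper bound on rho is available away from 0: there
    the remainder is bounded by |x|^(2m) rho(x), and only Gaussian integrals of rho are used.
    Dividing by B requires a lower bound on B, which comes from a polynomial upper bound on the Gram
    determinant. Every error has the form C r^(-k) exp(e |z|^2) with e as small as wanted, so
    products and quotients stay integrable in z. The matrix 2 H - a a^T is 2 (H - a a^T) + a a^T:
    the first part is the correlation of z with the linear correction (H - a a^T) z, counted twice,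
    and the second is the square of the constant correction. The threshold p^2 + p is n p - p (n - p
    - 1), the degree of homogeneity of the measure [pi_SVS] dM; below it the factor |M|^(-gamma)
    stays integrable at the origin. *)

Section measurable_bigop.
Context d (T : measurableType d) (R : realType) (I : Type).
Implicit Types (s : seq I) (P : pred I) (h : I -> T -> R).

Lemma measurable_sumr s P h : (forall i, measurable_fun setT (h i)) ->
  measurable_fun setT (fun x => \sum_(i <- s | P i) h i x).
Proof.
move=> mh; elim: s => [|i s IH].
  by under eq_fun do rewrite big_nil; exact: measurable_cst.
under eq_fun do rewrite big_cons.
by case: (P i) => //; exact: measurable_funD.
Qed.

Lemma measurable_prodr s P h : (forall i, measurable_fun setT (h i)) ->
  measurable_fun setT (fun x => \prod_(i <- s | P i) h i x).
Proof.
move=> mh; elim: s => [|i s IH].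
  by under eq_fun do rewrite big_nil; exact: measurable_cst.
under eq_fun do rewrite big_cons.
by case: (P i) => //; exact: measurable_funM.
Qed.

End measurable_bigop.

Section sigma_finite_pushforward.
Context d d' (T : measurableType d) (T' : measurableType d') (R : realType).
Variables (mu : {sigma_finite_measure set T -> \bar R}) (f : T -> T') (g : T' -> T).
Hypotheses (mf : measurable_fun setT f) (mg : measurable_fun setT g).
Hypothesis fK : cancel f g.

(** The left inverse carries an exhausting sequence over: the preimage under [f] of [g @^-1] F n is
    F n itself, so its measure is finite. *)
Lemma pushforward_sigma_finite : sigma_finite setT (pushforward mu f).
Proof.
have [F UF mF] := sigma_finiteT mu.
exists (fun n => g @^-1` F n).
  by rewrite -preimage_bigcup -UF preimage_setT.
move=> n; have [m1 m2] := mF n; split.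
  by rewrite -[X in measurable X]setTI; exact: mg.
rewrite /pushforward -comp_preimage (_ : g \o f = idfun) ?preimage_id//.
by apply/funext => x /=; rewrite fK.
Qed.

(** The proofs are arguments so that the measure and sigma-finiteness instances below can be
    attached to this constant and found again by unification. *)
Definition sfpush of measurable_fun setT f & measurable_fun setT g &
  cancel f g : set T' -> \bar R := pushforward mu f.

Let push := sfpush mf mg fK.

HB.instance Definition _ := Measure.copy push
  (measure_function_pushforward__canonical__measure_function_Measure mu mf).

HB.instance Definition _ :=
  Measure_isSigmaFinite.Build _ _ _ push pushforward_sigma_finite.

Lemma ge0_integral_sfpush (h : T' -> \bar R) : measurable_fun setT h ->
  (forall x, 0 <= h x)%E ->
  (\int[push]_y h y = \int[mu]_x h (f x))%E.
Proof. by move=> mh h0; rewrite ge0_integral_pushforward. Qed.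

Lemma integral_sfpush (h : T' -> \bar R) : measurable_fun setT h ->
  mu.-integrable setT (h \o f) ->
  (\int[push]_y h y = \int[mu]_x h (f x))%E.
Proof. by move=> mh h0; rewrite (integral_pushforward mf). Qed.

End sigma_finite_pushforward.

Section sigma_finite_product.
Context d d' (T : measurableType d) (T' : measurableType d') (R : realType).
Variables (mu : {sigma_finite_measure set T -> \bar R})
  (nu : {sigma_finite_measure set T' -> \bar R}).
Local Open Scope ereal_scope.

(* The library declares [mu \x nu] sigma-finite only for subprobabilities. *)
Definition sfprod : set (T * T')%type -> \bar R := mu \x nu.

HB.instance Definition _ := Measure.copy sfprod (mu \x nu).

Let sfprod_sigma_finite : sigma_finite setT sfprod.
Proof.
have /sigma_finiteP[F [TF ndF Foo]] := sigma_finiteT mu.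
have /sigma_finiteP[G [TG ndG Goo]] := sigma_finiteT nu.
exists (fun n => F n `*` G n).
  rewrite -setXTT TF TG predeqE => -[x y]; split; last first.
    by move=> [n _ []/= ? ?]; split; exists n.
  move=> [/= [n _ Fnx] [k _ Gky]]; exists (maxn n k) => //; split.
  - by move: x Fnx; exact/subsetPset/ndF/leq_maxl.
  - by move: y Gky; exact/subsetPset/ndG/leq_maxr.
move=> k; have [? ?] := Foo k; have [? ?] := Goo k.
split; first exact: measurableX.
by rewrite /sfprod product_measure1E// lte_mul_pinfty// ge0_fin_numE.
Qed.

HB.instance Definition _ :=
  Measure_isSigmaFinite.Build _ _ _ sfprod sfprod_sigma_finite.

End sigma_finite_product.

Section leb_tuple.
Variable R : realType.
Local Notation leb := (@lebesgue_measure R).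

Definition tcons k (z : measurableTypeR R * k.-tuple (measurableTypeR R)) : k.+1.-tuple (measurableTypeR R) :=
  [tuple of z.1 :: z.2].
Definition tuncons k (t : k.+1.-tuple (measurableTypeR R)) : measurableTypeR R * k.-tuple (measurableTypeR R) :=
  (thead t, [tuple of behead t]).

Lemma tconsK k : cancel (@tcons k) (@tuncons k).
Proof. by move=> [x t]; rewrite /tuncons /tcons theadE; congr pair; apply: val_inj. Qed.

Lemma measurable_tcons k : measurable_fun setT (@tcons k).
Proof. exact: (measurable_cons measurable_fst measurable_snd). Qed.

Lemma measurable_tuncons k : measurable_fun setT (@tuncons k).
Proof.
apply/measurable_fun_pair; last exact: measurable_behead.
exact: measurable_tnth.
Qed.

(** The recursion peels off the first coordinate, exactly as [iint] does, so that Fubini at each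
    stage matches the two. *)
Fixpoint lebt k : {sigma_finite_measure set (k.-tuple (measurableTypeR R)) -> \bar R} :=
  match k with
  | 0 => \d_[tuple]
  | k'.+1 => sfpush (sfprod leb (lebt k')) (@measurable_tcons k') (@measurable_tuncons k') (@tconsK k')
  end.

End leb_tuple.

(** The inner stages of [iint] may diverge on a null set, so this covers slices of any
    integrability: the integrals of the positive and negative parts are measurable by Tonelli, and
    their extended difference is defined everywhere. *)
Lemma measurable_fun_integral d d' (T : measurableType d) (T' : measurableType d')
    (R : realType) (mu : {sigma_finite_measure set T' -> \bar R})
    (f : T * T' -> \bar R) :
  measurable_fun setT f -> measurable_fun setT (fun t => \int[mu]_x f (t, x))%E.
Proof.
move=> mf; under eq_fun do rewrite integralE.
have mp := @measurable_fun_fubini_tonelli_F _ _ _ _ _ mu _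
  (measurable_funepos mf) (fun z => funepos_ge0 f z).
have mn := @measurable_fun_fubini_tonelli_F _ _ _ _ _ mu _
  (measurable_funeneg mf) (fun z => funeneg_ge0 f z).
rewrite (_ : (fun t => _) = fubini_F mu f^\+ \- fubini_F mu f^\-)%E.
  exact: emeasurable_funB.
apply/funext => t; rewrite /fubini_F; congr (_ - _)%E; apply: eq_integral => x _.
  by rewrite !funeposE.
by rewrite !funenegE.
Qed.

Section lebt_integral.
Variable R : realType.
Local Notation leb := (@lebesgue_measure R).
Local Notation mR := (measurableTypeR R).
Local Open Scope ereal_scope.

Lemma measurable_tcons1 k (x : mR) :
  measurable_fun setT (fun t : k.-tuple mR => tcons (x, t)).
Proof.
apply: measurableT_comp; first exact: measurable_tcons.
exact: measurable_pair1.
Qed.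

Lemma ge0_integral_lebtS k (h : k.+1.-tuple mR -> \bar R) :
  measurable_fun setT h -> (forall t, 0 <= h t) ->
  \int[lebt R k.+1]_t h t = \int[leb]_x \int[lebt R k]_t h (tcons (x, t)).
Proof.
move=> mh h0; rewrite /= ge0_integral_sfpush//.
apply: (fubini_tonelli1 (h \o (@tcons R k))) => //=.
by apply: measurableT_comp => //; exact: measurable_tcons.
Qed.

Lemma integral_lebt0 (h : 0.-tuple mR -> \bar R) : measurable_fun setT h ->
  \int[lebt R 0]_t h t = h [tuple].
Proof. by move=> mh; rewrite integral_dirac// diracT mul1e. Qed.

(** The parameter space is general because each induction step moves the outermost variable of
    integration into it. *)
Lemma measurable_fun_iint k d (T : measurableType d) (f : T -> seq R -> \bar R) :
  measurable_fun setT (fun z : T * k.-tuple mR => f z.1 z.2) ->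
  measurable_fun setT (fun t => iint k (f t)).
Proof.
elim: k d T f => [|k IH] d T f mf /=.
  exact: (measurableT_comp mf (measurable_pair2 [tuple])).
apply: (@measurable_fun_integral _ _ _ _ _ leb (fun z => iint k (fun s => f z.1 (z.2 :: s)))).
apply: (IH _ (T * mR)%type (fun z s => f z.1 (z.2 :: s))).
have mg : measurable_fun setT (fun z : (T * mR)%type * k.-tuple mR =>
    (z.1.1, tcons (z.1.2, z.2)) : T * k.+1.-tuple mR).
  apply/measurable_fun_pair; first exact: measurableT_comp.
  apply: measurableT_comp; first exact: measurable_tcons.
  by apply/measurable_fun_pair => //; exact: measurableT_comp.
exact: (measurableT_comp mf mg).
Qed.

(** Fubini by induction. Slices are integrable only almost everywhere, so the induction hypothesis
    rewrites the integrand almost everywhere, and [measurable_fun_iint] supplies the measurability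
    that this replacement requires. *)
Lemma iintE k (f : seq R -> \bar R) :
  (lebt R k).-integrable setT (fun t : k.-tuple mR => f t) ->
  iint k f = \int[lebt R k]_t f t.
Proof.
elim: k f => [|k IH] f intf.
  by rewrite integral_lebt0//; exact: measurable_int intf.
have mf := measurable_int _ intf.
have mfc : measurable_fun setT (fun z : mR * k.-tuple mR => f (tcons z)).
  exact: (measurableT_comp mf (@measurable_tcons R k)).
have intc : (leb \x lebt R k).-integrable setT (fun z => f (tcons z)).
  apply/integrableP; split=> //.
  have /integrableP[_] := intf.
  by rewrite /= ge0_integral_sfpush//; exact: measurableT_comp.
rewrite [RHS]/= integral_sfpush//.
transitivity (\int[leb]_x \int[lebt R k]_t f (tcons (x, t))); last first.
  exact: (integral12_prod_meas1 intc).
apply: ae_eq_integral => //=.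
- apply: (@measurable_fun_iint k _ _ (fun (x : mR) s => f (x :: s))).
  exact: mfc.
- exact: (measurable_fubini_F intc).
- have := ae_integrable1 intc.
  apply: filterS => x /= intx _.
  exact: (IH (fun s => f (x :: s))).
Qed.

End lebt_integral.

(** * Affine substitutions on the line and on tuples *)

Section affine1.
Variable R : realType.
Local Notation leb := (@lebesgue_measure R).
Local Notation mR := (measurableTypeR R).

Lemma measurable_affine (c b : R) :
  measurable_fun setT (fun x : mR => (c * x + b : mR)).
Proof.
by apply: measurable_funD => //; exact: measurable_funM.
Qed.

(** The right-hand side is a measure in [A] with the correct value on half-open intervals, and
    Lebesgue measure is unique with that property. *)
Lemma lebesgue_measure_pos_affine (c b : R) (A : set mR) : 0 < c -> measurable A ->
  leb A = (c%:E * leb [set x | A (c * x + b)%R])%E.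
Proof.
move=> c0 mA.
pose nu := mscale (NngNum (ltW c0)) [the measure _ _ of
  measure_function_pushforward__canonical__measure_function_Measure leb
    (measurable_affine c b)].
apply: (@lebesgue_measure_unique _ nu) => // _ [[x y] _ <-].
pose I : set mR := `](x - b) / c, (y - b) / c]%classic.
transitivity (c%:E * leb I)%E.
  rewrite /I !lebesgue_measure_itv/= !lte_fin ltr_pM2r ?invr_gt0// ltrD2r.
  case: ifPn => _; last by rewrite mule0.
  by rewrite -!EFinB -EFinM; congr EFin; field; rewrite gt_eqF.
congr (_ * _)%E; congr (leb _).
by rewrite /I; apply/seteqP; split => z /=; rewrite !in_itv/= ltr_pdivrMr// ler_pdivlMr//
  (mulrC z) ltrBlDr lerBrDr.
Qed.

Lemma lebesgue_measure_affine (c b : R) (A : set mR) : c != 0 -> measurable A ->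
  leb A = (`|c|%:E * leb [set x | A (c * x + b)%R])%E.
Proof.
move=> c0 mA; have [cp|cn|ce] := ltgtP c 0; last by rewrite ce eqxx in c0.
  have mB : measurable ([set x | A (- c * x + b)%R] : set mR).
    rewrite -[X in measurable X]setTI; exact: (measurable_affine (- c) b).
  rewrite (@lebesgue_measure_pos_affine (- c) b)// ?oppr_gt0//; congr (_ * _)%E.
    by rewrite ltr0_norm.
  apply: etrans (esym (lebesgue_measureN mB)) _; congr (leb _).
  by apply/seteqP; split => x /=; rewrite mulrNN.
by rewrite gtr0_norm//; exact: lebesgue_measure_pos_affine.
Qed.

Lemma ge0_integral_affine (c b : R) (f : mR -> \bar R) : c != 0 ->
  measurable_fun setT f -> (forall x, 0 <= f x)%E ->
  (\int[leb]_x f (c * x + b)%R = `|c|^-1%:E * \int[leb]_x f x)%E.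
Proof.
move=> c0 mf f0.
have cge : 0 <= `|c| by [].
have cn : `|c| != 0 by rewrite normr_eq0.
pose push := [the measure _ _ of
  measure_function_pushforward__canonical__measure_function_Measure leb
    (measurable_affine c b)].
have -> : (\int[leb]_x f x = \int[mscale (NngNum cge) push]_x f x)%E.
  by apply: eq_measure_integral => A mA _; exact: lebesgue_measure_affine.
rewrite ge0_integral_mscale// muleA -EFinM mulVf// mul1e.
by rewrite ge0_integral_pushforward//; exact: measurable_affine.
Qed.

End affine1.

Section lebt_affine.
Variable R : realType.
Local Notation leb := (@lebesgue_measure R).
Local Notation mR := (measurableTypeR R).

Definition tset k (t : k.-tuple mR) (j : 'I_k) (x : mR) : k.-tuple mR :=
  [tuple if i == j then x else tnth t i | i < k].

Lemma measurable_tset k d (T : measurableType d) (t : T -> k.-tuple mR)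
    (j : 'I_k) (x : T -> mR) : measurable_fun setT t -> measurable_fun setT x ->
  measurable_fun setT (fun u => tset (t u) j (x u)).
Proof.
move=> mt mx; apply/measurable_fun_tnthP => i.
have [->|ij] := eqVneq i j.
  by rewrite (_ : _ \o _ = x)//; apply/funext => u /=; rewrite tnth_mktuple eqxx.
rewrite (_ : _ \o _ = (fun u => tnth (t u) i)); last first.
  by apply/funext => u /=; rewrite tnth_mktuple (negbTE ij).
exact: (measurableT_comp (@measurable_tnth _ _ _ i) mt).
Qed.

Lemma tset_tcons0 k x y (t : k.-tuple mR) :
  tset (tcons (x, t)) ord0 y = tcons (y, t).
Proof.
apply: eq_from_tnth => i; rewrite tnth_mktuple.
case: (unliftP ord0 i) => [j ->|->]; last by rewrite eqxx tnth0.
by rewrite eq_sym (negbTE (neq_lift _ _)) !tnthS.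
Qed.

Lemma tset_tconsS k x y (t : k.-tuple mR) j :
  tset (tcons (x, t)) (lift ord0 j) y = tcons (x, tset t j y).
Proof.
apply: eq_from_tnth => i; rewrite tnth_mktuple.
case: (unliftP ord0 i) => [l ->|->]; last by rewrite (negbTE (neq_lift _ _)) !tnth0.
by rewrite (inj_eq lift_inj) !tnthS tnth_mktuple.
Qed.

Lemma measurable_lebt_F k (h : k.+1.-tuple mR -> \bar R) :
  measurable_fun setT h -> (forall t, 0 <= h t)%E ->
  measurable_fun setT (fun x : mR => \int[lebt R k]_t h (tcons (x, t)))%E.
Proof.
move=> mh h0; have mc := measurableT_comp mh (@measurable_tcons R k).
exact: (@measurable_fun_fubini_tonelli_F _ _ _ _ _ (lebt R k) _ mc (fun z => h0 _)).
Qed.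

Lemma measurable_lebt_G k (h : k.+1.-tuple mR -> \bar R) :
  measurable_fun setT h -> (forall t, 0 <= h t)%E ->
  measurable_fun setT (fun t => \int[leb]_x h (tcons (x, t)))%E.
Proof.
move=> mh h0; have mc := measurableT_comp mh (@measurable_tcons R k).
exact: (@measurable_fun_fubini_tonelli_G _ _ _ _ _ leb _ mc (fun z => h0 _)).
Qed.

Lemma ge0_integral_lebtS_swap k (h : k.+1.-tuple mR -> \bar R) :
  measurable_fun setT h -> (forall t, 0 <= h t)%E ->
  (\int[lebt R k.+1]_t h t = \int[lebt R k]_t \int[leb]_x h (tcons (x, t)))%E.
Proof.
move=> mh h0; rewrite ge0_integral_lebtS//.
apply: (fubini_tonelli (h \o (@tcons R k))) => //=.
by apply: measurableT_comp => //; exact: measurable_tcons.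
Qed.

(** The shift may depend on all other coordinates, which makes this the elementary step of every
    triangular linear substitution. Tonelli isolates coordinate [j], where it is a one-dimensional
    affine change of variable. *)
Lemma ge0_integral_lebt_coord k (j : 'I_k) (c : R) (g : k.-tuple mR -> mR)
    (f : k.-tuple mR -> \bar R) : c != 0 ->
  measurable_fun setT f -> (forall t, 0 <= f t)%E ->
  measurable_fun setT g -> (forall t x, g (tset t j x) = g t) ->
  (\int[lebt R k]_t f (tset t j (c * tnth t j + g t)%R) =
   `|c|^-1%:E * \int[lebt R k]_t f t)%E.
Proof.
move=> c0; elim: k j g f => [[]//|k IH] j g f mf f0 mg gj.
have mF : measurable_fun setT (fun t => f (tset t j (c * tnth t j + g t))).
  apply: measurableT_comp => //; apply: measurable_tset => //.
  apply: measurable_funD => //; apply: measurable_funM => //.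
  exact: measurable_tnth.
case: (unliftP ord0 j) => [i|] ij; subst j.
  rewrite !ge0_integral_lebtS// -ge0_integralZl//=; last 2 first.
  - exact: (measurable_lebt_F mf f0).
  - by move=> x _; exact: integral_ge0.
  apply: eq_integral => x _.
  have mc := @measurable_tcons1 R k x.
  rewrite -(IH i (fun t => g (tcons (x, t))) (fun t => f (tcons (x, t))))//.
  - by apply: eq_integral => t _; rewrite tset_tconsS tnthS.
  - exact: (measurableT_comp mf mc).
  - exact: (measurableT_comp mg mc).
  - by move=> t y; rewrite -tset_tconsS.
rewrite !ge0_integral_lebtS_swap// -ge0_integralZl//=; last 2 first.
- exact: (measurable_lebt_G mf f0).
- by move=> x _; exact: integral_ge0.
apply: eq_integral => t _.
have mc : measurable_fun setT (fun x : mR => tcons (x, t)).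
  by apply: measurableT_comp; [exact: measurable_tcons|exact: measurable_pair2].
(* [g] does not see the first coordinate, so its value with 0 in that place is the constant shift
   for the inner integral. *)
rewrite -(@ge0_integral_affine _ c (g (tcons (0, t))) (fun x => f (tcons (x, t))))//.
  apply: eq_integral => x _; rewrite tset_tcons0 tnth0 -(tset_tcons0 0 x t).
  by rewrite gj.
exact: (measurableT_comp mf mc).
Qed.

Definition taff (k : nat) (c : R) (b t : k.-tuple mR) : k.-tuple mR :=
  [tuple (c * tnth t i + tnth b i : mR) | i < k].

Lemma measurable_taff k c (b : k.-tuple mR) : measurable_fun setT (taff c b).
Proof.
apply/measurable_fun_tnthP => i.
rewrite (_ : _ \o _ = (fun t : k.-tuple mR => (c * tnth t i + tnth b i : mR))).
  apply: measurable_funD => //; apply: measurable_funM => //.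
  exact: measurable_tnth.
by apply/funext => t /=; rewrite tnth_mktuple.
Qed.

Lemma ge0_integral_lebt_affine k (c : R) (b : k.-tuple mR)
    (f : k.-tuple mR -> \bar R) : c != 0 ->
  measurable_fun setT f -> (forall t, 0 <= f t)%E ->
  (\int[lebt R k]_t f (taff c b t) =
   (`|c| ^- k)%:E * \int[lebt R k]_t f t)%E.
Proof.
move=> c0; elim: k b f => [|k IH] b f mf f0.
  rewrite expr0 invr1 mul1e; apply: eq_integral => t _.
  by rewrite [taff c b t]tuple0 [t]tuple0.
have mt := measurableT_comp mf (measurable_taff c b).
rewrite ge0_integral_lebtS// ge0_integral_lebtS// exprS invfM EFinM.
pose b' := [tuple of behead b].
have taffS x t : taff c b (tcons (x, t)) = tcons (c * x + thead b, taff c b' t).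
  apply: eq_from_tnth => i; rewrite tnth_mktuple.
  case: (unliftP ord0 i) => [j ->|->]; last by rewrite !tnth0.
  by rewrite !tnthS tnth_mktuple [in LHS](tuple_eta b) tnthS.
have mF : measurable_fun setT (fun x => (\int[lebt R k]_t f (tcons (x, t)))%E).
  exact: (measurable_lebt_F mf f0).
rewrite [in RHS]muleAC [in RHS]muleC.
rewrite -(@ge0_integral_affine _ c (thead b)
  (fun x => (\int[lebt R k]_t f (tcons (x, t)))%E))//; last first.
  by move=> x; exact: integral_ge0.
rewrite -ge0_integralZl//=; last 2 first.
- exact: (measurableT_comp mF (measurable_affine c (thead b))).
- by move=> x _; exact: integral_ge0.
apply: eq_integral => x _; rewrite -(IH b')//.
  by apply: eq_integral => t _; rewrite taffS.
exact: (measurableT_comp mf (@measurable_tcons1 R k _)).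
Qed.

Lemma ge0_integral_lebt_prod k (f : mR -> R) (I : R) :
  measurable_fun setT f -> (forall x, 0 <= f x) ->
  (\int[leb]_x (f x)%:E = I%:E)%E ->
  (\int[lebt R k]_t (\prod_(i < k) f (tnth t i))%:E = (I ^+ k)%:E)%E.
Proof.
move=> mf f0 fI.
have mp m : measurable_fun setT
    (fun t : m.-tuple mR => (\prod_(i < m) f (tnth t i))%:E).
  apply/measurable_EFinP.
  apply: measurable_prodr => i.
  exact: (measurableT_comp mf (@measurable_tnth _ _ _ i)).
elim: k => [|k IH].
  rewrite integral_lebt0; last exact: mp.
  by rewrite big_ord0.
rewrite ge0_integral_lebtS; last 2 first.
- exact: mp.
- by move=> t; rewrite lee_fin prodr_ge0.
transitivity (\int[leb]_x ((f x)%:E * (I ^+ k)%:E))%E.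
  apply: eq_integral => x _; rewrite -IH -ge0_integralZl//=.
  - apply: eq_integral => t _; rewrite big_ord_recl tnth0 EFinM; congr (_ * _)%E.
    by congr EFin; apply: eq_bigr => i _; rewrite tnthS.
  - exact: mp.
  - by move=> t _; rewrite lee_fin prodr_ge0.
  - by rewrite lee_fin.
rewrite ge0_integralZr//=; last 3 first.
- exact/measurable_EFinP.
- by move=> x _; rewrite lee_fin.
- rewrite lee_fin exprn_ge0// -lee_fin -fI; apply: integral_ge0 => x _.
  by rewrite lee_fin.
by rewrite fI exprS EFinM.
Qed.

End lebt_affine.

(** * Matrices as tuples, and Lebesgue measure on them *)

Section matrix_index.
Variables n p : nat.

Lemma mxidx_subproof (a : 'I_n) (i : 'I_p) : (a * p + i < n * p)%N.
Proof.
apply: (@leq_trans (a * p + p)); first by rewrite ltn_add2l.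
by rewrite addnC -mulSn leq_mul2r ltn_ord orbT.
Qed.

(** Row-major position, the one at which [mx_of_seq] looks up the entry. *)
Definition mxidx a i : 'I_(n * p) := Ordinal (mxidx_subproof a i).

Lemma mxidx_gt0 (k : 'I_(n * p)) : (0 < p)%N.
Proof. by move: k; case: p => // k; move: (ltn_ord k); rewrite [X in (_ < X)%N]muln0. Qed.

Lemma mxrow_subproof (k : 'I_(n * p)) : (k %/ p < n)%N.
Proof. by rewrite ltn_divLR ?ltn_ord// (mxidx_gt0 k). Qed.

Lemma mxcol_subproof (k : 'I_(n * p)) : (k %% p < p)%N.
Proof. by rewrite ltn_pmod// (mxidx_gt0 k). Qed.

Definition idxrow k : 'I_n := Ordinal (mxrow_subproof k).
Definition idxcol k : 'I_p := Ordinal (mxcol_subproof k).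

Lemma mxidxE k : mxidx (idxrow k) (idxcol k) = k.
Proof. by apply: val_inj; rewrite /= -divn_eq. Qed.

Lemma idxrowE a i : idxrow (mxidx a i) = a.
Proof.
apply: val_inj; rewrite /= divnMDl ?divn_small ?addn0//.
exact: leq_ltn_trans (ltn_ord i).
Qed.

Lemma idxcolE a i : idxcol (mxidx a i) = i.
Proof. by apply: val_inj; rewrite /= modnMDl modn_small. Qed.

Lemma mxidx_eq a i b j : (mxidx a i == mxidx b j) = (a == b) && (i == j).
Proof.
apply/eqP/andP => [e|[/eqP-> /eqP->]//].
by split; apply/eqP; [rewrite -(idxrowE a i) e idxrowE|rewrite -(idxcolE a i) e idxcolE].
Qed.

End matrix_index.

Section measurable_matrix.
Variables (R : realType) (n p : nat).
Local Notation mR := (measurableTypeR R).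

Definition mx_tuple (M : 'M[R]_(n, p)) : (n * p).-tuple mR :=
  [tuple (M (idxrow k) (idxcol k) : mR) | k < n * p].

Definition tuple_mx (t : (n * p).-tuple mR) : 'M[R]_(n, p) :=
  \matrix_(a, i) tnth t (mxidx a i).

Lemma mx_tupleK : cancel mx_tuple tuple_mx.
Proof.
by move=> M; apply/matrixP => a i; rewrite mxE tnth_mktuple idxrowE idxcolE.
Qed.

Lemma tuple_mxK : cancel tuple_mx mx_tuple.
Proof. by move=> t; apply: eq_from_tnth => k; rewrite tnth_mktuple mxE mxidxE. Qed.

Lemma tuple_mxE t : tuple_mx t = mx_of_seq n p t.
Proof.
by apply/matrixP => a i; rewrite !mxE (tnth_nth 0).
Qed.

(** Pulling the sigma-algebra back along [mx_tuple] makes that bijection measurable by construction,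
    and its inverse too; measurability of matrix-valued maps then reduces to entries. *)
HB.instance Definition _ := Measurable.copy 'M[R]_(n, p)
  (g_sigma_algebra_preimageType mx_tuple).

Lemma measurable_mx_tuple : measurable_fun setT mx_tuple.
Proof. by move=> _ A mA; exists A. Qed.

Lemma measurable_tuple_mx : measurable_fun setT tuple_mx.
Proof.
move=> _ _ [B mB <-]; rewrite !setTI -comp_preimage.
rewrite (_ : mx_tuple \o tuple_mx = idfun)//.
by apply/funext => t /=; rewrite tuple_mxK.
Qed.

Lemma measurable_coord a i : measurable_fun setT (fun M : 'M[R]_(n, p) => (M a i : mR)).
Proof.
have := measurableT_comp (@measurable_tnth _ _ _ (mxidx a i)) measurable_mx_tuple.
by congr measurable_fun; apply/funext => M /=; rewrite tnth_mktuple idxrowE idxcolE.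
Qed.

Lemma measurable_fun_mx d (T : measurableType d) (f : T -> 'M[R]_(n, p)) :
  (forall a i, measurable_fun setT (fun x => (f x a i : mR))) -> measurable_fun setT f.
Proof.
move=> mf.
rewrite (_ : f = tuple_mx \o (mx_tuple \o f)); last first.
  by apply/funext => x /=; rewrite mx_tupleK.
apply: measurableT_comp; first exact: measurable_tuple_mx.
apply/measurable_fun_tnthP => k.
have := mf (idxrow k) (idxcol k); congr measurable_fun.
by apply/funext => x /=; rewrite tnth_mktuple.
Qed.

Definition lebmx : {sigma_finite_measure set 'M[R]_(n, p) -> \bar R} :=
  sfpush (lebt R (n * p)) measurable_tuple_mx measurable_mx_tuple tuple_mxK.

End measurable_matrix.

Section lebmx_integral.
Variables (R : realType) (n p : nat).
Local Notation mR := (measurableTypeR R).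
Local Notation V := 'M[R]_(n, p).
Local Notation lam := (lebmx R n p).
Implicit Type f : V -> \bar R.

Lemma ge0_integral_lebmx f : measurable_fun setT f -> (forall x, 0 <= f x)%E ->
  (\int[lam]_x f x = \int[lebt R (n * p)]_t f (tuple_mx t))%E.
Proof. exact: ge0_integral_sfpush. Qed.

(** The bridge from the iterated integrals in the definitions of estimator and risk to an honest
    measure. *)
Lemma mxintE (F : V -> R) : lam.-integrable setT (EFin \o F) ->
  mxint F = (\int[lam]_x (F x)%:E)%E.
Proof.
move=> iF; have mF := measurable_int _ iF.
have iFt : (lebt R (n * p)).-integrable setT ((EFin \o F) \o (@tuple_mx R n p)).
  apply/integrableP; split.
    exact: (measurableT_comp mF (@measurable_tuple_mx R n p)).
  have /integrableP[_] := iF.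
  rewrite ge0_integral_lebmx//.
  exact: measurableT_comp.
rewrite (integral_sfpush _ _ _ mF)//.
rewrite /mxint iintE.
  by apply: eq_integral => t _; rewrite /= tuple_mxE.
by apply: eq_integrable iFt => // t _; rewrite /= tuple_mxE.
Qed.

Definition mxset (M : V) a i (x : R) : V :=
  \matrix_(b, j) if (b == a) && (j == i) then x else M b j.

Lemma tuple_mx_tset t a i x : tuple_mx (tset t (mxidx a i) x) = mxset (tuple_mx t) a i x.
Proof.
by apply/matrixP => b j; rewrite !mxE tnth_mktuple mxidx_eq.
Qed.

Lemma measurable_mxset d (T : measurableType d) (M : T -> V) a i (x : T -> mR) :
  measurable_fun setT M -> measurable_fun setT x ->
  measurable_fun setT (fun u => mxset (M u) a i (x u)).
Proof.
move=> mM mx; apply: measurable_fun_mx => b j.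
under eq_fun do rewrite mxE.
case: ((b == a) && (j == i)) => //.
exact: (measurableT_comp (@measurable_coord R n p b j) mM).
Qed.

Lemma ge0_integral_lebmx_coord a i (c : R) (g : V -> mR) f : c != 0 ->
  measurable_fun setT f -> (forall x, 0 <= f x)%E ->
  measurable_fun setT g -> (forall M x, g (mxset M a i x) = g M) ->
  (\int[lam]_M f (mxset M a i (c * M a i + g M)%R) =
   `|c|^-1%:E * \int[lam]_M f M)%E.
Proof.
move=> c0 mf f0 mg gai.
have mt := @measurable_tuple_mx R n p.
rewrite !ge0_integral_lebmx//; last first.
  apply: measurableT_comp => //; apply: measurable_mxset => //.
  by apply: measurable_funD => //; apply: measurable_funM => //; exact: measurable_coord.
rewrite -(@ge0_integral_lebt_coord _ _ (mxidx a i) c (g \o (@tuple_mx R n p))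
  (f \o (@tuple_mx R n p)))//.
- by apply: eq_integral => t _ /=; rewrite tuple_mx_tset mxE.
- exact: (measurableT_comp mf mt).
- by move=> t /=.
- exact: (measurableT_comp mg mt).
- by move=> t x /=; rewrite tuple_mx_tset gai.
Qed.

Lemma measurable_mx_affine (c : R) (u : V) : measurable_fun setT (fun M : V => c *: M + u).
Proof.
apply: measurable_fun_mx => a i.
rewrite (_ : (fun _ => _) = (fun M : V => (c * M a i + u a i : mR))).
  by apply: measurable_funD => //; apply: measurable_funM => //; exact: measurable_coord.
by apply/funext => M; rewrite !mxE.
Qed.

Lemma ge0_integral_lebmx_affine (c : R) (u : V) f : c != 0 ->
  measurable_fun setT f -> (forall x, 0 <= f x)%E ->
  (\int[lam]_M f (c *: M + u)%R = (`|c| ^- (n * p))%:E * \int[lam]_M f M)%E.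
Proof.
move=> c0 mf f0.
have mt := @measurable_tuple_mx R n p.
rewrite !ge0_integral_lebmx//; last first.
  exact: (measurableT_comp mf (measurable_mx_affine c u)).
rewrite -(@ge0_integral_lebt_affine _ _ c (mx_tuple u) (f \o (@tuple_mx R n p)))//.
- apply: eq_integral => t _ /=; congr (f _).
  by apply/matrixP => a i; rewrite !mxE !tnth_mktuple idxrowE idxcolE.
- exact: (measurableT_comp mf mt).
- by move=> t /=.
Qed.

Lemma ge0_integral_lebmx_prod (h : mR -> R) (I : R) :
  measurable_fun setT h -> (forall x, 0 <= h x) ->
  (\int[@lebesgue_measure R]_x (h x)%:E = I%:E)%E ->
  (\int[lam]_M (\prod_a \prod_i h (M a i))%:E = (I ^+ (n * p))%:E)%E.
Proof.
move=> mh h0 hI.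
rewrite ge0_integral_lebmx//; last 2 first.
- apply/measurable_EFinP; apply: measurable_prodr => a; apply: measurable_prodr => i.
  exact: (measurableT_comp mh (@measurable_coord R n p a i)).
- by move=> M; rewrite lee_fin prodr_ge0// => a _; rewrite prodr_ge0.
rewrite -(@ge0_integral_lebt_prod _ (n * p) h I)//.
apply: eq_integral => t _; congr EFin.
rewrite pair_big/= (reindex (fun k : 'I_(n * p) => (idxrow k, idxcol k)))/=; last first.
  exists (fun u => mxidx u.1 u.2) => [k|[a i]] _ /=; first by rewrite mxidxE.
  by rewrite idxrowE idxcolE.
by apply: eq_bigr => k _; rewrite mxE mxidxE.
Qed.

End lebmx_integral.

(** * Column operations and splitting off one coordinate *)

Section column_operation.
Variables (R : realType) (n p : nat).
Local Notation mR := (measurableTypeR R).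
Local Notation V := 'M[R]_(n, p).
Local Notation lam := (lebmx R n p).
Variables (i : 'I_p) (c : R) (d : 'I_p -> R).

Let partial_colop (m : nat) (M : V) : V := \matrix_(b, j)
  if (j == i) && (b < m)%N then c * M b i + \sum_(k | k != i) d k * M b k
  else M b j.

Definition colop (M : V) : V := \matrix_(b, j)
  if j == i then c * M b i + \sum_(k | k != i) d k * M b k else M b j.

Let measurable_partial_colop m : measurable_fun setT (partial_colop m).
Proof.
have mc := @measurable_coord R n p.
apply: measurable_fun_mx => b j; under eq_fun do rewrite mxE.
case: ((j == i) && (b < m)%N); last exact: mc.
apply: measurable_funD; first by apply: measurable_funM => //; exact: mc.
by apply: measurable_sumr => k; apply: measurable_funM => //; exact: mc.
Qed.

(** [partial_colop m] has treated the first [m] rows. Each further row changes one entry by an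
    affine map whose shift involves only other columns, at the price of a factor 1/|c|. *)
Lemma ge0_integral_colop (f : V -> \bar R) : c != 0 ->
  measurable_fun setT f -> (forall x, 0 <= f x)%E ->
  (\int[lam]_M f (colop M) = (`|c| ^- n)%:E * \int[lam]_M f M)%E.
Proof.
move=> c0 mf f0; have mc := @measurable_coord R n p.
have -> : colop = partial_colop n.
  by apply/funext => M; apply/matrixP => b j; rewrite !mxE ltn_ord andbT.
suff H m : (m <= n)%N -> (\int[lam]_M f (partial_colop m M) =
    (`|c| ^- m)%:E * \int[lam]_M f M)%E by exact: H.
elim: m => [_|m IH mn].
  rewrite expr0 invr1 mul1e; apply: eq_integral => M _; congr f.
  by apply/matrixP => b j; rewrite !mxE andbF.
pose a := Ordinal mn.
rewrite exprS invfM EFinM -muleA -IH 1?ltnW//.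
rewrite -(@ge0_integral_lebmx_coord _ _ _ a i c
  (fun M => \sum_(k | k != i) d k * M a k) (fun M => f (partial_colop m M)))//.
- apply: eq_integral => M _; congr f; apply/matrixP => b j; rewrite !mxE.
  rewrite eqxx andbT ltnS leq_eqVlt.
  have [->|ba] /= := eqVneq b a; last first.
    have -> : (b == m :> nat) = false by apply/negbTE; apply: contra ba => /eqP ?; exact/eqP/val_inj.
    case: ifP => // _; congr (_ + _); apply: eq_bigr => k _.
    by rewrite !mxE (negbTE ba).
  rewrite ltnn eqxx orTb andbT andbF.
  by case: ifP.
- exact: (measurableT_comp mf (measurable_partial_colop m)).
- by apply: measurable_sumr => k; apply: measurable_funM => //; exact: mc.
- move=> M x; apply: eq_bigr => k ki; rewrite mxE (negbTE ki) andbF//.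
Qed.

End column_operation.

Section row_cons.
Variables (R : realType) (p : nat).
Local Notation mR := (measurableTypeR R).
Local Notation leb := (@lebesgue_measure R).

Definition rowcons (x : R) (y : 'rV[R]_p) : 'rV[R]_p.+1 :=
  \row_j oapp (y 0) x (unlift ord0 j).

Lemma rowcons0 x y a : rowcons x y a ord0 = x.
Proof. by rewrite mxE unlift_none. Qed.

Lemma rowconsS x y a j : rowcons x y a (lift ord0 j) = y 0 j.
Proof. by rewrite mxE liftK. Qed.

Lemma tuple_mx_tcons (x : mR) (t : (1 * p).-tuple mR) :
  tuple_mx (n := 1) (p := p.+1) (tcons (x, t)) = rowcons x (tuple_mx (n := 1) t).
Proof.
apply/matrixP => a j; rewrite [a]ord1.
by case: (unliftP ord0 j) => [k ->|->];
  rewrite ?rowcons0 ?rowconsS !mxE !(tnth_nth 0).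
Qed.

Lemma ge0_integral_rowcons (f : 'rV[R]_p.+1 -> \bar R) : measurable_fun setT f ->
  (forall x, 0 <= f x)%E ->
  (\int[lebmx R 1 p.+1]_v f v =
   \int[lebmx R 1 p]_y \int[leb]_x f (rowcons x y))%E.
Proof.
move=> mf f0; rewrite ge0_integral_lebmx//.
have mf' : measurable_fun setT (fun t : (1 * p).+1.-tuple mR => f (tuple_mx (n := 1) (p := p.+1) t)).
  exact: (measurableT_comp mf (@measurable_tuple_mx R 1 p.+1)).
rewrite (@ge0_integral_lebtS_swap _ (1 * p) _ mf')//.
have mrow : measurable_fun setT (fun z : 'rV[R]_p * mR => rowcons z.2 z.1).
  apply: measurable_fun_mx => a j.
  case: (unliftP ord0 j) => [k|] ->.
    under eq_fun do rewrite rowconsS.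
    exact: (measurableT_comp (@measurable_coord R 1 p 0 k)).
  under eq_fun do rewrite rowcons0.
  exact: measurable_snd.
rewrite ge0_integral_lebmx.
- by apply: eq_integral => t _; apply: eq_integral => x _; rewrite tuple_mx_tcons.
- exact: (@measurable_fun_fubini_tonelli_F _ _ _ _ _ leb _ (measurableT_comp mf mrow) (fun z => f0 _)).
- by move=> y; exact: integral_ge0.
Qed.

End row_cons.

Section gauss1.
Variable R : realType.
Local Notation leb := (@lebesgue_measure R).

Lemma integral_gauss_affine (a b : R) : 0 < a ->
  (\int[leb]_x (expR (- (a * (x + b) ^+ 2) / 2))%:E = (Num.sqrt (2 * pi) / Num.sqrt a)%:E)%E.
Proof.
move=> a0; pose c := Num.sqrt (a / 2).
have c0 : 0 < c by rewrite sqrtr_gt0 divr_gt0.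
have cE : c ^+ 2 = a / 2 by rewrite sqr_sqrtr// ltW// divr_gt0.
have := @ge0_integral_affine R c (c * b) (fun x => (gauss_fun x)%:E) (lt0r_neq0 c0).
rewrite integralT_gauss => H.
transitivity (`|c|^-1%:E * (Num.sqrt pi)%:E)%E; last first.
  rewrite -EFinM gtr0_norm//; congr EFin.
  rewrite /c sqrtrM 1?ltW// sqrtrM ?ltW// sqrtrV ?ltW//.
  by field; rewrite !sqrtr_eq0 -!ltNge a0/=.
rewrite -H.
- apply: eq_integral => x _; rewrite /gauss_fun; congr EFin; congr expR.
  by rewrite -mulrDr exprMn cE; field.
- by apply/measurable_EFinP; exact: measurable_gauss_fun.
- by move=> x; rewrite lee_fin gauss_fun_ge0.
Qed.

End gauss1.

(** * Gaussian integrals of quadratic forms *)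

Section gauss_quadratic.
Variable R : realType.
Local Notation leb := (@lebesgue_measure R).

Definition qform p (A : 'M[R]_p) (x : 'rV[R]_p) : R :=
  \sum_i \sum_j A i j * x 0 i * x 0 j.

Definition gauss_qint p (A : 'M[R]_p) : \bar R :=
  (\int[lebmx R 1 p]_x (expR (- qform A x / 2))%:E)%E.

Definition schur p (A : 'M[R]_p.+1) : 'M[R]_p := \matrix_(i, j)
  (A (lift ord0 i) (lift ord0 j) - A (lift ord0 i) 0 * A 0 (lift ord0 j) / A 0 0).

(** One step of Gaussian elimination, written as a block triangular factorisation. *)
Lemma det_schur p (A : 'M[R]_p.+1) : A 0 0 != 0 -> \det A = A 0 0 * \det (schur A).
Proof.
move=> a0.
have l0 (i : 'I_1) : (lshift p i : 'I_p.+1) = 0 by apply: val_inj; rewrite [i]ord1.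
have rl j : (rshift 1 j : 'I_p.+1) = lift ord0 j by apply: val_inj.
pose c : 'cV[R]_p := \col_i (A (lift ord0 i) 0 / A 0 0).
pose r : 'rV[R]_p := \row_j A 0 (lift ord0 j).
have AE : (A : 'M[R]_(1 + p)) =
    block_mx 1%:M 0 c 1%:M *m block_mx (A 0 0)%:M r 0 (schur A).
  rewrite mulmx_block !mul1mx !mul0mx !addr0 mul_mx_scalar.
  rewrite -[LHS](@submxK R 1 p 1 p); congr block_mx; apply/matrixP => i j; rewrite !mxE.
  - by rewrite !ord1 l0 mulr1n.
  - by rewrite !ord1 l0 rl.
  - by rewrite ord1 l0 rl mulrC divfK.
  - by rewrite !rl !big_ord1 !mxE; field.
rewrite [LHS](congr1 determinant AE) det_mulmx det_lblock det_ublock !det1 !mul1r.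
by rewrite det_scalar expr1.
Qed.

Lemma qform_rowcons p (A : 'M[R]_p.+1) x y : A^T = A ->
  qform A (rowcons x y) = A 0 0 * x ^+ 2 +
    x * (\sum_j A 0 (lift ord0 j) * y 0 j) *+ 2 +
    \sum_i \sum_j A (lift ord0 i) (lift ord0 j) * y 0 i * y 0 j.
Proof.
move=> sA; rewrite /qform big_ord_recl.
have As i : A (lift ord0 i) 0 = A 0 (lift ord0 i) by rewrite -[in LHS]sA mxE.
set b := \sum_j A 0 (lift ord0 j) * y 0 j; set Q := \sum_i \sum_j A (lift ord0 i) (lift ord0 j) * y 0 i * y 0 j.
transitivity ((A 0 0 * x ^+ 2 + x * b) + (x * b + Q)); last by ring.
congr (_ + _).
  rewrite big_ord_recl rowcons0; congr (_ + _); first by rewrite -mulrA.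
  by rewrite /b mulr_sumr; apply: eq_bigr => j _; rewrite rowconsS; rewrite -!mulrA mulrCA.
rewrite /b mulr_sumr -big_split/=; apply: eq_bigr => i _.
rewrite big_ord_recl rowcons0 !rowconsS As; congr (_ + _); first by rewrite mulrC.
by apply: eq_bigr => j _; rewrite rowconsS.
Qed.

(** Completing the square in the first coordinate; the shift of [x] disappears under integration
    over the line. *)
Lemma qform_schur p (A : 'M[R]_p.+1) x y : A^T = A -> A 0 0 != 0 ->
  qform A (rowcons x y) =
    A 0 0 * (x + (\sum_j A 0 (lift ord0 j) * y 0 j) / A 0 0) ^+ 2 + qform (schur A) y.
Proof.
move=> sA a0; rewrite qform_rowcons// /qform.
have As i : A (lift ord0 i) 0 = A 0 (lift ord0 i) by rewrite -[in LHS]sA mxE.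
set b := \sum_j A 0 (lift ord0 j) * y 0 j.
have -> : \sum_i \sum_j schur A i j * y 0 i * y 0 j =
    \sum_i \sum_j A (lift ord0 i) (lift ord0 j) * y 0 i * y 0 j - b ^+ 2 / A 0 0.
  rewrite expr2 {2}/b mulr_sumr mulr_suml -sumrB; apply: eq_bigr => i _.
  rewrite /b !mulr_suml -sumrB; apply: eq_bigr => j _.
  by rewrite !mxE As; field.
by field.
Qed.

Lemma measurable_qform p (A : 'M[R]_p) : measurable_fun setT (qform A).
Proof.
apply: measurable_sumr => i; apply: measurable_sumr => j.
apply: measurable_funM; last exact: measurable_coord.
by apply: measurable_funM => //; exact: measurable_coord.
Qed.

Lemma measurable_gauss_qform p (A : 'M[R]_p) :
  measurable_fun setT (fun x => (expR (- qform A x / 2))%:E).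
Proof.
apply/measurable_EFinP; apply: measurableT_comp => //.
by apply: measurable_funM => //; apply: measurable_funN; exact: measurable_qform.
Qed.

(* The value [+oo] in the degenerate case is what makes the set of matrices of
   deficient rank negligible. *)
Lemma gauss_qintE p (A : 'M[R]_p) : A^T = A -> (forall x, 0 <= qform A x) ->
  0 <= \det A /\ gauss_qint A =
    if \det A == 0 then +oo%E else (Num.sqrt (2 * pi) ^+ p / Num.sqrt (\det A))%:E.
Proof.
elim: p A => [|p IH] A sA pA.
  rewrite det_mx00 oner_eq0 sqrtr1 expr0 divr1; split=> //.
  rewrite /gauss_qint ge0_integral_lebmx//; last exact: measurable_gauss_qform.
  rewrite integral_lebt0; first by rewrite /qform big_ord0 oppr0 mul0r expR0.
  exact: (measurableT_comp (measurable_gauss_qform A) (@measurable_tuple_mx R 1 0)).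
have As i j : A i j = A j i by rewrite -[in LHS]sA mxE.
pose b (y : 'rV[R]_p) := \sum_j A 0 (lift ord0 j) * y 0 j.
have sqrt2pi_gt0 : 0 < Num.sqrt (2 * pi) :> R by rewrite sqrtr_gt0 mulr_gt0// pi_gt0.
have a0 : 0 <= A 0 0.
  have := pA (rowcons 1 0); rewrite qform_rowcons//.
  rewrite [X in _ + X]big1; last by move=> i _; rewrite big1// => j _; rewrite !mxE !mulr0.
  rewrite [X in _ * X *+ _]big1; last by move=> j _; rewrite mxE mulr0.
  by rewrite mulr0 mul0rn !addr0 expr1n mulr1.
rewrite /gauss_qint ge0_integral_rowcons//; last exact: measurable_gauss_qform.
have [a_eq0|an0] := eqVneq (A 0 0) 0.
  pose D : 'M[R]_p := \matrix_(i, j) A (lift ord0 i) (lift ord0 j).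
  have DE y : qform D y = \sum_i \sum_j A (lift ord0 i) (lift ord0 j) * y 0 i * y 0 j.
    by apply: eq_bigr => i _; apply: eq_bigr => j _; rewrite mxE.
  have qE x y : qform A (rowcons x y) = x * b y *+ 2 + qform D y.
    by rewrite qform_rowcons// a_eq0 mul0r add0r DE.
  have b0 j : A 0 (lift ord0 j) = 0.
    (* With a zero corner the form is affine in [x] with slope [2 b y], so nonnegativity forces [b]
       to vanish. Taking for [y] the first row itself turns [b y] into the sum of its squares. *)
    pose y : 'rV[R]_p := \row_j A 0 (lift ord0 j).
    have y0 k : 0 <= A 0 (lift ord0 k) * y 0 k by rewrite mxE -expr2 sqr_ge0.
    suff /eqP : b y = 0.
      rewrite /b psumr_eq0// => /allP/(_ j); rewrite mem_index_enum => /(_ isT) /eqP.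
      by rewrite mxE -expr2 => /eqP; rewrite sqrf_eq0 => /eqP.
    have by0 : 0 <= b y by exact: sumr_ge0.
    apply/eqP; rewrite eq_le by0 andbT leNgt; apply/negP => byp.
    (* At this first coordinate the form takes the value -1. *)
    have := pA (rowcons (- (qform D y + 1) / (b y *+ 2)) y); rewrite qE leNgt => /negP; apply.
    have -> : - (qform D y + 1) / (b y *+ 2) * b y *+ 2 = - (qform D y + 1).
      by field; rewrite gt_eqF.
    by lra.
  have byE y : b y = 0 by rewrite /b big1// => j _; rewrite b0 mul0r.
  have -> : \det A = 0.
    rewrite (expand_det_row _ 0) big1// => j _.
    by case: (unliftP ord0 j) => [k ->|->]; rewrite ?b0 ?a_eq0 mul0r.
  rewrite eqxx; split=> //.
  have sD : D^T = D by apply/matrixP => i j; rewrite !mxE.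
  have pD y : 0 <= qform D y by have := pA (rowcons 0 y); rewrite qE mul0r mul0rn add0r.
  (* The integrand no longer depends on [x], so the inner integral over the line is infinite; the
     outer one is positive, hence the value [+oo]. *)
  transitivity (\int[lebmx R 1 p]_y (+oo * (expR (- qform D y / 2))%:E))%E.
    apply: eq_integral => y _.
    under eq_integral => x _ do rewrite qE byE mulr0 mul0rn add0r.
    rewrite integral_cst//= -set_itvNyy lebesgue_measure_itv/=.
    by rewrite muleC.
  rewrite ge0_integralZl//; last exact: measurable_gauss_qform.
  have [_] := IH D sD pD; rewrite /gauss_qint => ->.
  case: ifP => d0; first by rewrite mulyy.
  by rewrite gt0_mulye// lte_fin divr_gt0 ?exprn_gt0// sqrtr_gt0 lt_def d0 (IH D sD pD).1.
have {a0 an0} a0 : 0 < A 0 0 by rewrite lt_def an0.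
have an0 : A 0 0 != 0 by rewrite gt_eqF.
have sS : (schur A)^T = schur A.
  apply/matrixP => i j; rewrite !mxE (As (lift ord0 j) (lift ord0 i)) (As (lift ord0 j) 0) (As 0 (lift ord0 i)).
  by congr (_ - _ / _); exact: mulrC.
have pS y : 0 <= qform (schur A) y.
  (* This first coordinate makes the completed square vanish and leaves the Schur form alone. *)
  have := pA (rowcons (- (b y / A 0 0)) y); rewrite qform_schur//.
  by rewrite addNr expr0n mulr0 add0r.
have [dS SE] := IH _ sS pS.
rewrite det_schur//; split; first by rewrite mulr_ge0// ltW.
transitivity ((Num.sqrt (2 * pi) / Num.sqrt (A 0 0))%:E * gauss_qint (schur A))%E.
  rewrite /gauss_qint -ge0_integralZl//; last exact: measurable_gauss_qform.
  apply: eq_integral => y _; rewrite -(integral_gauss_affine (b y / A 0 0) a0).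
  rewrite -ge0_integralZr//; last first.
    apply/measurable_EFinP; apply: measurableT_comp => //.
    apply: measurable_funM => //; apply: measurable_funN => //.
    by apply: measurable_funM => //; apply: measurable_funX; exact: measurable_funD.
  apply: eq_integral => x _; rewrite -EFinM -expRD qform_schur//.
  by congr EFin; congr expR; rewrite -/(b y); field.
rewrite SE mulf_eq0 (negbTE an0)/=; case: ifP => [_|d0].
  by rewrite gt0_muley// lte_fin divr_gt0// sqrtr_gt0.
rewrite -EFinM (sqrtrM _ (ltW a0)) exprS; congr EFin.
by field; rewrite !gt_eqF// sqrtr_gt0// lt_def d0.
Qed.

End gauss_quadratic.

(** * Integrability of the priors *)

Section power_tail.
Variable R : realType.
Local Notation mR := (measurableTypeR R).
Local Notation leb := (@lebesgue_measure R).

(** An envelope integrable on the line for [q > 1]. A product of such factors over the coordinates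
    bounds a power decay in the largest coordinate while still integrating coordinate by
    coordinate. *)
Definition power_tail (q t : R) : R := if `|t| <= 1 then 1 else `|t| `^ (- q).

Lemma power_tail_ge0 q t : 0 <= power_tail q t.
Proof. by rewrite /power_tail; case: ifP => // _; exact: powR_ge0. Qed.

Lemma measurable_power_tail q : measurable_fun setT (power_tail q : mR -> R).
Proof.
apply: measurable_fun_ifT => //.
- by apply: measurable_fun_ler => //; exact: normr_measurable.
- by apply: (measurableT_comp (measurable_powR (- q))); exact: normr_measurable.
Qed.

Lemma powRN_cvg0 (b : R) : 0 < b -> x `^ (- b) @[x --> +oo] --> 0.
Proof.
move=> b0; apply/cvgrPdist_le => e e0; near=> x.
have ye : 0 < e `^ (- b^-1) by rewrite powR_gt0.
have xe : e `^ (- b^-1) <= x by near: x; apply: nbhs_pinfty_ge; exact: num_real.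
rewrite sub0r normrN ger0_norm ?powR_ge0// powRN.
rewrite -[leRHS]invrK lef_pV2 ?posrE ?invr_gt0// ?powR_gt0 ?(lt_le_trans ye xe)//.
have -> : e^-1 = (e `^ (- b^-1)) `^ b.
  by rewrite -powRrM mulNr mulVf ?gt_eqF// powR_inv1// ltW.
by apply: ge0_ler_powR => //; rewrite ?nnegrE ltW// (lt_le_trans ye xe).
Unshelve. all: by end_near. Qed.

Lemma integral_powRN_lty (q : R) : 1 < q ->
  (\int[leb]_(x in `[1%R, +oo[) (x `^ (- q))%:E < +oo)%E.
Proof.
move=> q1; have b0 : 0 < q - 1 by rewrite subr_gt0.
pose F (x : R) := - (q - 1)^-1 * x `^ (- (q - 1)).
have dF (x : R) : 0 < x -> is_derive x 1 F (x `^ (- q)).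
  move=> x0; have H := is_derive1_powR (- (q - 1)) x0.
  apply: is_derive_eq.
  by rewrite -[LHS]/(_ * _) mulrA mulrNN mulVf ?gt_eqF// mul1r; congr powR; ring.
have cpow (x : R) (r : R) : 0 < x -> {for x, continuous (fun y : R => y `^ r)}.
  move=> x0; apply: differentiable_continuous; apply/derivable1_diffP.
  by apply: derivable_powR; rewrite in_itv/= andbT.
rewrite (@ge0_continuous_FTC2y R _ F 1 0).
- by rewrite -EFinB ltry.
- by move=> x _; exact: powR_ge0.
- apply: continuous_in_subspaceT => x; rewrite inE/= in_itv/= andbT => x1.
  by apply: cpow; exact: lt_le_trans x1.
- rewrite -[X in _ --> X](mulr0 (- (q - 1)^-1)).
  by apply: cvgM; [exact: cvg_cst|exact: powRN_cvg0].
- by move=> x x1; have /@ex_derive := dF x (lt_trans ltr01 x1); exact.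
- apply: cvg_at_right_filter.
  by apply: cvgM; [exact: cvg_cst|exact: cpow].
- move=> x; rewrite in_itv/= andbT => x1; rewrite derive1E.
  by have [_] := dF x (lt_trans ltr01 x1).
Qed.

Lemma integral_power_tail_lty (q : R) : 1 < q ->
  (\int[leb]_x (power_tail q x)%:E < +oo)%E.
Proof.
move=> q1.
pose I : set mR := `[(-1)%R, 1%R]%classic; pose J : set mR := `[1%R, +oo[%classic.
pose g (x : mR) : \bar R := ((fun x : mR => (x `^ (- q))%:E) \_ J) x.
have mI : measurable I by exact: measurable_itv.
have mJ : measurable J by exact: measurable_itv.
have g0 x : (0 <= g x)%E.
  by rewrite /g patchE; case: ifP => // _; rewrite lee_fin powR_ge0.
have mg : measurable_fun setT g.
  apply/(measurable_restrictT _ mJ); apply/measurable_EFinP.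
  exact: measurable_funTS (measurable_powR (- q)).
have gN : (\int[leb]_x g (- x)%R = \int[leb]_x g x)%E.
  have N1 : -1 != 0 :> R by rewrite oppr_eq0 oner_eq0.
  have := @ge0_integral_affine R (-1) 0 g N1 mg g0.
  rewrite normrN1 invr1 mul1e => <-.
  by apply: eq_integral => x _; rewrite mulN1r addr0.
have gfin : (\int[leb]_x g x < +oo)%E.
  by rewrite /g -integral_mkcond; exact: integral_powRN_lty.
have gE x : 1 <= x -> (x `^ (- q))%:E = g x.
  by move=> x1; rewrite /g patchE mem_set//= /J/= in_itv/= andbT.
have lI : (leb I < +oo)%E.
  by rewrite /I lebesgue_measure_itv/=; case: ifP; rewrite ltry.
clearbody g.
have mgN : measurable_fun setT (fun x : mR => g (- x)%R).
  exact: (measurableT_comp mg (@oppr_measurable R setT)).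
have mind : measurable_fun setT (fun x : mR => (\1_I x)%:E : \bar R).
  by apply/measurable_EFinP; exact: measurable_indic.
have mgg : measurable_fun setT (fun x : mR => g x + g (- x)%R)%E.
  exact: emeasurable_funD.
have gg0 x : (0 <= g x + g (- x)%R)%E by rewrite adde_ge0.
have ind0 x : (0 <= (\1_I x)%:E :> \bar R)%E by rewrite lee_fin.
apply: (@le_lt_trans _ _ (\int[leb]_x ((\1_I x)%:E + (g x + g (- x)%R)))%E).
  apply: ge0_le_integral; first exact: measurableT.
  - by move=> x _; rewrite lee_fin power_tail_ge0.
  - by apply/measurable_EFinP; exact: measurable_power_tail.
  - exact: emeasurable_funD.
  - move=> x _; rewrite /power_tail indicE.
    case: ifPn => x1.
      have -> : x \in I by rewrite inE /I/= in_itv/= -ler_norml.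
      exact: leeDl.
    rewrite -ltNge in x1.
    apply: (@le_trans _ _ (g x + g (- x)%R)%E); last by apply: leeDr; rewrite lee_fin.
    rewrite gE; last exact: ltW.
    have [x0|x0] := ger0P x; first exact: leeDl.
    exact: leeDr.
rewrite ge0_integralD; [|exact: measurableT|by []|exact: mind|by []|exact: mgg].
rewrite ge0_integralD; [|exact: measurableT|by []|exact: mg|by []|exact: mgN].
rewrite gN integral_indic// setIT.
by apply: lte_add_pinfty => //; exact: lte_add_pinfty.
Qed.

End power_tail.

(** * Gram determinants under a Gaussian weight *)

Section gram.
Variable R : realType.
Local Notation mR := (measurableTypeR R).

Lemma measurable_det d (T : measurableType d) p (f : T -> 'M[R]_p) :
  (forall i j, measurable_fun setT (fun x => f x i j)) ->
  measurable_fun setT (fun x => \det (f x)).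
Proof.
move=> mf; apply: measurable_sumr => s; apply: measurable_funM => //.
by apply: measurable_prodr => i; exact: mf.
Qed.

Variables n p : nat.
Local Notation V := 'M[R]_(n, p).
Implicit Type M : V.

Definition gram_det M : R := \det (M^T *m M).

Lemma measurable_frob2 : measurable_fun setT (@frob2 R n p).
Proof.
apply: measurable_sumr => a; apply: measurable_sumr => i.
by apply: measurable_funX; exact: measurable_coord.
Qed.

Lemma measurable_gram_det : measurable_fun setT gram_det.
Proof.
apply: measurable_det => i j; under eq_fun do rewrite mxE.
apply: measurable_sumr => a; under eq_fun do rewrite mxE.
by apply: measurable_funM; exact: measurable_coord.
Qed.

Lemma frob2_ge0 M : 0 <= frob2 M.
Proof. by apply: sumr_ge0 => a _; apply: sumr_ge0 => i _; exact: sqr_ge0. Qed.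

Lemma qform_gram M x : qform (M^T *m M) x = \sum_a (\sum_i M a i * x 0 i) ^+ 2.
Proof.
rewrite /qform.
under eq_bigr => i _ do under eq_bigr => j _ do rewrite mxE 2!mulr_suml.
under eq_bigr => i _ do rewrite exchange_big.
rewrite exchange_big; apply: eq_bigr => a _.
rewrite expr2 mulr_suml; apply: eq_bigr => i _.
rewrite mulr_sumr; apply: eq_bigr => j _; rewrite mxE; ring.
Qed.

Lemma qform_gram_ge0 M x : 0 <= qform (M^T *m M) x.
Proof. by rewrite qform_gram; apply: sumr_ge0 => a _; exact: sqr_ge0. Qed.

Lemma gram_sym M : (M^T *m M)^T = M^T *m M.
Proof. by rewrite trmx_mul trmxK. Qed.

Lemma gram_det_ge0 M : 0 <= gram_det M.
Proof. by have [] := gauss_qintE (gram_sym M) (qform_gram_ge0 M). Qed.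

Lemma gram_det_mulmx M (T : 'M[R]_p) : gram_det (M *m T) = \det T ^+ 2 * gram_det M.
Proof.
by rewrite /gram_det trmx_mul -mulmxA det_mulmx mulmxA det_mulmx det_tr; ring.
Qed.

Lemma gram_detZ (c : R) M : gram_det (c *: M) = c ^+ (2 * p) * gram_det M.
Proof. by rewrite -mul_mx_scalar gram_det_mulmx det_scalar -exprM mulnC. Qed.

Lemma frob2Z (c : R) M : frob2 (c *: M) = c ^+ 2 * frob2 M.
Proof.
rewrite /frob2 mulr_sumr; apply: eq_bigr => a _; rewrite mulr_sumr.
by apply: eq_bigr => i _; rewrite mxE exprMn.
Qed.

(** The operation is right multiplication by a matrix of determinant [c]. *)
Lemma gram_det_colop i (c : R) (d : 'I_p -> R) M :
  gram_det (colop i c d M) = c ^+ 2 * gram_det M.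
Proof.
pose T : 'M[R]_p := \matrix_(k, j)
  if j == i then (if k == i then c else d k) else (k == j)%:R.
have -> : colop i c d M = M *m T.
  apply/matrixP => a j; rewrite !mxE.
  have [->|ji] := eqVneq j i.
    rewrite [RHS](bigD1 i)//= mxE !eqxx mulrC; congr (_ + _).
    by apply: eq_bigr => k ki; rewrite mxE eqxx (negbTE ki) mulrC.
  rewrite [RHS](bigD1 j)//= mxE (negbTE ji) eqxx mulr1 big1 ?addr0// => k kj.
  by rewrite mxE (negbTE ji) (negbTE kj) mulr0.
rewrite gram_det_mulmx; congr (_ ^+ 2 * _).
(* Row [i] of [T] has only its diagonal entry [c], and the complementary minor is the identity. *)
rewrite (expand_det_row _ i) (bigD1 i)//= big1 ?addr0.
  rewrite mxE !eqxx /cofactor addnn -signr_odd odd_double expr0 mul1r.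
  rewrite (_ : row' i (col' i T) = 1%:M) ?det1 ?mulr1//.
  apply/matrixP => k j; rewrite !mxE.
  by rewrite eq_sym (negbTE (neq_lift i j)) (inj_eq lift_inj).
by move=> j ji; rewrite mxE (negbTE ji) eq_sym (negbTE ji) mul0r.
Qed.

Definition gauss_det (s : nat) M : R :=
  expR (- frob2 M / 2) * gram_det M `^ (- (s%:R / 2)).

Lemma gauss_det_ge0 s M : 0 <= gauss_det s M.
Proof. by rewrite mulr_ge0 ?expR_ge0 ?powR_ge0. Qed.

Lemma measurable_gauss_det s : measurable_fun setT (gauss_det s).
Proof.
apply: measurable_funM.
  apply: measurableT_comp => //; apply: measurable_funM => //.
  by apply: measurable_funN; exact: measurable_frob2.
exact: (measurableT_comp (measurable_powR _) measurable_gram_det).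
Qed.

(** Integrating over [x] gives a constant times [gauss_det s.+1] where the Gram determinant is
    nonzero; integrating over [M] first gives a function decaying in [x]. Comparing the two orders
    raises [s] by one. *)
Definition gauss_det_lin s (x : 'rV[R]_p) M : R :=
  gauss_det s M * expR (- qform (M^T *m M) x / 2).

Local Notation lam := (lebmx R n p).

Lemma measurable_gauss_det_lin2 s :
  measurable_fun setT (fun z : V * 'rV[R]_p => gauss_det_lin s z.2 z.1).
Proof.
apply: measurable_funM; first exact: (measurableT_comp (measurable_gauss_det s) measurable_fst).
apply: measurableT_comp => //; apply: measurable_funM => //.
apply: measurable_funN; under eq_fun do rewrite qform_gram.
apply: measurable_sumr => a; apply: measurable_funX; apply: measurable_sumr => i.
apply: measurable_funM.
  exact: (measurableT_comp (@measurable_coord R n p a i) measurable_fst).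
exact: (measurableT_comp (@measurable_coord R 1 p 0 i) measurable_snd).
Qed.

Lemma gauss_det_lin_ge0 s x M : 0 <= gauss_det_lin s x M.
Proof. by rewrite mulr_ge0 ?gauss_det_ge0 ?expR_ge0. Qed.

Lemma measurable_gauss_det_lin s x : measurable_fun setT (gauss_det_lin s x).
Proof.
exact: (measurableT_comp (measurable_gauss_det_lin2 s) (measurable_pair2 x)).
Qed.

Lemma frob2_colop i (c : R) (d : 'I_p -> R) M :
  frob2 (colop i c d M) + \sum_a M a i ^+ 2 =
  frob2 M + \sum_a (c * M a i + \sum_(k | k != i) d k * M a k) ^+ 2.
Proof.
rewrite /frob2 -!big_split/=; apply: eq_bigr => a _.
rewrite (bigD1 i)//= [X in _ = X + _](bigD1 i)//= mxE eqxx.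
have -> : \sum_(j < p | j != i) colop i c d M a j ^+ 2 = \sum_(j < p | j != i) M a j ^+ 2.
  by apply: eq_bigr => j ji; rewrite mxE (negbTE ji).
by ring.
Qed.

(* Substituting [m_i -> (m_i - sum_(k != i) x_k m_k) / x_i] in column [i] turns
   [M x] into [m_i] and leaves the other columns unchanged. *)
Lemma integral_gauss_det_lin s (x : 'rV[R]_p) (i : 'I_p) : (s <= n)%N -> x 0 i != 0 ->
  (\int[lam]_M (gauss_det_lin s x M)%:E <=
   (`|x 0 i| ^- (n - s))%:E * \int[lam]_M (gauss_det s M)%:E)%E.
Proof.
move=> sn xi0; set c := (x 0 i)^-1; pose d k := - (x 0 k / x 0 i).
have c0 : c != 0 by rewrite invr_eq0.
have mF := measurable_gauss_det_lin s x.
have axi : 0 < `|x 0 i| by rewrite normr_gt0.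
have H : (\int[lam]_M (gauss_det_lin s x M)%:E = (`|x 0 i| ^- n)%:E *
    \int[lam]_M (gauss_det_lin s x (colop i c d M))%:E)%E.
  have := @ge0_integral_colop _ _ _ i c d (fun M => (gauss_det_lin s x M)%:E) c0.
  move=> ->; first last.
  - by move=> M; rewrite lee_fin gauss_det_lin_ge0.
  - exact/measurable_EFinP.
  rewrite muleA -EFinM /c normfV exprVn invrK mulVf ?mul1e// expf_neq0// gt_eqF//.
rewrite H (_ : (`|x 0 i| ^- (n - s))%:E = (`|x 0 i| ^- n)%:E * (`|x 0 i| ^+ s)%:E)%E; last first.
  rewrite -EFinM; congr EFin; rewrite -{2}(subnK sn) exprD invfM.
  by rewrite -mulrA mulVf ?mulr1// expf_neq0// gt_eqF.
rewrite -muleA; apply: lee_wpmul2l; first by rewrite lee_fin invr_ge0 exprn_ge0.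
rewrite -ge0_integralZl//; last 2 first.
- exact/measurable_EFinP/measurable_gauss_det.
- by move=> M _; rewrite lee_fin gauss_det_ge0.
apply: ge0_le_integral => //.
- by move=> M _; rewrite lee_fin gauss_det_lin_ge0.
- apply/measurable_EFinP; apply: (measurableT_comp mF).
  apply: measurable_fun_mx => a j; under eq_fun do rewrite mxE.
  case: (j == i); last exact: measurable_coord.
  apply: measurable_funD; first by apply: measurable_funM => //; exact: measurable_coord.
  by apply: measurable_sumr => k; apply: measurable_funM => //; exact: measurable_coord.
- by apply/measurable_EFinP; apply: measurable_funM => //; exact: measurable_gauss_det.
move=> M _; rewrite -EFinM lee_fin.
rewrite /gauss_det_lin /gauss_det gram_det_colop qform_gram.
rewrite powRM ?sqr_ge0 ?gram_det_ge0//.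
(* The determinant gives back [s] of the [n] powers of 1/|x_i| contributed by the Jacobian, whence
   the exponent [n - s]. *)
have -> : (c ^+ 2) `^ (- (s%:R / 2)) = `|x 0 i| ^+ s.
  have -> : c ^+ 2 = `|x 0 i| `^ (- 2%:R).
    by rewrite powR_invn// real_normK ?num_real// /c exprVn.
  by rewrite -powRrM -powR_mulrn//; congr powR; field.
have aux (t G E1 E2 E3 : R) : 0 <= t -> 0 <= G -> E1 * E2 <= E3 ->
    E1 * (t * G) * E2 <= t * (E3 * G).
  move=> t0 G0 E123; rewrite (_ : _ * E2 = t * G * (E1 * E2)); last by ring.
  by rewrite (mulrC E3) [leRHS]mulrA; apply: ler_wpM2l => //; exact: mulr_ge0.
apply: aux; [exact: exprn_ge0|exact: powR_ge0|].
rewrite -expRD ler_expR.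
have -> : \sum_a (\sum_k colop i c d M a k * x 0 k) ^+ 2 = \sum_a M a i ^+ 2.
  apply: eq_bigr => a _; congr (_ ^+ 2).
  rewrite (bigD1 i)//= mxE eqxx mulrDl mulr_suml -addrA -big_split/= big1.
    by rewrite addr0 mulrAC mulVf// mul1r.
  by move=> k ki; rewrite mxE (negbTE ki) /d; field.
(* The factor coming from [M x] now supplies the Gaussian weight of column [i], while the weight of
   the substituted column is bounded by 1. *)
rewrite -mulrDl ler_pM2r ?invr_gt0// -opprD lerN2 frob2_colop.
by rewrite lerDl; apply: sumr_ge0 => a _; exact: sqr_ge0.
Qed.

End gram.

Section gram_integrability.
Variables (R : realType) (n p : nat).
Local Notation V := 'M[R]_(n, p).
Local Notation lam := (lebmx R n p).
Local Notation leb := (@lebesgue_measure R).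
Implicit Type M : V.

Definition int_gauss_det s : \bar R := (\int[lam]_M (gauss_det s M)%:E)%E.

(** Apply [integral_gauss_det_lin] at the coordinate of largest modulus. Since p (1 + 2/p) = p + 2
    <= n - s, the decay obtained can be shared among all [p] coordinates with an exponent still
    greater than 1. *)
Lemma int_gauss_det_lin_bound s (x : 'rV[R]_p) : (0 < p)%N -> (s + p + 2 <= n)%N ->
  (\int[lam]_M (gauss_det_lin s x M)%:E <=
   int_gauss_det s * (\prod_a \prod_i power_tail (1 + 2 / p%:R) (x a i))%:E)%E.
Proof.
move=> p0 spn; rewrite big_ord1; set q := 1 + 2 / p%:R.
have pR : 0 < p%:R :> R by rewrite ltr0n.
have q0 : 0 < q by rewrite addr_gt0// divr_gt0.
have J0 : (0 <= int_gauss_det s)%E.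
  by apply: integral_ge0 => M _; rewrite lee_fin gauss_det_ge0.
have [i _ imax'] := @arg_maxP _ _ 'I_p (Ordinal p0) predT (fun j => `|x 0 j|) isT.
have {imax'} imax j : `|x 0 j| <= `|x 0 i| := imax' j isT.
rewrite /int_gauss_det; have [xi1|xi1] := leP `|x 0 i| 1.
  rewrite big1 ?mule1 => [|j _]; last by rewrite /power_tail (le_trans (imax j) xi1).
  apply: ge0_le_integral => //.
  - by move=> M _; rewrite lee_fin gauss_det_lin_ge0.
  - by apply/measurable_EFinP; exact: measurable_gauss_det_lin.
  - by apply/measurable_EFinP; exact: measurable_gauss_det.
  - move=> M _; rewrite lee_fin; apply: ler_piMr; first exact: gauss_det_ge0.
    by rewrite expR_le1 mulNr oppr_le0 divr_ge0// qform_gram_ge0.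
have xi0 : x 0 i != 0 by rewrite -normr_gt0 (lt_trans ltr01).
apply: (le_trans (integral_gauss_det_lin _ xi0)); first by lia.
rewrite muleC; apply: lee_wpmul2l => //; rewrite lee_fin.
apply: (@le_trans _ _ (power_tail q (x 0 i) ^+ p)).
  rewrite /power_tail [`|x 0 i| <= 1]leNgt xi1/= -powR_mulrn ?powR_ge0// -powRrM.
  rewrite -powR_invn//; apply: ler_powR; first exact: ltW.
  rewrite mulNr lerN2 /q mulrDl mul1r -mulrA mulVf ?mulr1 ?gt_eqF//.
  by rewrite -natrD ler_nat; lia.
rewrite -[X in _ ^+ X]card_ord -prodr_const; apply: ler_prod => j _.
rewrite power_tail_ge0/= /power_tail [`|x 0 i| <= 1]leNgt xi1/=.
case: (leP `|x 0 j| 1) => xj1.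
  rewrite powRN invf_le1 ?powR_gt0 ?(lt_trans ltr01)//.
  by rewrite -[leLHS](powRr0 `|x 0 i|) ler_powR// ltW.
rewrite !powRN lef_pV2 ?posrE ?powR_gt0 ?(lt_trans ltr01)//.
by apply: ge0_ler_powR; rewrite ?nnegrE// ltW.
Qed.

(** Tonelli lets the integral over [M] come first, where the envelope of [int_gauss_det_lin_bound]
    applies; that envelope is integrable in [x]. *)
Lemma int_gauss_det_qint s : (0 < p)%N -> (s + p + 2 <= n)%N ->
  (int_gauss_det s < +oo)%E ->
  (\int[lam]_M ((gauss_det s M)%:E * gauss_qint (M^T *m M)) < +oo)%E.
Proof.
move=> p0 spn Jfin.
have pR : 0 < p%:R :> R by rewrite ltr0n.
have J0 : (0 <= int_gauss_det s)%E.
  by apply: integral_ge0 => M _; rewrite lee_fin gauss_det_ge0.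
set q : R := 1 + 2 / p%:R.
have q1 : 1 < q by rewrite ltrDl divr_gt0.
have qfin := integral_power_tail_lty q1.
set I := fine (\int[leb]_x (power_tail q x)%:E)%E.
have IE : (\int[leb]_x (power_tail q x)%:E = I%:E)%E.
  rewrite fineK// ge0_fin_numE//.
  by apply: integral_ge0 => x _; rewrite lee_fin power_tail_ge0.
have mprod : measurable_fun setT (fun x : 'rV[R]_p => \prod_a \prod_i power_tail q (x a i)).
  apply: measurable_prodr => a; apply: measurable_prodr => i.
  exact: (measurableT_comp (measurable_power_tail q) (@measurable_coord R 1 p a i)).
have m2 := measurable_gauss_det_lin2 (n := n) (p := p) s.
have mE2 : measurable_fun setT (fun z : V * 'rV[R]_p => (gauss_det_lin s z.2 z.1)%:E).
  exact/measurable_EFinP.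
have ge2 (z : V * 'rV[R]_p) : (0 <= (gauss_det_lin s z.2 z.1)%:E)%E.
  by rewrite lee_fin gauss_det_lin_ge0.
apply: (@le_lt_trans _ _ (\int[lebmx R 1 p]_x (int_gauss_det s *
    (\prod_a \prod_i power_tail q (x a i))%:E))%E); last first.
  rewrite ge0_integralZl//.
  - rewrite (ge0_integral_lebmx_prod _ _ _ _ IE)//.
    + by rewrite lte_mul_pinfty// ?ltry// ge0_fin_numE.
    + exact: measurable_power_tail.
    + exact: power_tail_ge0.
  - exact/measurable_EFinP.
  - move=> x _; rewrite lee_fin; apply: prodr_ge0 => a _; apply: prodr_ge0 => i _.
    exact: power_tail_ge0.
apply: (@le_trans _ _ (\int[lebmx R 1 p]_x \int[lam]_M (gauss_det_lin s x M)%:E)%E); last first.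
  apply: ge0_le_integral => //.
  - by move=> x _; apply: integral_ge0 => M _; rewrite lee_fin gauss_det_lin_ge0.
  - exact: (@measurable_fun_fubini_tonelli_G _ _ _ _ _ lam _ mE2 ge2).
  - by apply: emeasurable_funM => //; exact/measurable_EFinP.
  - by move=> x _; exact: int_gauss_det_lin_bound.
rewrite -(fubini_tonelli _ mE2 ge2)/=.
rewrite le_eqVlt; apply/orP; left; apply/eqP; apply: eq_integral => M _.
rewrite /gauss_qint -ge0_integralZl//; first last.
- by rewrite lee_fin gauss_det_ge0.
- exact: measurable_gauss_qform.

Qed.

(** Only an inequality: where the determinant vanishes, the convention for [powR] at 0 makes the
    left side 0, while the Gaussian integral on the right is infinite. *)
Lemma le_gauss_detS s M :
  ((gauss_det s.+1 M)%:E <= (Num.sqrt (2 * pi) ^- p)%:E *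
    ((gauss_det s M)%:E * gauss_qint (M^T *m M)))%E.
Proof.
have k0 : 0 < Num.sqrt (2 * pi) ^+ p :> R.
  by rewrite exprn_gt0// sqrtr_gt0 mulr_gt0// pi_gt0.
have [g0 ->] := gauss_qintE (gram_sym M) (qform_gram_ge0 M).
case: ifPn => [/eqP d0|d0].
  rewrite {1}/gauss_det /gram_det d0 powR0 ?mulr0.
    by rewrite !mule_ge0// lee_fin ?gauss_det_ge0// invr_ge0 ltW.
  by rewrite oppr_eq0 mulf_neq0// ?pnatr_eq0// invr_neq0.
rewrite -!EFinM lee_fin mulrCA [X in _ * X]mulrA mulVf ?gt_eqF// mul1r.
rewrite /gauss_det -mulrA; apply: ler_wpM2l; first exact: expR_ge0.
rewrite -/(gram_det M) in g0 d0 *.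
rewrite -powR12_sqrt// -powRN -powRD; last by rewrite d0 implybT.
by rewrite le_eqVlt; apply/orP; left; apply/eqP; congr powR; rewrite -natr1; field.
Qed.

Lemma measurable_gauss_qint_gram :
  measurable_fun setT (fun M : V => gauss_qint (M^T *m M)).
Proof.
have mz : measurable_fun setT (fun z : V * 'rV[R]_p => (expR (- qform (z.1^T *m z.1) z.2 / 2))%:E).
  apply/measurable_EFinP; apply: measurableT_comp => //; apply: measurable_funM => //.
  apply: measurable_funN; under eq_fun do rewrite qform_gram.
  apply: measurable_sumr => a; apply: measurable_funX; apply: measurable_sumr => i.
  apply: measurable_funM.
    exact: (measurableT_comp (@measurable_coord R n p a i) measurable_fst).
  exact: (measurableT_comp (@measurable_coord R 1 p 0 i) measurable_snd).
apply: (@measurable_fun_fubini_tonelli_F _ _ _ _ _ (lebmx R 1 p) _ mz) => z.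
by rewrite lee_fin expR_ge0.
Qed.

(** The induction starts from a pure Gaussian and stops at s = n - p - 1, which is exactly the
    exponent of [pi_SVS]. *)
Lemma int_gauss_det_lty s : (0 < p)%N -> (s + p + 1 <= n)%N ->
  (int_gauss_det s < +oo)%E.
Proof.
move=> p0; elim: s => [|s IH] spn.
  have E (x : R) : (\int[leb]_x (expR (- x ^+ 2 / 2))%:E = (Num.sqrt (2 * pi))%:E :> \bar R)%E.
    have := @integral_gauss_affine R 1 0 ltr01; rewrite sqrtr1 divr1 => <-.
    by apply: eq_integral => y _; rewrite mul1r addr0.
  rewrite /int_gauss_det.
  under eq_integral => M _.
    rewrite /gauss_det mul0r oppr0 powRr0 mulr1 /frob2 -sumrN mulr_suml expR_sum.
    under eq_bigr => a _ do rewrite -sumrN mulr_suml expR_sum.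
    over.
  rewrite (ge0_integral_lebmx_prod n p _ _ (E 0)) ?ltry//.
  - apply: measurableT_comp => //; apply: measurable_funM => //.
    by apply: measurable_funN; exact: exprn_measurable.
have Jfin := IH ltac:(lia).
have Tfin := int_gauss_det_qint p0 (ltac:(lia) : (s + p + 2 <= n)%N) Jfin.
have k0 : 0 < Num.sqrt (2 * pi) ^- p :> R.
  by rewrite invr_gt0 exprn_gt0// sqrtr_gt0 mulr_gt0// pi_gt0.
have mq := measurable_gauss_qint_gram.
have q0 (M : V) : (0 <= gauss_qint (M^T *m M))%E.
  by apply: integral_ge0 => x _; rewrite lee_fin expR_ge0.
have mT : measurable_fun setT (fun M : V => (gauss_det s M)%:E * gauss_qint (M^T *m M))%E.
  by apply: emeasurable_funM => //; apply/measurable_EFinP; exact: measurable_gauss_det.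
apply: (@le_lt_trans _ _ (\int[lam]_M ((Num.sqrt (2 * pi) ^- p)%:E *
    ((gauss_det s M)%:E * gauss_qint (M^T *m M))))%E).
  apply: ge0_le_integral => //.
  - by move=> M _; rewrite lee_fin gauss_det_ge0.
  - by apply/measurable_EFinP; exact: measurable_gauss_det.
  - exact: emeasurable_funM.
  - by move=> M _; exact: le_gauss_detS.
rewrite ge0_integralZl//.
- rewrite lte_mul_pinfty//.
- by move=> M _; rewrite mule_ge0// lee_fin gauss_det_ge0.
Qed.

End gram_integrability.

(** * Gaussian integrals of the two priors *)

Section prior_integrability.
Variables (R : realType) (n p : nat).
Local Notation V := 'M[R]_(n, p).
Local Notation lam := (lebmx R n p).
Implicit Type M : V.
Hypotheses (p_gt0 : (0 < p)%N) (pn : (p.+1 < n)%N).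
Let s := (n - p.+1)%N.

(** For s = 0 the integrand of [int_gauss_det_qint] is infinite wherever the determinant vanishes,
    and an integrable function is finite almost everywhere. *)
Lemma ae_gram_det_neq0 : {ae lam, forall M, gram_det M != 0}.
Proof.
have J0 : (int_gauss_det R n p 0 < +oo)%E by apply: int_gauss_det_lty; lia.
have T0 := int_gauss_det_qint p_gt0 (ltac:(lia) : (0 + p + 2 <= n)%N) J0.
pose f M := ((gauss_det 0 M)%:E * gauss_qint (M^T *m M))%E.
have f0 M : (0 <= f M)%E.
  rewrite mule_ge0 ?lee_fin ?gauss_det_ge0//; apply: integral_ge0 => x _.
  by rewrite lee_fin expR_ge0.
have fi : lam.-integrable setT f.
  apply/integrableP; split.
    apply: emeasurable_funM; first by apply/measurable_EFinP; exact: measurable_gauss_det.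
    exact: measurable_gauss_qint_gram.
  by under eq_integral => M _ do rewrite gee0_abs//.
have := integrable_ae measurableT fi; apply: filterS => M /(_ I).
apply: contraPneq => d0; rewrite /f.
have [_ ->] := gauss_qintE (gram_sym M) (qform_gram_ge0 M).
rewrite -/(gram_det M) d0 eqxx /gauss_det mul0r oppr0 powRr0 mulr1.
by rewrite gt0_muley// lte_fin expR_gt0.
Qed.

Lemma pi_SVSE M : pi_SVS M = gram_det M `^ (- (s%:R / 2)).
Proof.
rewrite /pi_SVS /gram_det; congr (_ `^ (- (_ / 2))).
by rewrite /s natrB 1?ltnW// -natr1 opprD addrA.
Qed.

Lemma pi_SVS_ge0 M : 0 <= pi_SVS M. Proof. exact: powR_ge0. Qed.

Lemma measurable_pi_SVS : measurable_fun setT (@pi_SVS R n p).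
Proof. exact: (measurableT_comp (measurable_powR _) (@measurable_gram_det R n p)). Qed.

Lemma pi_SVSZ (c : R) M : 0 < c -> pi_SVS (c *: M) = c ^- (p * s) * pi_SVS M.
Proof.
move=> c0; rewrite !pi_SVSE gram_detZ powRM ?gram_det_ge0 ?exprn_ge0 ?(ltW c0)//.
congr (_ * _); rewrite -powR_mulrn 1?ltW// -powRrM -powR_invn 1?ltW//.
by congr powR; rewrite !natrM; field.
Qed.

Lemma pi_MSVS1_ge0 gamma M : 0 <= pi_MSVS1 gamma M.
Proof. by rewrite mulr_ge0 ?powR_ge0. Qed.

Lemma measurable_pi_MSVS1 gamma : measurable_fun setT (@pi_MSVS1 R gamma n p).
Proof.
apply: measurable_funM; first exact: measurable_pi_SVS.
under eq_fun do rewrite -powR12_sqrt ?frob2_ge0//.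
apply: (measurableT_comp (measurable_powR _)).
exact: (measurableT_comp (measurable_powR _) (@measurable_frob2 R n p)).
Qed.

Lemma pi_MSVS1_0 : @pi_MSVS1 R 0 n p = @pi_SVS R n p.
Proof. by apply/funext => M; rewrite /pi_MSVS1 oppr0 powRr0 mulr1. Qed.

Let J := int_gauss_det R n p s.

Let J_fin : (J < +oo)%E. Proof. by apply: int_gauss_det_lty => //; rewrite /s; lia. Qed.

Let J_ge0 : (0 <= J)%E.
Proof. by apply: integral_ge0 => M _; rewrite lee_fin gauss_det_ge0. Qed.

(** Scaling by [c] gives c^(n p) from the volume and c^(-p s) from the prior; with s = n - p - 1 the
    balance is c^(p (p + 1)), the source of the bound on gamma. *)
Lemma integral_gauss_pi_SVS (c : R) : 0 < c ->
  (\int[lam]_M (expR (- (c ^- 2 * frob2 M) / 2) * pi_SVS M)%:E =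
   (c ^+ (p * p.+1))%:E * J)%E.
Proof.
move=> c0; have cn0 : c^-1 != 0 by rewrite gt_eqF ?invr_gt0.
have md := measurable_gauss_det (R := R) (n := n) (p := p) s.
have := @ge0_integral_lebmx_affine R n p c^-1 0 (fun M => (gauss_det s M)%:E) cn0.
move=> /(_ _ _)-/(_ _ _) H.
have E : (\int[lam]_M (gauss_det s (c^-1 *: M + 0))%:E = (c ^+ (n * p))%:E * J)%E.
  rewrite H.
  - by rewrite gtr0_norm ?invr_gt0// exprVn invrK.
  - exact/measurable_EFinP.
  - by move=> M; rewrite lee_fin gauss_det_ge0.
transitivity ((c ^- (p * s))%:E * ((c ^+ (n * p))%:E * J))%E; last first.
  rewrite muleA -EFinM; congr (_%:E * _)%E.
  rewrite (_ : n * p = p * s + p * p.+1)%N; last by rewrite /s; nia.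
  by rewrite exprD mulrA mulVf ?mul1r// expf_neq0// gt_eqF.
rewrite -E -ge0_integralZl//.
- apply: eq_integral => M _; rewrite -EFinM; congr EFin.
  have cE : c^-1 ^- (p * s) = c ^+ (p * s) by rewrite exprVn invrK.
  rewrite addr0 /gauss_det -pi_SVSE pi_SVSZ ?invr_gt0// frob2Z cE exprVn.
  by rewrite [RHS]mulrCA [X in _ = _ * X]mulrA mulVf ?mul1r// expf_neq0// gt_eqF.
- apply/measurable_EFinP; apply: (measurableT_comp md).
  exact: measurable_mx_affine.
- by move=> M _; rewrite lee_fin gauss_det_ge0.
- by rewrite lee_fin invr_ge0 exprn_ge0// ltW.
Qed.

Lemma dyadic_between (x : R) : 0 < x -> x <= 1 ->
  exists k, 2^-1 ^+ k.+1 <= x <= 2^-1 ^+ k.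
Proof.
move=> x0 x1.
have ex : exists k, 2^-1 ^+ k.+1 <= x.
  have [k xk] : exists k, x^-1 < k%:R by exists (Num.truncn x^-1).+1; rewrite truncnS_gt.
  exists k; rewrite exprVn -[leRHS]invrK lef_pV2 ?posrE ?invr_gt0 ?exprn_gt0//.
  apply: (le_trans (ltW xk)); rewrite -natrX ler_nat.
  by rewrite ltnW// ltnW// ltn_expl.
exists (ex_minn ex); case: ex_minnP => -[|k] h hmin; rewrite h//=.
by rewrite leNgt; apply/negP => /ltW /hmin; rewrite ltnn.
Qed.

Lemma powRN_le_dyadic (gamma x : R) k : 0 <= gamma -> 0 < x ->
  2^-1 ^+ k.+1 <= x -> x `^ (- gamma) <= (2 `^ gamma) ^+ k.+1.
Proof.
move=> g0 x0 xk.
have -> : (2 `^ gamma) ^+ k.+1 = ((2^-1 ^+ k.+1) `^ gamma)^-1 :> R.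
  rewrite exprVn -(powR_inv1 (exprn_ge0 _ _))// -powRrM mulN1r powRN invrK.
  by rewrite -[in RHS]powR_mulrn// -powRrM mulrC powRrM powR_mulrn ?powR_ge0.
rewrite powRN lef_pV2 ?posrE ?powR_gt0 ?exprn_gt0 ?invr_gt0//.
by apply: ge0_ler_powR; rewrite ?nnegrE ?exprn_ge0 ?invr_ge0// ltW.
Qed.

(** Outside the unit ball |M|^(-gamma) is at most 1. On the shell 2^(-k-1) <= |M| <= 2^(-k) it is at
    most 2^(gamma (k+1)), and the indicator of the shell is dominated by a Gaussian of width 2^(-k),
    whose integral against [pi_SVS] scales by the previous lemma. *)
Lemma integral_gauss_pi_MSVS1 (gamma e : R) : 0 <= gamma ->
  gamma < (p ^ 2 + p)%:R -> 0 < e ->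
  (\int[lam]_M (expR (- (e * frob2 M)) * pi_MSVS1 gamma M)%:E < +oo)%E.
Proof.
move=> g0 gp e0.
pose c := Num.sqrt (2 * e)^-1.
have c0 : 0 < c by rewrite sqrtr_gt0 invr_gt0 mulr_gt0.
have cE : c ^- 2 / 2 = e.
  by rewrite sqr_sqrtr ?invr_ge0 ?mulr_ge0 ?ltW// invrK; field.
pose t (k : nat) : R := 2^-1 ^+ k.
have t0 k : 0 < t k by rewrite exprn_gt0// invr_gt0.
(* On shell [k] the Gaussian of width [t k] is at least exp(-1/2); the last factor compensates for
   that. *)
pose b k := (2 `^ gamma) ^+ k.+1 * expR (2^-1).
have b0 k : 0 <= b k by rewrite mulr_ge0 ?exprn_ge0 ?powR_ge0 ?expR_ge0.
pose G (r : R) M := expR (- (r ^- 2 * frob2 M) / 2) * pi_SVS M.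
have G0 r M : 0 <= G r M by rewrite mulr_ge0 ?expR_ge0 ?pi_SVS_ge0.
have mG r : measurable_fun setT (G r).
  apply: measurable_funM; last exact: measurable_pi_SVS.
  apply: measurableT_comp => //; apply: measurable_funM => //; apply: measurable_funN.
  by apply: measurable_funM => //; exact: measurable_frob2.
pose S M := (\sum_(k <oo) ((b k)%:E * (G (t k) M)%:E))%E.
have mterm k : measurable_fun setT (fun M => (b k)%:E * (G (t k) M)%:E)%E.
  by apply: emeasurable_funM => //; exact/measurable_EFinP.
have term0 k M : (0 <= (b k)%:E * (G (t k) M)%:E)%E by rewrite mule_ge0// lee_fin.
have S0 M : (0 <= S M)%E by apply: nneseries_ge0 => k _ _.
have mS : measurable_fun setT S.
  apply: (@ge0_emeasurable_sum _ _ _ _ (fun k M => ((b k)%:E * (G (t k) M)%:E)%E) predT) => //.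
apply: (@le_lt_trans _ _ (\int[lam]_M ((G c M)%:E + S M))%E).
  apply: ge0_le_integral => //.
  - by move=> M _; rewrite lee_fin mulr_ge0 ?expR_ge0 ?pi_MSVS1_ge0.
  - apply/measurable_EFinP; apply: measurable_funM; last exact: measurable_pi_MSVS1.
    apply: measurableT_comp => //; apply: measurable_funN.
    by apply: measurable_funM => //; exact: measurable_frob2.
  - by apply: emeasurable_funD => //; exact/measurable_EFinP.
  - move=> M _; set x := Num.sqrt (frob2 M).
    have xE : x ^+ 2 = frob2 M by rewrite sqr_sqrtr ?frob2_ge0.
    have Ec : - (c ^- 2 * frob2 M) / 2 = - (e * frob2 M).
      by rewrite mulNr mulrAC cE.
    have [x1|x1] := leP 1 x.
      rewrite -[leLHS]adde0; apply: leeD => //; rewrite lee_fin /G Ec.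
      apply: ler_wpM2l; first exact: expR_ge0.
      rewrite /pi_MSVS1 -/x; apply: ler_piMr; first exact: pi_SVS_ge0.
      by rewrite -[leRHS](powRr0 x); apply: ler_powR => //; rewrite oppr_le0.
    (* No shell contains the origin. There the weight is 0 by the convention for [powR], or 1 when
       gamma = 0. *)
    have [x_eq0|xn0] := eqVneq x 0.
      rewrite -[leLHS]adde0; apply: leeD => //; rewrite lee_fin /G Ec.
      apply: ler_wpM2l; first exact: expR_ge0.
      rewrite /pi_MSVS1 -/x x_eq0; apply: ler_piMr; first exact: pi_SVS_ge0.
      have [->|gn0] := eqVneq gamma 0; first by rewrite oppr0 powRr0.
      by rewrite powR0// oppr_eq0.
    have x0 : 0 < x by rewrite lt_def xn0 sqrtr_ge0.
    have [k /andP[k1 k2]] := dyadic_between x0 (ltW x1).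
    rewrite -[leLHS]add0e; apply: leeD; first by rewrite lee_fin.
    apply: (@le_trans _ _ ((b k)%:E * (G (t k) M)%:E)%E); last first.
      have := @nneseries_lim_ge R (fun k => ((b k)%:E * (G (t k) M)%:E)%E) predT 0%N k.+1.
      move=> /(_ (fun k _ _ => term0 k M)); apply: le_trans.
      rewrite big_nat_recr//= leeDr//; apply: sume_ge0 => i _; exact: term0.
    rewrite -EFinM lee_fin /b /G /pi_MSVS1 -/x.
    have h1 : expR (- (e * frob2 M)) <= expR (2^-1) * expR (- (t k ^- 2 * frob2 M) / 2).
      rewrite -expRD ler_expR; apply: (@le_trans _ _ 0).
        by rewrite oppr_le0 mulr_ge0 ?frob2_ge0// ltW.
      rewrite mulNr -[X in X - _]mul1r -mulrBl mulr_ge0 ?invr_ge0// subr_ge0.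
      rewrite -xE mulrC ler_pdivrMr ?exprn_gt0// mul1r.
      by rewrite lerXn2r ?nnegrE ?(ltW (t0 k)) ?(ltW x0).
    have h2 := powRN_le_dyadic g0 x0 k1.
    have aux (A E F K P X : R) : 0 <= E -> 0 <= P -> 0 <= X -> E <= K * F -> X <= A ->
        E * (P * X) <= A * K * (F * P).
      move=> E0 P0 X0 EK XA; rewrite (_ : A * K * (F * P) = P * (K * F * A)); last by ring.
      by rewrite mulrCA; apply: ler_wpM2l => //; exact: ler_pM.
    by apply: aux => //; rewrite ?powR_ge0 ?expR_ge0 ?pi_SVS_ge0.
rewrite ge0_integralD//; last 2 first.
- by move=> M _; rewrite lee_fin.
- exact/measurable_EFinP.
rewrite (integral_gauss_pi_SVS c0).
apply: lte_add_pinfty; first by rewrite lte_mul_pinfty// lee_fin exprn_ge0// ltW.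
rewrite /S (integral_nneseries lam measurableT mterm)//.
(* Ratio of consecutive shell bounds; [z < 1] is where gamma < p^2 + p enters. *)
pose z := 2 `^ gamma * 2^-1 ^+ (p * p.+1).
have z0 : 0 <= z by rewrite mulr_ge0 ?powR_ge0 ?exprn_ge0 ?invr_ge0.
have z1 : z < 1.
  rewrite /z exprVn ltr_pdivrMr ?exprn_gt0// mul1r -powR_mulrn//.
  rewrite /powR !pnatr_eq0/= ltr_expR ltr_pM2r ?ln_gt0 ?ltr1n//.
  by apply: (lt_le_trans gp); rewrite ler_nat; lia.
pose C := (2 `^ gamma * expR 2^-1).
have C0 : 0 <= C by rewrite mulr_ge0 ?powR_ge0 ?expR_ge0.
have J_EFin : J = (fine J)%:E by rewrite fineK// ge0_fin_numE.
have fJ0 : 0 <= fine J by apply: fine_ge0.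
have termE k : (\int[lam]_M ((b k)%:E * (G (t k) M)%:E) = (C * fine J * z ^+ k)%:E)%E.
  rewrite ge0_integralZl//; last 3 first.
  - exact/measurable_EFinP.
  - by move=> M _; rewrite lee_fin.
  - by rewrite lee_fin.
  rewrite (integral_gauss_pi_SVS (t0 k)) J_EFin -!EFinM; congr EFin.
  by rewrite /b /C /z /t exprMn -!exprM exprS (mulnC k); ring.
under eq_eseriesr do rewrite termE.
have cz : series (geometric (C * fine J) z) @ \oo --> C * fine J * (1 - z)^-1.
  by apply: cvg_geometric_series; rewrite ger0_norm.
apply: (@le_lt_trans _ _ (C * fine J * (1 - z)^-1)%:E); last exact: ltry.
have -> : (C * fine J * (1 - z)^-1)%:E = (limn (EFin \o series (geometric (C * fine J) z))).
  by apply/esym/cvg_lim => //; apply: cvg_EFin => //; exact: nearW.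
rewrite le_eqVlt; apply/orP; left; apply/eqP; congr (limn _).
by apply/funext => m; rewrite /= /series /= sumEFin.
Qed.

End prior_integrability.

(** * Gaussian means *)

Lemma powR_le_expR (R : realType) (a e : R) : 0 <= a -> 0 < e ->
  exists2 C, 0 < C & forall t, 0 <= t -> t `^ a <= C * expR (e * t).
Proof.
move=> a0 e0; have a1 : 0 < a + 1 by rewrite ltr_wpDl.
(* From t <= exp(d t) / d, raised to the power [a]; the denominator [a + 1] gives d a <= e and also
   covers a = 0. *)
pose d := e / (a + 1); have d0 : 0 < d by rewrite divr_gt0.
exists (d^-1 `^ a); first by rewrite powR_gt0// invr_gt0.
move=> t t0; have td : t <= d^-1 * expR (d * t).
  rewrite mulrC ler_pdivlMr// mulrC (le_trans _ (expR_ge1Dx _))// lerDr//.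
apply: (@le_trans _ _ ((d^-1 * expR (d * t)) `^ a)).
  by apply: ge0_ler_powR; rewrite ?nnegrE// mulr_ge0 ?expR_ge0// invr_ge0 ltW.
rewrite powRM ?expR_ge0 ?invr_ge0 ?(ltW d0)//; apply: ler_wpM2l; first exact: powR_ge0.
rewrite -expRM ler_expR mulrAC; apply: ler_wpM2r => //.
rewrite /d mulrAC ler_pdivrMr//; nra.
Qed.

Lemma exprn_le_expR (R : realType) k (e : R) : 0 < e ->
  exists2 C, 0 < C & forall t, 0 <= t -> t ^+ k <= C * expR (e * t).
Proof.
move=> e0; have [C C0 HC] := @powR_le_expR R k%:R e (ler0n _ _) e0.
by exists C => // t t0; rewrite -powR_mulrn// HC.
Qed.

Section gauss_mean.
Variables (R : realType) (n p : nat).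
Local Notation mR := (measurableTypeR R).
Local Notation V := 'M[R]_(n, p).
Local Notation lam := (lebmx R n p).
Local Notation I := ('I_n * 'I_p)%type.
Implicit Types (f g : V -> R) (v : V).

Definition crd v (k : I) := v k.1 k.2.

Definition gw v : R := ((2 * pi)^-1) `^ ((n * p)%:R / 2) * expR (- frob2 v / 2).

Lemma gw_const_gt0 : 0 < ((2 * pi)^-1) `^ ((n * p)%:R / 2) :> R.
Proof. by rewrite powR_gt0// invr_gt0 mulr_gt0// pi_gt0. Qed.

Lemma gw_ge0 v : 0 <= gw v.
Proof. by rewrite mulr_ge0 ?powR_ge0 ?expR_ge0. Qed.

Lemma measurable_crd k : measurable_fun setT (crd ^~ k).
Proof. exact: measurable_coord. Qed.

Lemma measurable_expR_frob2 (c : R) : measurable_fun setT (fun v : V => expR (c * frob2 v)).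
Proof.
by apply: measurableT_comp => //; apply: measurable_funM => //; exact: measurable_frob2.
Qed.

Lemma measurable_gw : measurable_fun setT gw.
Proof.
apply: measurable_funM => //; apply: measurableT_comp => //.
by apply: measurable_funM => //; apply: measurable_funN; exact: measurable_frob2.
Qed.

(** [gmean] is the expectation under the standard normal law on matrices. Since [fine] sends
    infinite values to 0, its linearity and monotonicity hold under [gint]. *)
Definition gint f := lam.-integrable setT (fun v => (f v * gw v)%:E).
Definition gmean f : R := fine (\int[lam]_v (f v * gw v)%:E).

Lemma gmeanE f : gint f -> (\int[lam]_v (f v * gw v)%:E = (gmean f)%:E)%E.
Proof. by move=> fi; rewrite fineK// integrable_fin_num. Qed.

Lemma eq_gint f g : f =1 g -> gint f -> gint g.
Proof. by move=> /funext ->. Qed.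

Lemma gintD f g : gint f -> gint g -> gint (fun v => f v + g v).
Proof.
move=> fi gi; have := integrableD measurableT fi gi.
by apply: eq_integrable => // v _; rewrite /= mulrDl EFinD.
Qed.

Lemma gintZ (c : R) f : gint f -> gint (fun v => c * f v).
Proof.
move=> fi; have := integrableZl measurableT c fi.
by apply: eq_integrable => // v _; rewrite -EFinM mulrA.
Qed.

Lemma gint_le f g : measurable_fun setT f -> (forall v, `|f v| <= g v) -> gint g -> gint f.
Proof.
move=> mf fg; apply: le_integrable => //.
  by apply/measurable_EFinP; apply: measurable_funM => //; exact: measurable_gw.
move=> v _; rewrite lee_fin normrM [leRHS]ger0_norm; last first.
  by rewrite mulr_ge0 ?gw_ge0// (le_trans _ (fg v)).
by rewrite (ger0_norm (gw_ge0 v)); apply: ler_wpM2r; [exact: gw_ge0|exact: fg].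
Qed.

Lemma gint_sum (J : Type) (s : seq J) (f : J -> V -> R) :
  (forall j, gint (f j)) -> gint (fun v => \sum_(j <- s) f j v).
Proof.
move=> fi; have := @integrable_sum _ _ _ lam setT measurableT _ s xpredT _ (fun j _ => fi j).
by apply: eq_integrable => // v _; rewrite sumEFin mulr_suml.
Qed.

Lemma gmeanD f g : gint f -> gint g ->
  gmean (fun v => f v + g v) = gmean f + gmean g.
Proof.
move=> fi gi; apply/eqP; rewrite -eqe EFinD -!gmeanE//; last exact: gintD.
rewrite -integralD//; apply/eqP; apply: eq_integral => v _.
by rewrite mulrDl EFinD.
Qed.

Lemma gmeanZ (c : R) f : gint f -> gmean (fun v => c * f v) = c * gmean f.
Proof.
move=> fi; apply/eqP; rewrite -eqe EFinM -!gmeanE//; last exact: gintZ.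
rewrite -integralZl//; apply/eqP; apply: eq_integral => v _.
by rewrite -EFinM -mulrA.
Qed.

Lemma gmean_sum (J : Type) (s : seq J) (f : J -> V -> R) :
  (forall j, gint (f j)) ->
  gmean (fun v => \sum_(j <- s) f j v) = \sum_(j <- s) gmean (f j).
Proof.
move=> fi; elim: s => [|j s IH].
  rewrite big_nil /gmean; under eq_integral do rewrite big_nil mul0r.
  by rewrite integral0.
rewrite big_cons -IH -gmeanD//; last exact: gint_sum.
by congr gmean; apply/funext => v; rewrite big_cons.
Qed.

Lemma gmean_le f g : gint f -> gint g -> (forall v, f v <= g v) -> gmean f <= gmean g.
Proof.
move=> fi gi fg; rewrite -lee_fin -!gmeanE//; apply: le_integral => // v _.
by rewrite lee_fin ler_wpM2r// gw_ge0.
Qed.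

Lemma gmean_norm_le f g : measurable_fun setT f -> (forall v, `|f v| <= g v) -> gint g ->
  `|gmean f| <= gmean g.
Proof.
move=> mf fg gi; have fi := gint_le mf fg gi.
rewrite ler_norml; apply/andP; split.
  rewrite -mulN1r -gmeanZ//; apply: gmean_le => //; first exact: gintZ.
  by move=> v; rewrite mulN1r; have := fg v; rewrite ler_norml => /andP[].
by apply: gmean_le => // v; rewrite (le_trans _ (fg v))// ler_norm.
Qed.

Lemma integral_gauss_matrix (a : R) : 0 < a ->
  (\int[lam]_v (expR (- (a * frob2 v) / 2))%:E =
   ((Num.sqrt (2 * pi) / Num.sqrt a) ^+ (n * p))%:E)%E.
Proof.
move=> a0; have E := integral_gauss_affine 0 a0.
have {}E : (\int[@lebesgue_measure R]_x (expR (- (a * x ^+ 2) / 2))%:E =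
    (Num.sqrt (2 * pi) / Num.sqrt a)%:E)%E.
  by rewrite -E; apply: eq_integral => x _; rewrite addr0.
rewrite -(ge0_integral_lebmx_prod n p _ _ E)//.
- apply: eq_integral => v _; rewrite /frob2 mulr_sumr -sumrN mulr_suml expR_sum.
  congr EFin; apply: eq_bigr => i _; rewrite mulr_sumr -sumrN mulr_suml expR_sum.
  by [].
- apply: measurableT_comp => //; apply: measurable_funM => //.
  by apply: measurable_funN; apply: measurable_funM => //; exact: exprn_measurable.
Qed.

Lemma gw_const : ((2 * pi)^-1) `^ ((n * p)%:R / 2) = Num.sqrt (2 * pi) ^- (n * p) :> R.
Proof.
have pi2 : 0 < 2 * pi :> R by rewrite mulr_gt0// pi_gt0.
rewrite -(powR_inv1 (ltW pi2)) -(powR12_sqrt (ltW pi2)) -powR_invn; last exact: powR_ge0.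
by rewrite -!powRrM; congr powR; field.
Qed.

Lemma gint_expR_frob2 (c : R) : c < 2^-1 -> gint (fun v => expR (c * frob2 v)).
Proof.
move=> c1; apply/integrableP; split.
  apply/measurable_EFinP; apply: measurable_funM; last exact: measurable_gw.
  exact: measurable_expR_frob2.
have a0 : 0 < 1 - 2 * c by lra.
rewrite (eq_integral (fun v => (((2 * pi)^-1) `^ ((n * p)%:R / 2))%:E *
    (expR (- ((1 - 2 * c) * frob2 v) / 2))%:E)%E); last first.
  move=> v _; rewrite gee0_abs; last first.
    by rewrite lee_fin; apply: mulr_ge0; [exact: expR_ge0|exact: gw_ge0].
  by rewrite -EFinM; congr EFin; rewrite mulrCA -expRD; congr (_ * expR _); field.
rewrite ge0_integralZl//; last 2 first.
- apply/measurable_EFinP; under eq_fun do rewrite mulNr mulrAC -mulNr.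
  exact: measurable_expR_frob2.
- by rewrite lee_fin powR_ge0.
by rewrite integral_gauss_matrix//= -EFinM ltry.
Qed.

Lemma gint_cst (c : R) : gint (fun=> c).
Proof.
have h : (0 : R) < 2^-1 by rewrite invr_gt0.
apply: eq_gint (gintZ c (gint_expR_frob2 h)) => v.
by rewrite mul0r expR0 mulr1.
Qed.

Lemma gmean_cst (c : R) : gmean (fun=> c) = c.
Proof.
have -> : (fun=> c) = (fun _ : V => c * 1) by apply/funext => v; rewrite mulr1.
rewrite gmeanZ; last exact: gint_cst.
rewrite -[RHS]mulr1; congr (_ * _).
rewrite /gmean (eq_integral (fun v => (((2 * pi)^-1) `^ ((n * p)%:R / 2))%:E *
    (expR (- frob2 v / 2))%:E)%E); last by move=> v _; rewrite mul1r EFinM.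
rewrite ge0_integralZl//; last 2 first.
- apply/measurable_EFinP; under eq_fun do rewrite -[- _]mulN1r mulrAC.
  exact: measurable_expR_frob2.
- by rewrite lee_fin powR_ge0.
rewrite (_ : (\int[lam]_v _ = ((Num.sqrt (2 * pi) / Num.sqrt 1) ^+ (n * p))%:E)%E); last first.
  rewrite -(integral_gauss_matrix ltr01); apply: eq_integral => v _.
  by rewrite mul1r.
rewrite /= gw_const sqrtr1 divr1 mulVf// expf_neq0//.
by rewrite gt_eqF// sqrtr_gt0 mulr_gt0// pi_gt0.
Qed.

Lemma ge0_integral_lebmx_oppr (f : V -> \bar R) : measurable_fun setT f ->
  (forall x, 0 <= f x)%E -> (\int[lam]_v f (- v)%R = \int[lam]_v f v)%E.
Proof.
move=> mf f0; have N1 : -1 != 0 :> R by rewrite oppr_eq0 oner_eq0.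
have := @ge0_integral_lebmx_affine R n p (-1) 0 f N1 mf f0.
rewrite normrN1 expr1n invr1 mul1e => <-.
by apply: eq_integral => v _; rewrite addr0 scaleN1r.
Qed.

Lemma frob2N v : frob2 (- v) = frob2 v.
Proof.
by apply: eq_bigr => i _; apply: eq_bigr => j _; rewrite mxE sqrrN.
Qed.

Lemma gwN v : gw (- v) = gw v. Proof. by rewrite /gw frob2N. Qed.

Lemma gmean_odd f : gint f -> (forall v, f (- v) = - f v) -> gmean f = 0.
Proof.
move=> fi fN; rewrite /gmean integralE.
have mf := measurable_int _ fi.
rewrite -(ge0_integral_lebmx_oppr (measurable_funepos mf))//.
rewrite (_ : (\int[lam]_v _ = \int[lam]_v (fun v => (f v * gw v)%:E)^\- v)%E).
  by rewrite subee//; apply: integrable_neg_fin_num.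
by apply: eq_integral => v _; rewrite funeposE funenegE fN gwN mulNr.
Qed.

(* Compare Gaussian integrals of [exp (- h v_k^2 / 2)] for small [h] of both
   signs, computed by rescaling the coordinate [k]. *)
Lemma gmean_sqr k : gmean (fun v => crd v k ^+ 2) = 1.
Proof.
pose u v := crd v k ^+ 2 / 2.
have u0 v : 0 <= u v by rewrite divr_ge0 ?sqr_ge0.
have u_frob v : u v <= frob2 v / 2.
  rewrite ler_pM2r ?invr_gt0// /frob2 (bigD1 k.1)//= (bigD1 k.2)//= -addrA lerDl.
  apply: addr_ge0; first by apply: sumr_ge0 => j _; exact: sqr_ge0.
  by apply: sumr_ge0 => i _; apply: sumr_ge0 => j _; exact: sqr_ge0.
have mu : measurable_fun setT u.
  by apply: measurable_funM => //; apply: measurable_funX; exact: measurable_crd.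
have ui : gint u.
  have q : 4^-1 < 2^-1 :> R by lra.
  apply: gint_le (gintZ 2 (gint_expR_frob2 q)) => // v.
  rewrite ger0_norm//; have := expR_ge1Dx (4^-1 * frob2 v); have := u_frob v.
  by move: (u v) (frob2 v) (expR _) => x y z; lra.
have scale (h : R) : `|h| < 2^-1 -> gint (fun v => expR (- (h * u v))) /\
    gmean (fun v => expR (- (h * u v))) = (Num.sqrt (1 + h))^-1.
  move=> h1; have h1' : 0 < 1 + h by have := ltr_normlW h1; have := ler_norm (- h); rewrite normrN; lra.
  have mE : measurable_fun setT (fun v => expR (- (h * u v))).
    by apply: measurableT_comp => //; apply: measurable_funN; exact: measurable_funM.
  have gi : gint (fun v => expR (- (h * u v))).
    have q : 4^-1 < 2^-1 :> R by lra.
    apply: gint_le (gint_expR_frob2 q) => // v.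
    rewrite ger0_norm ?expR_ge0// ler_expR -mulNr.
    have hh : - h <= 2^-1 by have := ler_norm (- h); rewrite normrN; lra.
    have := u_frob v; have := u0 v; nra.
  split=> //; set c := Num.sqrt (1 + h).
  have c0 : 0 < c by rewrite sqrtr_gt0.
  have cE : c ^+ 2 = 1 + h by rewrite sqr_sqrtr// ltW.
  apply/eqP; rewrite -eqe -gmeanE//; apply/eqP.
  have i1 := gint_cst 1.
  rewrite (_ : c^-1%:E = `|c|^-1%:E * \int[lam]_v (1 * gw v)%:E)%E; last first.
    by rewrite gmeanE// gmean_cst mule1 gtr0_norm.
  have mg : measurable_fun setT (fun v => (1 * gw v)%:E).
    by apply/measurable_EFinP; apply: measurable_funM => //; exact: measurable_gw.
  have g0 v : (0 <= (1 * gw v)%:E)%E by rewrite mul1r lee_fin gw_ge0.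
  have := @ge0_integral_lebmx_coord R n p k.1 k.2 c (fun=> 0) _ (lt0r_neq0 c0) mg g0
    (measurable_cst _) (fun _ _ => erefl).
  move=> <-; apply: eq_integral => v _; congr EFin; rewrite mul1r addr0.
  rewrite /gw mulrCA -expRD; congr (_ * expR _).
  suff -> : frob2 (mxset v k.1 k.2 (c * v k.1 k.2)) = frob2 v + h * crd v k ^+ 2.
    by rewrite /u; field.
  rewrite /frob2 (bigD1 k.1)//= (bigD1 k.2)//= mxE !eqxx/=.
  rewrite [in RHS](bigD1 k.1)//= [in RHS](bigD1 k.2)//=.
  rewrite (eq_bigr (fun j => v k.1 j ^+ 2)); last by move=> j jk; rewrite mxE (negbTE jk) andbF.
  rewrite (eq_bigr (fun i => \sum_j v i j ^+ 2)); last first.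
    by move=> i ik; apply: eq_bigr => j _; rewrite mxE (negbTE ik).
  by rewrite exprMn cE /crd; ring.
(* Taking means in 1 - h u <= exp(- h u) gives 1 - h E[u] <= (1 + h)^(-1/2) <= 1 - h/2 + h^2. Used
   for [h] and [- h], this traps E[u] within |h| of 1/2. *)
have key (h : R) : `|h| < 2^-1 -> h != 0 -> h / 2 - h ^+ 2 <= h * gmean u.
  move=> h1 h0; have [gi ge] := scale h h1.
  have h1' : 0 < 1 + h by have := ler_norm (- h); rewrite normrN; lra.
  have : gmean (fun v => 1 + (- h) * u v) <= gmean (fun v => expR (- (h * u v))).
    apply: gmean_le => //; first by apply: gintD; [exact: gint_cst|exact: gintZ].
    by move=> v; rewrite mulNr; exact: expR_ge1Dx.
  rewrite gmeanD; [|exact: gint_cst|exact: gintZ].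
  rewrite gmeanZ// gmean_cst ge => H.
  have : (Num.sqrt (1 + h))^-1 <= 1 - h / 2 + h ^+ 2.
    set c := Num.sqrt (1 + h); have c0 : 0 < c by rewrite sqrtr_gt0.
    have cE : c ^+ 2 = 1 + h by rewrite sqr_sqrtr// ltW.
    rewrite -[leLHS]mul1r ler_pdivrMr//.
    have hE : h = c ^+ 2 - 1 by rewrite cE; ring.
    rewrite hE.
    have c12 : 2^-1 <= c ^+ 2 by rewrite cE; have := ler_norm (- h); rewrite normrN; lra.
    have chalf : 2^-1 <= c by nra.
    rewrite -subr_ge0.
    (* Both sides of the inequality agree to first order at h = 0, that is at c = 1, so (c - 1)^2
       factors out; the cofactor is nonnegative because c^2 >= 1/2. *)
    have -> : (1 - (c ^+ 2 - 1) / 2 + (c ^+ 2 - 1) ^+ 2) * c - 1 =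
      (c - 1) ^+ 2 * (c ^+ 3 + 2 * c ^+ 2 + c / 2 - 1) by field.
    rewrite mulr_ge0 ?sqr_ge0//; nra.
  by move: H; rewrite mulNr; lra.
suff uE : gmean u = 2^-1.
  have -> : (fun v => crd v k ^+ 2) = (fun v => 2 * u v) by apply/funext => v; rewrite /u; field.
  by rewrite gmeanZ// uE mulfV.
apply/eqP; rewrite -subr_eq0 -normr_eq0; apply/eqP; apply: le_anti; rewrite normr_ge0 andbT.
apply/ler_addgt0Pl => e e0; rewrite addr0.
pose h := Num.min e 4^-1; have h0 : 0 < h by rewrite lt_min e0/= invr_gt0.
have hm : `|h| < 2^-1 by rewrite gtr0_norm// (@le_lt_trans _ _ 4^-1) ?ge_min ?lexx ?orbT//; lra.
have he : h <= e by rewrite ge_min lexx.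
have k1 := key h hm (lt0r_neq0 h0).
have k2 : - h / 2 - h ^+ 2 <= - h * gmean u.
  by have := key (- h); rewrite normrN sqrrN oppr_eq0 gt_eqF//; exact.
by rewrite ler_norml; apply/andP; split; nra.
Qed.

(** Flipping the sign of coordinate [k] preserves the weight and negates the integrand. *)
Lemma gmean_cross k l : k != l -> gint (fun v => crd v k * crd v l) ->
  gmean (fun v => crd v k * crd v l) = 0.
Proof.
move=> kl fi; rewrite /gmean integralE.
have mf := measurable_int _ fi.
pose S v := mxset v k.1 k.2 (-1 * v k.1 k.2 + 0).
have N1 : -1 != 0 :> R by rewrite oppr_eq0 oner_eq0.
have := @ge0_integral_lebmx_coord R n p k.1 k.2 (-1) (fun=> 0) _ N1
  (measurable_funepos mf) (funepos_ge0 _) (measurable_cst _) (fun _ _ => erefl).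
rewrite normrN1 invr1 mul1e => <-.
rewrite (_ : (\int[lam]_v _ = \int[lam]_v (fun v => (crd v k * crd v l * gw v)%:E)^\- v)%E).
  by rewrite subee//; apply: integrable_neg_fin_num.
apply: eq_integral => v _; rewrite funeposE funenegE.
have -> : crd (mxset v k.1 k.2 (-1 * v k.1 k.2 + 0)) k = - crd v k.
  by rewrite /crd mxE !eqxx/= addr0 mulN1r.
have -> : crd (mxset v k.1 k.2 (-1 * v k.1 k.2 + 0)) l = crd v l.
  rewrite /crd mxE ifF//; apply/negbTE; apply: contra kl => /andP[/eqP e1 /eqP e2].
  by apply/eqP; case: k l e1 e2 {fi mf S} => ? ? [? ?] /= -> ->.
suff -> : gw (mxset v k.1 k.2 (-1 * v k.1 k.2 + 0)) = gw v by rewrite !mulNr.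
rewrite /gw; congr (_ * expR (- _ / 2)).
apply: eq_bigr => i _; apply: eq_bigr => j _; rewrite mxE.
by case: ifP => // /andP[/eqP-> /eqP->]; rewrite addr0 mulN1r sqrrN.
Qed.

End gauss_mean.

(** * Functions dominated by arbitrarily slow Gaussian growth *)

Section growth.
Variables (R : realType) (n p : nat).
Local Notation V := 'M[R]_(n, p).
Local Notation I := ('I_n * 'I_p)%type.
Implicit Types (f g : V -> R) (v x y z : V) (a : I -> R) (H : I -> I -> R).

Lemma frob2E x : frob2 x = \sum_(k : I) crd x k ^+ 2.
Proof. by rewrite /frob2 pair_big. Qed.

Lemma crd_sqr_le x (k : I) : crd x k ^+ 2 <= frob2 x.
Proof.
by rewrite frob2E (bigD1 k)//= lerDl; apply: sumr_ge0 => l _; exact: sqr_ge0.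
Qed.

Lemma frob2D_le x y : frob2 (x + y) <= 2 * frob2 x + 2 * frob2 y.
Proof.
rewrite !frob2E !mulr_sumr -big_split/=; apply: ler_sum => k _; rewrite /crd !mxE.
by have := sqr_ge0 (crd x k - crd y k); rewrite /crd; nra.
Qed.

Lemma frob2_triangle x y : frob2 x / 2 - frob2 y <= frob2 (x - y).
Proof.
have := frob2D_le (x - y) y; rewrite subrK; lra.
Qed.

(** Quantifying over every rate [e] makes the class closed under products, by halving the rate; it
    contains all polynomials and lies inside [gint]. *)
Definition growth f := measurable_fun setT f /\
  forall e, 0 < e -> exists2 C, 0 < C & forall v, `|f v| <= C * expR (e * frob2 v).

Lemma growth_gint f : growth f -> gint f.
Proof.
move=> [mf fg]; have [C C0 fC] := fg 4^-1 ltac:(by rewrite invr_gt0).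
apply: gint_le mf fC _; apply: gintZ; apply: gint_expR_frob2; lra.
Qed.

Lemma growth_cst (c : R) : growth (fun=> c).
Proof.
split=> // e e0; exists (`|c| + 1); first by rewrite ltr_wpDl.
move=> v; rewrite -[leLHS]mulr1; apply: ler_pM => //; first by rewrite lerDl.
by rewrite -[leLHS]expR0 ler_expR mulr_ge0 ?frob2_ge0// ltW.
Qed.

Lemma growthD f g : growth f -> growth g -> growth (fun v => f v + g v).
Proof.
move=> [mf fg] [mg gg]; split=> [|e e0]; first exact: measurable_funD.
have [C C0 fC] := fg e e0; have [D D0 gD] := gg e e0.
exists (C + D) => [|v]; first exact: addr_gt0.
by rewrite mulrDl (le_trans (ler_normD _ _))// lerD.
Qed.

Lemma growthM f g : growth f -> growth g -> growth (fun v => f v * g v).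
Proof.
move=> [mf fg] [mg gg]; split=> [|e e0]; first exact: measurable_funM.
have e20 : 0 < e / 2 by rewrite divr_gt0.
have [C C0 fC] := fg _ e20; have [D D0 gD] := gg _ e20.
exists (C * D) => [|v]; first exact: mulr_gt0.
have -> : e * frob2 v = e / 2 * frob2 v + e / 2 * frob2 v by field.
by rewrite expRD mulrACA normrM ler_pM.
Qed.

Lemma growth_sum (J : Type) (s : seq J) (f : J -> V -> R) :
  (forall j, growth (f j)) -> growth (fun v => \sum_(j <- s) f j v).
Proof.
move=> fg; elim: s => [|j s IH].
  by under eq_fun do rewrite big_nil; exact: growth_cst.
by under eq_fun do rewrite big_cons; exact: growthD.
Qed.

Definition nrm x := Num.sqrt (frob2 x).

Lemma nrm_ge0 x : 0 <= nrm x. Proof. exact: sqrtr_ge0. Qed.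

Lemma nrm_sqr x : nrm x ^+ 2 = frob2 x.
Proof. by rewrite sqr_sqrtr// frob2_ge0. Qed.

Lemma nrmZ (c : R) x : 0 <= c -> nrm (c *: x) = c * nrm x.
Proof. by move=> c0; rewrite /nrm frob2Z sqrtrM ?sqr_ge0// sqrtr_sqr ger0_norm. Qed.

Lemma measurable_nrm : measurable_fun setT nrm.
Proof.
rewrite /nrm; under eq_fun do rewrite -powR12_sqrt ?frob2_ge0//.
exact: (measurableT_comp (measurable_powR _) (@measurable_frob2 R n p)).
Qed.

Lemma growth_nrmX k : growth (fun v => nrm v ^+ k).
Proof.
split=> [|e e0]; first by apply: measurable_funX; exact: measurable_nrm.
have [C C0 HC] := @powR_le_expR R (k%:R / 2) e (divr_ge0 (ler0n _ _) (ler0n _ 2)) e0.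
exists C => // v; rewrite ger0_norm ?exprn_ge0 ?nrm_ge0//.
rewrite (le_trans _ (HC _ (frob2_ge0 v)))//.
by rewrite /nrm -powR_mulrn ?sqrtr_ge0// -powR12_sqrt ?frob2_ge0// -powRrM mulrC.
Qed.

Lemma growth_crd (k : I) : growth (fun v => crd v k).
Proof.
split=> [|e e0]; first exact: measurable_crd.
have [_ /(_ e e0) [C C0 HC]] := growth_nrmX 1; exists C => // v.
rewrite (le_trans _ (HC v))// expr1 [leRHS]ger0_norm ?nrm_ge0// -sqrtr_sqr ler_wsqrtr//.
exact: crd_sqr_le.
Qed.

Definition dot a x : R := \sum_(k : I) a k * crd x k.
Definition quad H x : R := \sum_(k : I) \sum_(l : I) H k l * crd x k * crd x l.
Definition hmul H z (k : I) : R := \sum_(l : I) H k l * crd z l.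

Lemma growth_dot a : growth (dot a).
Proof.
by apply: growth_sum => k; apply: growthM; [exact: growth_cst|exact: growth_crd].
Qed.

Lemma growth_hmul H k : growth (hmul H ^~ k).
Proof. exact: growth_dot. Qed.

Lemma growth_quad H : growth (quad H).
Proof.
apply: growth_sum => k; apply: growth_sum => l; apply: growthM; last exact: growth_crd.
by apply: growthM; [exact: growth_cst|exact: growth_crd].
Qed.

Lemma dotD a x y : dot a (x + y) = dot a x + dot a y.
Proof.
by rewrite -big_split/=; apply: eq_bigr => k _; rewrite /crd mxE mulrDr.
Qed.

Lemma dotZ a (c : R) x : dot a (c *: x) = c * dot a x.
Proof.
by rewrite mulr_sumr; apply: eq_bigr => k _; rewrite /crd mxE mulrCA.
Qed.

Lemma dotN a x : dot a (- x) = - dot a x.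
Proof. by rewrite -scaleN1r dotZ mulN1r. Qed.

Lemma quadZ H (c : R) x : quad H (c *: x) = c ^+ 2 * quad H x.
Proof.
rewrite mulr_sumr; apply: eq_bigr => k _; rewrite mulr_sumr.
by apply: eq_bigr => l _; rewrite /crd !mxE; ring.
Qed.

Lemma quadN H x : quad H (- x) = quad H x.
Proof. by rewrite -scaleN1r quadZ sqrrN expr1n mul1r. Qed.

Lemma quadD H x y : (forall k l, H k l = H l k) ->
  quad H (x + y) = quad H x + 2 * dot (hmul H x) y + quad H y.
Proof.
move=> sH.
have E1 : dot (hmul H x) y = \sum_(k : I) \sum_(l : I) H k l * crd x k * crd y l.
  rewrite /dot exchange_big/=; apply: eq_bigr => k _; rewrite mulr_suml.
  by apply: eq_bigr => l _; rewrite sH.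
have E2 : dot (hmul H x) y = \sum_(k : I) \sum_(l : I) H k l * crd y k * crd x l.
  rewrite /dot; apply: eq_bigr => k _; rewrite mulr_suml.
  by apply: eq_bigr => l _; rewrite mulrAC.
rewrite mulr_natl mulr2n {1}E1 E2 -!big_split/=; apply: eq_bigr => k _.
rewrite -!big_split/=; apply: eq_bigr => l _; rewrite /crd !mxE; ring.
Qed.

Lemma gmean_crd_dot (k : I) a : gmean (fun v => crd v k * dot a v) = a k.
Proof.
have gk l : gint (fun v => crd v k * crd v l).
  by apply: growth_gint; apply: growthM; exact: growth_crd.
have -> : (fun v => crd v k * dot a v) = (fun v => \sum_(l : I) a l * (crd v k * crd v l)).
  apply/funext => v; rewrite mulr_sumr; apply: eq_bigr => l _; exact: mulrCA.
rewrite gmean_sum; last by move=> l; exact: gintZ.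
rewrite (bigD1 k)//= gmeanZ// (_ : (fun v => _) = (fun v => crd v k ^+ 2))//.
rewrite gmean_sqr mulr1 big1 ?addr0// => l lk.
by rewrite gmeanZ// gmean_cross ?mulr0// eq_sym.
Qed.

(** Against the odd factor [crd v k] only the part of the polynomial linear in [v] survives. Its
    coefficient vector is a/r + (H z)/r^2, and the identity covariance reads off entry [k]. *)
Lemma gmean_crd_poly (k : I) a H (r : R) z : r != 0 -> (forall k l, H k l = H l k) ->
  gmean (fun v => crd v k * (1 + dot a (r^-1 *: (z + v)) + quad H (r^-1 *: (z + v)) / 2)) =
  a k / r + hmul H z k / r ^+ 2.
Proof.
move=> r0 sH.
pose c l := a l / r + hmul H z l / r ^+ 2.
have dc v : dot c v = dot a v / r + dot (hmul H z) v / r ^+ 2.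
  by rewrite /dot !mulr_suml -big_split/=; apply: eq_bigr => l _; rewrite /c; ring.
pose q v := 1 + dot a z / r + quad H z / r ^+ 2 / 2 + quad H v * (r ^- 2 / 2).
have gq : growth q.
  apply: growthD; first exact: growth_cst.
  by apply: growthM; [exact: growth_quad|exact: growth_cst].
rewrite (_ : (fun v => _) = (fun v => crd v k * dot c v + crd v k * q v)); last first.
  apply/funext => v; rewrite !dotZ !quadZ dotD quadD// dc /q; field; exact: r0.
rewrite gmeanD; last 2 first.
- apply: growth_gint; apply: growthM; [exact: growth_crd|exact: growth_dot].
- by apply: growth_gint; apply: growthM => //; exact: growth_crd.
rewrite gmean_crd_dot gmean_odd ?addr0//.
- by apply: growth_gint; apply: growthM => //; exact: growth_crd.
- by move=> v; rewrite /q quadN /crd mxE mulNr.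
Qed.

(** The weight [1 + frob2 v] dominates both 1 and |v_k|, so one estimate serves numerator and
    denominator. From |z + v|^2 <= 2 |z|^2 + 2 |v|^2 the rate in [z] doubles, while in [v] the total
    rate is at most 1/8 + 2/8, below the admissible 1/2. *)
Lemma gmean_shift_growth g (e : R) : growth g -> 0 < e -> e < 8^-1 ->
  exists2 C, 0 < C & forall z,
    gint (fun v => (1 + frob2 v) * `|g (z + v)|) /\
    gmean (fun v => (1 + frob2 v) * `|g (z + v)|) <= C * expR (2 * e * frob2 z).
Proof.
move=> [mg gg] e0 e8; have [C C0 gC] := gg e e0.
have gi : gint (fun v : V => expR (8^-1 * 3 * frob2 v)) by apply: gint_expR_frob2; lra.
set E := gmean (fun v : V => expR (8^-1 * 3 * frob2 v)).
have E0 : 0 <= E.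
  rewrite -[leLHS](gmean_cst n p); apply: gmean_le => //; first exact: gint_cst.
exists (8 * C * (E + 1)) => [|z]; first by rewrite !mulr_gt0// ltr_wpDl.
have mf : measurable_fun setT (fun v => (1 + frob2 v) * `|g (z + v)|).
  apply: measurable_funM; first by apply: measurable_funD => //; exact: measurable_frob2.
  apply: measurableT_comp => //; apply: (measurableT_comp mg).
  have := measurable_mx_affine 1 z; congr measurable_fun.
  by apply/funext => v; rewrite scale1r addrC.
have bnd v : `|(1 + frob2 v) * `|g (z + v)| | <=
    8 * C * expR (2 * e * frob2 z) * expR (8^-1 * 3 * frob2 v).
  rewrite normrM normr_id ger0_norm ?addr_ge0 ?frob2_ge0//.
  have h1 : 1 + frob2 v <= 8 * expR (8^-1 * frob2 v).
    have := expR_ge1Dx (8^-1 * frob2 v); have := frob2_ge0 v; lra.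
  have h2 : `|g (z + v)| <= C * (expR (2 * e * frob2 z) * expR (8^-1 * 2 * frob2 v)).
    apply: (le_trans (gC _)); apply: ler_wpM2l; first exact: ltW.
    rewrite -expRD ler_expR.
    have := frob2D_le z v; have := frob2_ge0 v.
    move: (frob2 v) (frob2 z) (frob2 _) => s t u; nra.
  apply: (le_trans (ler_pM _ (normr_ge0 _) h1 h2)); first by rewrite addr_ge0 ?frob2_ge0.
  have -> : 8^-1 * 3 * frob2 v = 8^-1 * frob2 v + 8^-1 * 2 * frob2 v by ring.
  rewrite expRD le_eqVlt; apply/orP; left; apply/eqP; ring.
have gb : gint (fun v => 8 * C * expR (2 * e * frob2 z) * expR (8^-1 * 3 * frob2 v)).
  exact: gintZ.
have fi := gint_le mf bnd gb; split=> //.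
apply: (@le_trans _ _ (8 * C * expR (2 * e * frob2 z) * E)).
  rewrite /E -gmeanZ//; apply: gmean_le => // v.
  by rewrite (le_trans _ (bnd v))// ler_norm.
rewrite mulrAC; apply: ler_wpM2r; first exact: expR_ge0.
by apply: ler_wpM2l; [rewrite mulr_ge0// ltW|rewrite lerDl].
Qed.

End growth.

(** * Expansion of the posterior mean *)

Lemma ae_lebmx_affine (R : realType) n p (c : R) (u : 'M[R]_(n, p)) (P : 'M[R]_(n, p) -> Prop) :
  c != 0 -> {ae lebmx R n p, forall x, P x} ->
  {ae lebmx R n p, forall v, P (c *: v + u)}.
Proof.
move=> c0 [B [mB B0 PB]].
have ma := measurable_mx_affine c u.
exists ((fun v => c *: v + u) @^-1` B); split.
- by rewrite -[X in measurable X]setTI; exact: ma.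
- have mBi : measurable_fun setT (fun x : 'M[R]_(n, p) => (\1_B x)%:E : \bar R).
    by apply/measurable_EFinP; exact: measurable_indic.
  have mpre : measurable ((fun v => c *: v + u) @^-1` B).
    by rewrite -[X in measurable X]setTI; exact: ma.
  have := @ge0_integral_lebmx_affine R n p c u _ c0 mBi (fun x => ltac:(by rewrite lee_fin)).
  have I0 : (\int[lebmx R n p]_x (\1_B x)%:E = 0)%E by rewrite integral_indic// setIT.
  rewrite I0 mule0 => <-.
  transitivity (\int[lebmx R n p]_v (\1_((fun v => c *: v + u) @^-1` B) v)%:E)%E.
    by rewrite integral_indic// setIT.
  by apply: eq_integral => v _.
- by move=> v Pv; apply: PB.
Qed.

Section posterior_expansion.
Variables (R : realType) (n p : nat).
Local Notation V := 'M[R]_(n, p).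
Local Notation I := ('I_n * 'I_p)%type.
Local Notation lam := (lebmx R n p).
Implicit Types (x v z : V) (r : R).

Variables (rho : V -> R) (a : I -> R) (H : I -> I -> R) (C0 delta : R).
Hypothesis rho_ge0 : forall x, 0 <= rho x.
Hypothesis mrho : measurable_fun setT rho.
Hypothesis rho_int : forall e, 0 < e ->
  (\int[lam]_x (expR (- (e * frob2 x)) * rho x)%:E < +oo)%E.
(** This keeps the denominator of the posterior mean away from 0. It is an almost everywhere bound
    because [powR] makes the determinantal priors vanish on matrices of deficient rank. *)
Hypothesis rho_lb : forall e, 0 < e -> exists2 c, 0 < c &
  {ae lam, forall x, c * expR (- (e * frob2 x)) <= rho x}.
Hypothesis H_sym : forall k l, H k l = H l k.
Hypothesis delta_gt0 : 0 < delta.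
Hypothesis rho_taylor : forall x, nrm x <= delta ->
  `|rho x - (1 + dot a x + quad H x / 2)| <= C0 * nrm x ^+ 3.

Let rem x := rho x - (1 + dot a x + quad H x / 2).
Let m := (n * p + 2)%N.
Let pt r z v : V := r^-1 *: (z + v).

Let measurable_pt r z : measurable_fun setT (pt r z).
Proof.
have := measurable_mx_affine r^-1 (r^-1 *: z); congr measurable_fun.
by apply/funext => v; rewrite /pt scalerDr addrC.
Qed.

Lemma norm_dot_le (b : I -> R) : exists2 C, 0 < C & forall x, `|dot b x| <= C * nrm x.
Proof.
exists (\sum_(k : I) `|b k| + 1) => [|x].
  by rewrite ltr_wpDl// sumr_ge0.
rewrite mulrDl mul1r; apply: (@le_trans _ _ ((\sum_(k : I) `|b k|) * nrm x)); last first.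
  by rewrite lerDl nrm_ge0.
rewrite mulr_suml (le_trans (ler_norm_sum _ _ _))//; apply: ler_sum => k _.
rewrite normrM; apply: ler_wpM2l => //.
by rewrite -sqrtr_sqr ler_wsqrtr// crd_sqr_le.
Qed.

Lemma norm_crd_le x (k : I) : `|crd x k| <= nrm x.
Proof. by rewrite -sqrtr_sqr ler_wsqrtr// crd_sqr_le. Qed.

Lemma norm_quad_le : exists2 C, 0 < C & forall x, `|quad H x| <= C * nrm x ^+ 2.
Proof.
exists (\sum_(k : I) \sum_(l : I) `|H k l| + 1) => [|x].
  by rewrite ltr_wpDl// sumr_ge0// => k _; rewrite sumr_ge0.
rewrite mulrDl mul1r; apply: (@le_trans _ _ ((\sum_(k : I) \sum_(l : I) `|H k l|) * nrm x ^+ 2)); last first.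
  by rewrite lerDl sqr_ge0.
rewrite mulr_suml (le_trans (ler_norm_sum _ _ _))//; apply: ler_sum => k _.
rewrite mulr_suml (le_trans (ler_norm_sum _ _ _))//; apply: ler_sum => l _.
rewrite !normrM -mulrA; apply: ler_wpM2l => //.
by rewrite expr2; apply: ler_pM => //; exact: norm_crd_le.
Qed.

(** Turns the local Taylor bound into a global one. Outside the ball |x|/delta exceeds 1, so 1, |x|
    and |x|^2 are absorbed into |x|^3, and rho(x) into |x|^(2m) rho(x). *)
Lemma rem_bound : exists2 C, 0 < C &
  forall x, `|rem x| <= C * (nrm x ^+ 3 + frob2 x ^+ m * rho x).
Proof.
have [Ca Ca0 Ha] := norm_dot_le a.
have [Ch Ch0 Hh] := norm_quad_le.
pose d := delta^-1.
have d0 : 0 < d by rewrite invr_gt0.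
exists (`|C0| + (d ^+ 2) ^+ m + (d ^+ 3 + Ca * d ^+ 2 + Ch * d)) => [|x].
  apply: ltr_wpDl; first by apply: addr_ge0; [exact: normr_ge0|rewrite exprn_ge0// sqr_ge0].
  by rewrite addr_gt0 ?mulr_gt0// addr_gt0 ?mulr_gt0 ?exprn_gt0.
set K := d ^+ 3 + _ + _.
have K0 : 0 <= K by rewrite !addr_ge0 ?mulr_ge0 ?exprn_ge0// ltW.
have n3 : 0 <= nrm x ^+ 3 by rewrite exprn_ge0// nrm_ge0.
have fr0 : 0 <= frob2 x ^+ m * rho x by rewrite mulr_ge0 ?exprn_ge0 ?frob2_ge0.
have d2m : 0 <= (d ^+ 2) ^+ m by rewrite exprn_ge0 ?sqr_ge0.
have [xd|xd] := leP (nrm x) delta.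
  apply: (le_trans (rho_taylor xd)).
  apply: (@le_trans _ _ (`|C0| * nrm x ^+ 3)); first by apply: ler_wpM2r => //; exact: ler_norm.
  by apply: ler_pM => //; rewrite ?lerDl// -addrA lerDl addr_ge0.
have u1 : 1 <= d * nrm x by rewrite mulrC ler_pdivlMr// mul1r ltW.
have u0 := nrm_ge0 x.
have A1 : 1 <= d ^+ 3 * nrm x ^+ 3 by rewrite -exprMn exprn_ege1.
have A2 : Ca * nrm x <= Ca * d ^+ 2 * nrm x ^+ 3.
  rewrite -mulrA; apply: ler_wpM2l; first exact: ltW.
  by rewrite (exprSr _ 2) mulrA -exprMn ler_peMl// exprn_ege1.
have A3 : Ch * nrm x ^+ 2 <= Ch * d * nrm x ^+ 3.
  rewrite -mulrA; apply: ler_wpM2l; first exact: ltW.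
  by rewrite (exprS _ 2) mulrA ler_peMl// sqr_ge0.
have A4 : rho x <= (d ^+ 2) ^+ m * (frob2 x ^+ m * rho x).
  rewrite mulrA ler_peMl// -exprMn exprn_ege1// -nrm_sqr -exprMn exprn_ege1//.
have B1 : `|rem x| <= rho x + 1 + Ca * nrm x + Ch * nrm x ^+ 2.
  have -> : rem x = rho x - 1 - dot a x - quad H x / 2 by rewrite /rem; ring.
  have h1 := ler_normB (rho x - 1 - dot a x) (quad H x / 2).
  have h2 := ler_normB (rho x - 1) (dot a x).
  have h3 := ler_normB (rho x) 1.
  rewrite normr1 (ger0_norm (rho_ge0 x)) in h3.
  have h4 : `|quad H x / 2| <= `|quad H x|.
    by rewrite normrM ler_piMr// gtr0_norm ?invr_gt0// invf_le1 ?ler1n.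
  by have := Ha x; have := Hh x; lra.
apply: (le_trans B1).
rewrite (_ : (_ + _) * (_ + _) = `|C0| * (nrm x ^+ 3 + frob2 x ^+ m * rho x) +
  (d ^+ 2) ^+ m * nrm x ^+ 3 + (d ^+ 2) ^+ m * (frob2 x ^+ m * rho x) +
  (d ^+ 3 * nrm x ^+ 3 + Ca * d ^+ 2 * nrm x ^+ 3 + Ch * d * nrm x ^+ 3) +
  K * (frob2 x ^+ m * rho x)); last by rewrite /K; ring.
have P1 : 0 <= `|C0| * (nrm x ^+ 3 + frob2 x ^+ m * rho x) by rewrite mulr_ge0 ?addr_ge0.
have P2 : 0 <= (d ^+ 2) ^+ m * nrm x ^+ 3 by rewrite mulr_ge0.
have P3 : 0 <= K * (frob2 x ^+ m * rho x) by rewrite mulr_ge0.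
lra.
Qed.

Let tailw r z v := (1 + frob2 v) * (frob2 (pt r z v) ^+ m * rho (pt r z v)).

Let measurable_tailw r z : measurable_fun setT (tailw r z).
Proof.
apply: measurable_funM; first by apply: measurable_funD => //; exact: measurable_frob2.
apply: measurable_funM; last exact: (measurableT_comp mrho (measurable_pt r z)).
by apply: measurable_funX; exact: (measurableT_comp (@measurable_frob2 R n p) (measurable_pt r z)).
Qed.

(* The factor [|x|^(2 m)] with [2 m >= n p + 3] compensates the Jacobian
   [r^(n p)] of the substitution [v = r x - z]. *)
Lemma tail_bound (e : R) : 0 < e -> e <= 4^-1 -> exists2 C, 0 < C &
  forall r z, 1 <= r -> gint (tailw r z) /\
    gmean (tailw r z) <= C * r ^- 3 * expR (e * frob2 z).
Proof.
move=> e0 e4; have e40 : 0 < e / 4 by rewrite divr_gt0.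
have [Cm Cm0 HCm] := exprn_le_expR m e40.
pose h x := expR (- (e / 4 * frob2 x)) * rho x.
have h0 x : 0 <= h x by rewrite mulr_ge0 ?expR_ge0.
have mh : measurable_fun setT h.
  apply: measurable_funM => //; apply: measurableT_comp => //; apply: measurable_funN.
  by apply: measurable_funM => //; exact: measurable_frob2.
have := rho_int e40; set K := (\int[lam]_x _)%E => Kfin.
have K0 : (0 <= K)%E by apply: integral_ge0 => x _; rewrite lee_fin h0.
have KE : K = (fine K)%:E by rewrite fineK// ge0_fin_numE.
have fK0 : 0 <= fine K by apply: fine_ge0.
pose kap : R := ((2 * pi)^-1) `^ ((n * p)%:R / 2).
have kap0 : 0 < kap by exact: gw_const_gt0.
exists (8 * kap * Cm * (fine K + 1)) => [|r z r1].
  by rewrite !mulr_gt0// ltr_wpDl.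
have r0 : 0 < r by exact: lt_le_trans r1.
set D := 8 * kap * Cm.
have D0 : 0 < D by rewrite !mulr_gt0.
have tw0 v : 0 <= tailw r z v.
  by rewrite !mulr_ge0 ?addr_ge0 ?exprn_ge0 ?frob2_ge0.
have pw v : tailw r z v * gw v <= D * (r ^+ 2) ^- m * expR (e * frob2 z) * h (pt r z v).
  set x := pt r z v.
  have vE : v = r *: x - z.
    by rewrite /x /pt scalerA mulfV ?gt_eqF// scale1r addrC addKr.
  (* Through this inequality the weight exp(- e |v|^2) becomes exp(e |z|^2) exp(- e r^2 |x|^2 / 2).
     Half of the last exponent absorbs the power (r |x|)^(2m), the other half leaves the weight in
     [h]. *)
  have hv : r ^+ 2 * frob2 x / 2 - frob2 z <= frob2 v.
    by rewrite [in leRHS]vE -frob2Z; exact: frob2_triangle.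
  have g1 : (1 + frob2 v) * gw v <= 8 * kap * expR (- (e * frob2 v)).
    have q1 : 1 + frob2 v <= 8 * expR (8^-1 * frob2 v).
      by have := expR_ge1Dx (8^-1 * frob2 v); have := frob2_ge0 v; lra.
    apply: (@le_trans _ _ (8 * expR (8^-1 * frob2 v) * gw v)).
      by apply: ler_wpM2r => //; exact: gw_ge0.
    rewrite /gw -/kap mulrACA -expRD; apply: ler_wpM2l; first by rewrite mulr_ge0// ltW.
    rewrite ler_expR; have := frob2_ge0 v; nra.
  have g2 : expR (- (e * frob2 v)) <= expR (e * frob2 z) * expR (- (e / 2 * (r ^+ 2 * frob2 x))).
    by rewrite -expRD ler_expR; nra.
  have t0 : 0 <= r ^+ 2 * frob2 x by rewrite mulr_ge0 ?sqr_ge0 ?frob2_ge0.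
  have g3 : frob2 x ^+ m <= (r ^+ 2) ^- m * (Cm * expR (e / 4 * (r ^+ 2 * frob2 x))).
    by rewrite mulrC ler_pdivlMr ?exprn_gt0// mulrC -exprMn; exact: HCm.
  have g4 : expR (- (e / 4 * (r ^+ 2 * frob2 x))) <= expR (- (e / 4 * frob2 x)).
    rewrite ler_expR lerN2; apply: ler_wpM2l; first exact: ltW.
    by rewrite ler_peMl ?frob2_ge0// exprn_ege1.
  rewrite /tailw -/x /h.
  have -> : (1 + frob2 v) * (frob2 x ^+ m * rho x) * gw v =
    ((1 + frob2 v) * gw v) * frob2 x ^+ m * rho x by ring.
  rewrite [leRHS]mulrA; apply: ler_wpM2r => //.
  apply: (@le_trans _ _ ((8 * kap * (expR (e * frob2 z) * expR (- (e / 2 * (r ^+ 2 * frob2 x))))) *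
      ((r ^+ 2) ^- m * (Cm * expR (e / 4 * (r ^+ 2 * frob2 x)))))).
    apply: ler_pM => //.
    - by rewrite mulr_ge0 ?gw_ge0// addr_ge0 ?frob2_ge0.
    - by rewrite exprn_ge0 ?frob2_ge0.
    - by apply: (le_trans g1); apply: ler_wpM2l => //; rewrite mulr_ge0// ltW.
  have eE : expR (- (e / 2 * (r ^+ 2 * frob2 x))) * expR (e / 4 * (r ^+ 2 * frob2 x)) =
      expR (- (e / 4 * (r ^+ 2 * frob2 x))).
    by rewrite -expRD; congr expR; field.
  rewrite (_ : _ * _ = D * (r ^+ 2) ^- m * expR (e * frob2 z) *
    (expR (- (e / 2 * (r ^+ 2 * frob2 x))) * expR (e / 4 * (r ^+ 2 * frob2 x)))); last first.
    by rewrite /D; ring.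
  rewrite eE; apply: ler_wpM2l => //.
  by rewrite !mulr_ge0 ?expR_ge0// ?invr_ge0 ?exprn_ge0// ltW.
have int_le : (\int[lam]_v (tailw r z v * gw v)%:E <=
    (D * fine K * r ^- 3 * expR (e * frob2 z))%:E)%E.
  apply: (@le_trans _ _ (\int[lam]_v ((D * (r ^+ 2) ^- m * expR (e * frob2 z))%:E *
      (h (pt r z v))%:E))%E).
    apply: ge0_le_integral => //.
    - by move=> v _; rewrite lee_fin mulr_ge0 ?gw_ge0.
    - apply/measurable_EFinP; apply: measurable_funM => //; exact: measurable_gw.
    - apply: emeasurable_funM => //; apply/measurable_EFinP.
      exact: (measurableT_comp mh (measurable_pt r z)).
    - by move=> v _; rewrite -EFinM lee_fin.
  rewrite ge0_integralZl//; last 3 first.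
  - by apply/measurable_EFinP; exact: (measurableT_comp mh (measurable_pt r z)).
  - by move=> v _; rewrite lee_fin.
  - by rewrite lee_fin !mulr_ge0 ?expR_ge0// ?invr_ge0 ?exprn_ge0// ltW.
  have -> : (\int[lam]_v (h (pt r z v))%:E = (r ^+ (n * p))%:E * K)%E.
    have := @ge0_integral_lebmx_affine R n p r^-1 (r^-1 *: z) (fun x => (h x)%:E)
      (invr_neq0 (lt0r_neq0 r0)).
    rewrite gtr0_norm ?invr_gt0// exprVn invrK => <-.
    - by apply: eq_integral => v _; rewrite /pt scalerDr addrC.
    - exact/measurable_EFinP.
    - by move=> x; rewrite lee_fin.
  rewrite KE -!EFinM lee_fin.
  have mulE (A B E X Y : R) : A * X * E * (Y * B) = A * B * E * (X * Y) by ring.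
  rewrite mulE.
  rewrite [leRHS]mulrAC; apply: ler_wpM2l; first by rewrite !mulr_ge0 ?expR_ge0// ltW.
  rewrite -exprM mulrC ler_pdivrMr ?exprn_gt0// mulrC ler_pdivlMr ?exprn_gt0//.
  rewrite -exprD; apply: ler_weXn2l; first exact: r1.
  by rewrite /m; clear; lia.
have gi : gint (tailw r z).
  apply/integrableP; split.
    by apply/measurable_EFinP; apply: measurable_funM => //; exact: measurable_gw.
  rewrite (eq_integral (fun v => (tailw r z v * gw v)%:E)).
    exact: le_lt_trans int_le (ltry _).
  by move=> v _; rewrite gee0_abs// lee_fin mulr_ge0// gw_ge0.
split=> //; rewrite -lee_fin -gmeanE//; apply: (le_trans int_le).
rewrite lee_fin; apply: ler_wpM2r; first exact: expR_ge0.
apply: ler_wpM2r; first by rewrite invr_ge0 exprn_ge0// ltW.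
by apply: ler_wpM2l; [exact: ltW|rewrite lerDl].
Qed.

Let measurable_rem r z : measurable_fun setT (fun v => rem (pt r z v)).
Proof.
apply: (measurableT_comp _ (measurable_pt r z)); apply: measurable_funB => //.
apply: measurable_funD; last by apply: measurable_funM => //; have [] := growth_quad H.
by apply: measurable_funD => //; have [] := growth_dot a.
Qed.

Lemma rem_mean_bound (e : R) : 0 < e -> e < 4^-1 -> exists2 C, 0 < C &
  forall r z, 1 <= r ->
    gint (fun v => (1 + frob2 v) * `|rem (pt r z v)|) /\
    gmean (fun v => (1 + frob2 v) * `|rem (pt r z v)|) <= C * r ^- 3 * expR (e * frob2 z).
Proof.
move=> e0 e4.
have [C1 C10 H1] := rem_bound.
have [C2 C20 H2] := tail_bound e0 (ltW e4).
have e20 : 0 < e / 2 by rewrite divr_gt0.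
have [C3 C30 H3] := gmean_shift_growth (@growth_nrmX R n p 3) e20 (ltac:(lra) : e / 2 < 8^-1).
exists (C1 * (C3 + C2)) => [|r z r1]; first by rewrite mulr_gt0// addr_gt0.
have r0 : 0 < r by exact: lt_le_trans r1.
have [t1 t2] := H2 r z r1; have [s1 s2] := H3 z.
have mrem := measurable_rem r z.
have mf : measurable_fun setT (fun v => (1 + frob2 v) * `|rem (pt r z v)|).
  apply: measurable_funM; first by apply: measurable_funD => //; exact: measurable_frob2.
  exact: measurableT_comp.
pose g v := C1 * (r ^- 3 * ((1 + frob2 v) * `|nrm (z + v) ^+ 3|) + tailw r z v).
have fg v : `|(1 + frob2 v) * `|rem (pt r z v)| | <= g v.
  have f1 : 0 <= 1 + frob2 v by rewrite addr_ge0 ?frob2_ge0.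
  rewrite ger0_norm ?mulr_ge0//; apply: (le_trans (ler_wpM2l f1 (H1 _))).
  rewrite /g /tailw nrmZ ?invr_ge0 ?(ltW r0)// exprMn exprVn.
  rewrite ger0_norm ?exprn_ge0 ?nrm_ge0//.
  by rewrite le_eqVlt; apply/orP; left; apply/eqP; rewrite /pt; ring.
have i1 : gint (fun v => r ^- 3 * ((1 + frob2 v) * `|nrm (z + v) ^+ 3|)) by exact: gintZ.
have gi : gint g by apply: gintZ; exact: gintD.
split; first exact: gint_le gi.
have := gmean_norm_le mf fg gi; rewrite gmeanZ; last exact: gintD.
rewrite gmeanD// gmeanZ// => Hm.
apply: (le_trans (ler_norm _)); apply: (le_trans Hm).
rewrite -!mulrA; apply: ler_wpM2l; first exact: ltW.
rewrite mulrDl; apply: lerD; last by rewrite mulrA.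
rewrite mulrCA; apply: ler_wpM2l; first by rewrite invr_ge0 exprn_ge0// ltW.
by rewrite (le_trans s2)// (_ : 2 * (e / 2) = e)//; field.
Qed.

Definition post_num r z k := gmean (fun v => crd v k * rho (pt r z v)).
Definition post_den r z := gmean (fun v => rho (pt r z v)).

Let poly r z v := 1 + dot a (pt r z v) + quad H (pt r z v) / 2.

Let polyE r z v : poly r z v = (1 + r^-1 * dot a z + r ^- 2 * quad H z / 2) +
  (r^-1 * dot a v + (r ^- 2 * dot (hmul H z) v + r ^- 2 / 2 * quad H v)).
Proof.
rewrite /poly !dotZ !quadZ dotD quadD// -!exprVn; move: r^-1 => c; by field.
Qed.

Let growth_poly r z : growth (poly r z).
Proof.
have -> : poly r z = fun v => (1 + r^-1 * dot a z + r ^- 2 * quad H z / 2) +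
  (r^-1 * dot a v + (r ^- 2 * dot (hmul H z) v + r ^- 2 / 2 * quad H v)).
  by apply/funext => v; rewrite polyE.
apply: growthD; first exact: growth_cst.
apply: growthD; first by apply: growthM; [exact: growth_cst|exact: growth_dot].
apply: growthD; first by apply: growthM; [exact: growth_cst|exact: growth_dot].
by apply: growthM; [exact: growth_cst|exact: growth_quad].
Qed.

Let rhoE r z v : rho (pt r z v) = poly r z v + rem (pt r z v).
Proof. by rewrite /rem /poly addrC subrK. Qed.

Lemma norm_crd_le1 v (k : I) : `|crd v k| <= 1 + frob2 v.
Proof.
apply: (le_trans (norm_crd_le v k)); rewrite -nrm_sqr.
by have := sqr_ge0 (nrm v - 2^-1); nra.
Qed.

Let crd_rem_le r z v k : `|crd v k * rem (pt r z v)| <= (1 + frob2 v) * `|rem (pt r z v)|.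
Proof. by rewrite normrM; apply: ler_wpM2r => //; exact: norm_crd_le1. Qed.

Let rem_le r z v : `|rem (pt r z v)| <= (1 + frob2 v) * `|rem (pt r z v)|.
Proof. by rewrite ler_peMl// lerDl frob2_ge0. Qed.

Let rem_mean (e : R) (e0 : 0 < e) (e4 : e < 4^-1) :=
  rem_mean_bound e0 e4.

Let eighth : (0 : R) < 8^-1. Proof. by rewrite invr_gt0. Qed.
Let eighth4 : 8^-1 < 4^-1 :> R. Proof. lra. Qed.

Let gint_rem r z : 1 <= r -> gint (fun v => rem (pt r z v)).
Proof.
move=> r1; have [C _ /(_ r z r1)[gi _]] := rem_mean eighth eighth4.
exact: gint_le gi.
Qed.

Let gint_crd_rem r z k : 1 <= r -> gint (fun v => crd v k * rem (pt r z v)).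
Proof.
move=> r1; have [C _ /(_ r z r1)[gi _]] := rem_mean eighth eighth4.
apply: gint_le gi => //; apply: measurable_funM => //; exact: measurable_crd.
Qed.

Let gint_crd_poly r z k : gint (fun v => crd v k * poly r z v).
Proof. by apply: growth_gint; apply: growthM; [exact: growth_crd|]. Qed.

Lemma gint_post_den r z : 1 <= r -> gint (fun v => rho (pt r z v)).
Proof.
move=> r1; apply: eq_gint (gintD (growth_gint (growth_poly r z)) (gint_rem z r1)) => v.
by rewrite rhoE.
Qed.

Lemma gint_post_num r z k : 1 <= r -> gint (fun v => crd v k * rho (pt r z v)).
Proof.
move=> r1; apply: eq_gint (gintD (gint_crd_poly r z k) (gint_crd_rem z k r1)) => v.
by rewrite rhoE [RHS]mulrDr.
Qed.

Lemma post_num_expansion (e : R) : 0 < e -> e < 4^-1 -> exists2 C, 0 < C &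
  forall r z k, 1 <= r ->
  `|post_num r z k - (a k / r + hmul H z k / r ^+ 2)| <= C * r ^- 3 * expR (e * frob2 z).
Proof.
move=> e0 e4; have [C C_gt0 HC] := rem_mean e0 e4; exists C => // r z k r1.
have [gi gb] := HC r z r1.
have r0 : r != 0 by rewrite gt_eqF// (lt_le_trans ltr01 r1).
rewrite /post_num.
have -> : (fun v => crd v k * rho (pt r z v)) =
    (fun v => crd v k * poly r z v + crd v k * rem (pt r z v)).
  by apply/funext => v; rewrite rhoE [LHS]mulrDr.
rewrite gmeanD//; last exact: gint_crd_rem.
rewrite gmean_crd_poly// addrC addKr; apply: le_trans gb.
have mc : measurable_fun setT (fun v => crd v k * rem (pt r z v)).
  by apply: measurable_funM => //; exact: measurable_crd.
exact: (gmean_norm_le mc (fun v => crd_rem_le r z v k) gi).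
Qed.

(** An error of order r^(-2) suffices here, because the numerator is itself of order 1/r and the
    quotient is wanted up to r^(-3). *)
Lemma post_den_expansion (e : R) : 0 < e -> e < 4^-1 -> exists2 C, 0 < C &
  forall r z, 1 <= r ->
  `|post_den r z - (1 + dot a z / r)| <= C * r ^- 2 * expR (e * frob2 z).
Proof.
move=> e0 e4; have [C C_gt0 HC] := rem_mean e0 e4.
have e20 : 0 < e / 2 by rewrite divr_gt0.
have [D D_gt0 HD] := gmean_shift_growth (growth_quad H) e20 (ltac:(lra) : e / 2 < 8^-1).
exists (D + C) => [|r z r1]; first exact: addr_gt0.
have [gi gb] := HC r z r1; have [hi hb] := HD z.
have r0 : 0 < r by rewrite (lt_le_trans ltr01 r1).
have mq : measurable_fun setT (fun v => quad H (z + v)).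
  have [mq _] := growth_quad H; apply: (measurableT_comp mq).
  have := measurable_mx_affine 1 z; congr measurable_fun.
  by apply/funext => v; rewrite scale1r addrC.
have q_le v : `|quad H (z + v)| <= (1 + frob2 v) * `|quad H (z + v)|.
  by rewrite ler_peMl// lerDl frob2_ge0.
have qi : gint (fun v => quad H (z + v)) by exact: gint_le hi.
have di : gint (dot a : V -> R) by apply: growth_gint; exact: growth_dot.
rewrite /post_den.
have -> : (fun v => rho (pt r z v)) = (fun v => (1 + dot a z / r) +
    (r^-1 * dot a v + (r ^- 2 / 2 * quad H (z + v) + rem (pt r z v)))).
  by apply/funext => v; rewrite rhoE /poly !dotZ !quadZ dotD exprVn; ring.
rewrite gmeanD; [|exact: gint_cst|]; last first.
  by apply: gintD; [exact: gintZ|apply: gintD; [exact: gintZ|exact: gint_rem]].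
rewrite gmean_cst addrC addKr.
rewrite gmeanD; [|exact: gintZ|]; last first.
  by apply: gintD; [exact: gintZ|exact: gint_rem].
rewrite gmeanZ// (gmean_odd di) ?mulr0 ?add0r; last by move=> v; rewrite dotN.
rewrite gmeanD; [|exact: gintZ|exact: gint_rem]; rewrite gmeanZ//.
apply: (le_trans (ler_normD _ _)).
rewrite mulrDl mulrDl; apply: lerD.
  rewrite normrM ger0_norm ?divr_ge0 ?invr_ge0 ?exprn_ge0 ?(ltW r0)//.
  have qb : `|gmean (fun v => quad H (z + v))| <= D * expR (e * frob2 z).
    apply: (le_trans (gmean_norm_le mq q_le hi)).
    by rewrite (le_trans hb)// (_ : 2 * (e / 2) = e)//; field.
  have ir : 0 < r ^- 2 by rewrite invr_gt0 exprn_gt0.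
  rewrite [leRHS]mulrAC [leRHS]mulrC.
  apply: ler_pM => //; first by rewrite divr_ge0// ltW.
  by rewrite ler_pdivrMr// ler_peMr ?ler1n// ltW.
apply: (le_trans (gmean_norm_le (measurable_rem r z) (rem_le r z) gi)).
apply: (le_trans gb); apply: ler_wpM2r; first exact: expR_ge0.
apply: ler_wpM2l; first exact: ltW.
rewrite lef_pV2 ?posrE ?exprn_gt0//.
by rewrite ler_weXn2l.
Qed.

(** Uniform in [r >= 1] because the argument of rho has norm at most |z + v|. Dividing by the
    denominator thus costs only a factor exp(e |z|^2). *)
Lemma post_den_lb (e : R) : 0 < e -> exists2 c, 0 < c &
  forall r z, 1 <= r -> c * expR (- (e * frob2 z)) <= post_den r z.
Proof.
move=> e0; have e20 : 0 < e / 2 by rewrite divr_gt0.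
have [c c0 ae_c] := rho_lb e20.
have ei : gint (fun v : V => expR (- e * frob2 v)) by apply: gint_expR_frob2; lra.
set E := gmean (fun v : V => expR (- e * frob2 v)).
have E0 : 0 < E.
  rewrite -lte_fin /E -gmeanE//.
  rewrite (eq_integral (fun v => (((2 * pi)^-1) `^ ((n * p)%:R / 2))%:E *
    (expR (- ((1 + 2 * e) * frob2 v) / 2))%:E)%E); last first.
    move=> v _; rewrite -EFinM; congr EFin; rewrite /gw mulrCA -expRD.
    by congr (_ * expR _); field.
  have a0 : 0 < 1 + 2 * e by lra.
  rewrite ge0_integralZl//.
  - rewrite integral_gauss_matrix// -EFinM lte_fin mulr_gt0 ?gw_const_gt0//.
    by rewrite exprn_gt0// divr_gt0 ?sqrtr_gt0// mulr_gt0// pi_gt0.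
  - apply/measurable_EFinP; under eq_fun do rewrite mulNr mulrAC -mulNr.
    exact: measurable_expR_frob2.
  - by rewrite lee_fin ltW// gw_const_gt0.
exists (c * E) => [|r z r1]; first exact: mulr_gt0.
have r0 : r != 0 by rewrite gt_eqF// (lt_le_trans ltr01 r1).
have ae_v := ae_lebmx_affine (r^-1 *: z) (invr_neq0 r0) ae_c.
rewrite -lee_fin -gmeanE; last exact: gint_post_den.
rewrite mulrAC EFinM -gmeanE// -ge0_integralZl//; last 3 first.
- apply/measurable_EFinP; apply: measurable_funM; last exact: measurable_gw.
  exact: measurable_expR_frob2.
- by move=> v _; rewrite lee_fin mulr_ge0 ?expR_ge0 ?gw_ge0.
- by rewrite lee_fin mulr_ge0 ?expR_ge0// ltW.
apply: ae_ge0_le_integral => //.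
- move=> v _; rewrite -EFinM lee_fin; apply: mulr_ge0.
    by apply: mulr_ge0; [exact: ltW|exact: expR_ge0].
  by apply: mulr_ge0; [exact: expR_ge0|exact: gw_ge0].
- apply: emeasurable_funM => //; apply/measurable_EFinP; apply: measurable_funM.
    exact: measurable_expR_frob2.
  exact: measurable_gw.
- by move=> v _; rewrite lee_fin mulr_ge0 ?gw_ge0.
- apply/measurable_EFinP; apply: measurable_funM; last exact: measurable_gw.
  exact: (measurableT_comp mrho (measurable_pt r z)).
apply: filterS ae_v => v Hv _.
rewrite -EFinM lee_fin mulrA; apply: ler_wpM2r; first exact: gw_ge0.
have -> : pt r z v = r^-1 *: v + r^-1 *: z by rewrite /pt scalerDr addrC.
apply: le_trans Hv; rewrite -mulrA -expRD; apply: ler_wpM2l; first exact: ltW.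
rewrite ler_expR -scalerDr frob2Z.
have h1 := frob2D_le v z; have h0 := frob2_ge0 (v + z).
have h2 : r^-1 ^+ 2 * frob2 (v + z) <= frob2 (v + z).
  rewrite ler_piMl// exprVn invf_le1 ?exprn_gt0 ?(lt_le_trans ltr01 r1)//.
  exact: exprn_ege1.
move: (frob2 (v + z)) (frob2 v) (frob2 z) (r^-1 ^+ 2 * _) h1 h2 h0 => s t u w; nra.
Qed.

(** The Hessian of log rho at 0. *)
Let L k l := H k l - a k * a l.

Let hmulL z k : hmul L z k = hmul H z k - a k * dot a z.
Proof.
rewrite /hmul /dot mulr_sumr -sumrB; apply: eq_bigr => l _.
by rewrite /L; ring.
Qed.

Lemma post_ratio_expansion (e : R) : 0 < e -> e < 4^-1 -> exists2 C, 0 < C &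
  forall r z k, 1 <= r ->
  `|post_num r z k / post_den r z - (a k / r + hmul L z k / r ^+ 2)| <=
    C * r ^- 3 * expR (3 * e * frob2 z).
Proof.
move=> e0 e4.
have [CA CA0 HA] := post_num_expansion e0 e4.
have [CB CB0 HB] := post_den_expansion e0 e4.
have [c c0 Hc] := post_den_lb e0.
have [_ /(_ e e0)[Ct Ct0 Ht]] := growth_dot (n := n) (p := p) a.
have [CL CL0 HL] : exists2 C, 0 < C & forall z (k : I), `|hmul L z k| <= C * expR (e * frob2 z).
  have /choice[F HF] : forall k : I, exists C, 0 < C /\
      forall z, `|hmul L z k| <= C * expR (e * frob2 z).
    by move=> k; have [_ /(_ e e0)[C ? ?]] := growth_hmul L k; exists C.
  exists (\sum_(k : I) F k + 1) => [|z k].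
    by rewrite ltr_wpDl// sumr_ge0// => k _; have [/ltW] := HF k.
  have [F0 HFk] := HF k; apply: (le_trans (HFk z)); apply: ler_wpM2r; first exact: expR_ge0.
  rewrite (bigD1 k)//= -addrA lerDl addr_ge0// sumr_ge0// => l _.
  by have [/ltW] := HF l.
pose Ca := \sum_(k : I) `|a k|.
have Ha k : `|a k| <= Ca.
  by rewrite /Ca (bigD1 k)//= lerDl sumr_ge0.
have Ca0 : 0 <= Ca by rewrite sumr_ge0.
pose S := CA + Ca * CB + CL * (Ct + CB).
have S0 : 0 < S.
  rewrite /S -addrA ltr_pwDl// addr_ge0// mulr_ge0// ?(ltW CB0) ?(ltW CL0)//.
  by rewrite ltW// addr_gt0.
exists (S / c) => [|r z k r1]; first exact: divr_gt0.
set w := expR (e * frob2 z).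
have w1 : 1 <= w by rewrite -expR0 ler_expR mulr_ge0 ?frob2_ge0// ltW.
have w0 : 0 < w by exact: lt_le_trans w1.
have w3 : expR (3 * e * frob2 z) = w ^+ 3.
  by rewrite -expRM_natl; congr expR; ring.
have r0 : 0 < r by exact: lt_le_trans r1.
have rn0 : r != 0 by rewrite gt_eqF.
have {HA} hA := HA r z k r1; have {HB} hB := HB r z r1.
have {}Hc : c / w <= post_den r z by have := Hc r z r1; rewrite expRN.
have {HL} hL := HL z k; have {Ht} ht := Ht z; have {Ha} ha := Ha k.
rewrite -/w in hA hB hL ht.
have B0 : 0 < post_den r z by apply: lt_le_trans Hc; rewrite divr_gt0.
have Bn0 : post_den r z != 0 by rewrite gt_eqF.
move: hmulL => /(_ z k) hLE.
set A := post_num r z k in hA *; set B := post_den r z in hB Hc B0 Bn0 *.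
(* Uses (a_k / r) (1 + a.z / r) = a_k / r + ((H - L) z)_k / r^2, so the principal terms cancel. The
   remaining terms carry at most w^2, and the bound on 1/B adds the third power of [w]. *)
have -> : A / B - (a k / r + hmul L z k / r ^+ 2) =
    (A - (a k / r + hmul H z k / r ^+ 2) - a k / r * (B - (1 + dot a z / r))
      - hmul L z k / r ^+ 2 * (B - 1)) / B.
  by rewrite hLE; field; rewrite Bn0.
have ir0 : 0 < r^-1 by rewrite invr_gt0.
have ir1 : r^-1 <= 1 by rewrite invf_le1.
have hB1 : `|B - 1| <= (Ct + CB) * r^-1 * w.
  have -> : B - 1 = (B - (1 + dot a z / r)) + dot a z / r by ring.
  apply: (le_trans (ler_normD _ _)); rewrite normrM [`|r^-1|]gtr0_norm//.
  apply: (@le_trans _ _ (CB * r^-1 * w + Ct * w * r^-1)).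
    apply: lerD; last by apply: ler_wpM2r => //; exact: ltW.
    apply: (le_trans hB); apply: ler_wpM2r; first exact: ltW.
    apply: ler_wpM2l; first exact: ltW.
    by rewrite expr2 invfM ler_piMl// ltW.
  by rewrite le_eqVlt; apply/orP; left; apply/eqP; ring.
have num_le : `|A - (a k / r + hmul H z k / r ^+ 2) - a k / r * (B - (1 + dot a z / r))
      - hmul L z k / r ^+ 2 * (B - 1)| <= S * r ^- 3 * w ^+ 2.
  apply: (le_trans (ler_normB _ _)); apply: (le_trans (lerD (ler_normB _ _) (lexx _))).
  rewrite !normrM ![`|r^-1|]gtr0_norm// [`|(r ^+ 2)^-1|]gtr0_norm ?invr_gt0 ?exprn_gt0//.
  apply: (@le_trans _ _ (CA * r ^- 3 * w + Ca * r^-1 * (CB * r ^- 2 * w) +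
      CL * w * r ^- 2 * ((Ct + CB) * r^-1 * w))).
    apply: lerD; first apply: lerD => //.
      apply: ler_pM => //; first by rewrite mulr_ge0// ltW.
      by apply: ler_wpM2r => //; exact: ltW.
    apply: ler_pM => //; first by rewrite mulr_ge0// invr_ge0 exprn_ge0// ltW.
    by apply: ler_wpM2r => //; rewrite invr_ge0 exprn_ge0// ltW.
  have ww : w <= w ^+ 2 by rewrite expr2 ler_peMl// ltW.
  have i3 : r^-1 * r ^- 2 = r ^- 3 by rewrite -invfM -exprS.
  rewrite (_ : _ + _ = (CA + Ca * CB) * r ^- 3 * w + CL * (Ct + CB) * r ^- 3 * w ^+ 2); last first.
    by rewrite -i3; ring.
  rewrite /S [in leRHS]mulrDl [in leRHS]mulrDl; apply: lerD => //.
  apply: ler_wpM2l => //; rewrite mulr_ge0 ?invr_ge0 ?exprn_ge0 ?(ltW r0)//.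
  by rewrite addr_ge0 ?mulr_ge0// ltW.
rewrite normrM normfV (gtr0_norm B0) w3 ler_pdivrMr//.
apply: (le_trans num_le).
apply: (@le_trans _ _ (S / c * r ^- 3 * w ^+ 3 * (c / w))).
  rewrite le_eqVlt; apply/orP; left; apply/eqP; field.
  by rewrite !gt_eqF.
apply: ler_wpM2l => //.
rewrite !mulr_ge0 ?invr_ge0 ?exprn_ge0 ?(ltW S0) ?(ltW c0) ?(ltW w0) ?(ltW r0)//.
Qed.

Let measurable_pair_fun (f : V -> R) r : measurable_fun setT f ->
  measurable_fun setT (fun u : V * V => (f u.2 * rho (pt r u.1 u.2) * gw u.2)%:E).
Proof.
move=> mf; apply/measurable_EFinP; apply: measurable_funM; last first.
  exact: (measurableT_comp (@measurable_gw R n p) measurable_snd).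
apply: measurable_funM; first exact: (measurableT_comp mf measurable_snd).
have mp : measurable_fun setT (fun u : V * V => pt r u.1 u.2).
  apply: measurable_fun_mx => i j; under eq_fun do rewrite /pt !mxE.
  apply: measurable_funM => //; apply: measurable_funD.
    exact: (measurableT_comp (@measurable_coord R n p i j) measurable_fst).
  exact: (measurableT_comp (@measurable_coord R n p i j) measurable_snd).
exact: (measurableT_comp mrho mp).
Qed.

Lemma measurable_post_num r k : measurable_fun setT (fun z => post_num r z k).
Proof.
have mi := @measurable_fun_integral _ _ _ _ _ lam _ (measurable_pair_fun r (measurable_crd k)).
exact: (measurableT_comp (fine_measurable measurableT) mi).
Qed.

Lemma measurable_post_den r : measurable_fun setT (post_den r).
Proof.
have m1 : measurable_fun setT (fun _ : V => 1 : R) by exact: measurable_cst.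
have mi := @measurable_fun_integral _ _ _ _ _ lam _ (measurable_pair_fun r m1).
have := measurableT_comp (fine_measurable measurableT) mi.
congr measurable_fun; apply/funext => z /=; rewrite /post_den /gmean.
by congr fine; apply: eq_integral => v _; rewrite mul1r.
Qed.

Lemma post_den_ge0 r z : 0 <= post_den r z.
Proof.
by apply: fine_ge0; apply: integral_ge0 => v _; rewrite lee_fin mulr_ge0 ?gw_ge0.
Qed.

(** Estimation error at the observation M + z/r, in units of 1/r. *)
Definition post_err r z k := crd z k + post_num r z k / post_den r z.

Lemma measurable_post_err r k : measurable_fun setT (fun z => post_err r z k).
Proof.
apply: measurable_funD; first exact: measurable_crd.
apply: measurable_funM; first exact: measurable_post_num.
under eq_fun do rewrite -powR_inv1 ?post_den_ge0//.
exact: (measurableT_comp (measurable_powR _) (@measurable_post_den r)).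
Qed.

(** Write the error as z + a/r + u with u = L z / r^2 + O(r^(-3)). In the product of two entries the
    order 1 part has mean delta_kl, the order 1/r part is odd in [z], and the order r^(-2) part has
    mean 2 L_kl + a_k a_l = 2 H_kl - a_k a_l. *)
Theorem post_err_expansion : exists2 C, 0 < C & forall r k l, 1 <= r ->
  gint (fun z => post_err r z k * post_err r z l) /\
  `|r ^+ 2 * (gmean (fun z => post_err r z k * post_err r z l) - (k == l)%:R) -
    (2 * H k l - a k * a l)| <= C / r.
Proof.
(* Errors grow like w^3 and a product of two like w^6; the rate 6/16 is still below 1/2. *)
pose e : R := 16^-1.
have e0 : 0 < e by rewrite invr_gt0.
have e4 : e < 4^-1 by rewrite /e; lra.
have [C1 C10 H1] := post_ratio_expansion e0 e4.
pose w z := expR (e * frob2 z).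
have w1 z : 1 <= w z by rewrite -expR0 ler_expR mulr_ge0 ?frob2_ge0// ltW.
have w0 z : 0 < w z by exact: lt_le_trans (w1 z).
have H1' r z k : 1 <= r ->
    `|post_num r z k / post_den r z - (a k / r + hmul L z k / r ^+ 2)| <= C1 * r ^- 3 * w z ^+ 3.
  by move=> r1; rewrite /w -expRM_natl mulrA; exact: H1.
have sum_bound (F : I -> V -> R) : (forall k, growth (F k)) ->
    exists2 C, 0 < C & forall z k, `|F k z| <= C * w z.
  move=> gF; have /choice[G HG] : forall k : I, exists C, 0 < C /\ forall z, `|F k z| <= C * w z.
    by move=> k; have [_ /(_ e e0)[C ? ?]] := gF k; exists C.
  exists (\sum_(k : I) G k + 1) => [|z k].
    by rewrite ltr_wpDl// sumr_ge0// => k _; have [/ltW] := HG k.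
  have [G0 HGk] := HG k; apply: (le_trans (HGk z)); apply: ler_wpM2r; first exact: ltW.
  rewrite (bigD1 k)//= -addrA lerDl addr_ge0// sumr_ge0// => l _.
  by have [/ltW] := HG l.
have [CL CL0 HL] := sum_bound (fun k z => hmul L z k) (fun k => growth_hmul L k).
have [Cz Cz0 Hz] := sum_bound (fun k z => crd z k) (@growth_crd R n p).
have [Ca Ca0 Ha] := sum_bound (fun k _ => a k) (fun k => @growth_cst R n p (a k)).
pose C2 := CL + C1.
have C20 : 0 < C2 by exact: addr_gt0.
have gi6 : gint (fun z => w z ^+ 6).
  apply: (@eq_gint _ _ _ (fun z => expR (6 * e * frob2 z))).
    by move=> z; rewrite /w -expRM_natl mulrA.
  by apply: gint_expR_frob2; rewrite /e; lra.
pose E6 := gmean (fun z => w z ^+ 6).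
have E60 : 0 <= E6.
  rewrite -[leLHS](gmean_cst n p); apply: gmean_le => //; first exact: gint_cst.
  by move=> z; rewrite exprn_ge0// ltW.
pose C3 := 2 * C1 * Cz + 2 * Ca * C2 + C2 ^+ 2.
have C30 : 0 < C3 by rewrite /C3 !addr_gt0 ?mulr_gt0 ?exprn_gt0.
exists (C3 * (E6 + 1)) => [|r k l r1]; first by rewrite mulr_gt0// ltr_wpDl.
have r0 : 0 < r by exact: lt_le_trans r1.
have rn0 : r != 0 by rewrite gt_eqF.
pose q z j := post_num r z j / post_den r z - (a j / r + hmul L z j / r ^+ 2).
pose u z j := hmul L z j / r ^+ 2 + q z j.
pose rest z := r ^+ 2 * (q z k * crd z l + crd z k * q z l) +
  r * (a k * u z l + u z k * a l) + r ^+ 2 * (u z k * u z l).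
pose main z := hmul L z k * crd z l + crd z k * hmul L z l + a k * a l.
pose lin z := r * (a k * crd z l + crd z k * a l).
have WE z : post_err r z k * post_err r z l =
    r ^- 2 * (r ^+ 2 * (crd z k * crd z l) + (lin z + (main z + rest z))).
  have qE j : post_err r z j = crd z j + a j / r + u z j.
    by rewrite /post_err /u /q; ring.
  rewrite !qE /lin /main /rest.
  have uE j : u z j = hmul L z j / r ^+ 2 + q z j by [].
  have -> : q z k = u z k - hmul L z k / r ^+ 2 by rewrite uE; ring.
  have -> : q z l = u z l - hmul L z l / r ^+ 2 by rewrite uE; ring.
  by move: (u z k) (u z l) => uk ul; field.
have mq j : measurable_fun setT (q ^~ j).
  have me := @measurable_post_err r j; have [mh _] := growth_hmul L j.
  have -> : q ^~ j = fun z => post_err r z j - crd z j - (a j / r + hmul L z j / r ^+ 2).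
    by apply/funext => z; rewrite /q /post_err; ring.
  apply: measurable_funB; first by apply: measurable_funB => //; exact: measurable_crd.
  by apply: measurable_funD => //; exact: measurable_funM.
have mu j : measurable_fun setT (u ^~ j).
  by have [mh _] := growth_hmul L j; apply: measurable_funD => //; exact: measurable_funM.
have mrest : measurable_fun setT rest.
  have mc := @measurable_crd R n p.
  apply: measurable_funD; last by apply: measurable_funM => //; exact: measurable_funM.
  apply: measurable_funD; apply: measurable_funM => //; apply: measurable_funD; exact: measurable_funM.
have rest_le z : `|rest z| <= C3 / r * w z ^+ 6.
  have ir0 : 0 < r^-1 by rewrite invr_gt0.
  have ir1 : r^-1 <= 1 by rewrite invf_le1.
  have hq j : `|q z j| <= C1 * r ^- 3 * w z ^+ 3 by exact: H1'.
  have w13 : w z <= w z ^+ 3 by rewrite -[leLHS]expr1; apply: ler_weXn2l.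
  have hu j : `|u z j| <= C2 * r ^- 2 * w z ^+ 3.
    apply: (le_trans (ler_normD _ _)); rewrite /C2 2!mulrDl; apply: lerD.
      rewrite normrM [`|_^-1|]gtr0_norm ?invr_gt0 ?exprn_gt0// mulrAC.
      apply: ler_wpM2r; first by rewrite invr_ge0 exprn_ge0// ltW.
      by apply: (le_trans (HL z j)); apply: ler_wpM2l => //; exact: ltW.
    apply: (le_trans (hq j)); apply: ler_wpM2r; first by rewrite exprn_ge0// ltW.
    apply: ler_wpM2l; first exact: ltW.
    by rewrite lef_pV2 ?posrE ?exprn_gt0// ler_weXn2l.
  have ha j : `|a j| <= Ca * w z := Ha z j.
  have hz j : `|crd z j| <= Cz * w z := Hz z j.
  have w46 : w z ^+ 4 <= w z ^+ 6 by rewrite ler_weXn2l.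
  have [cz0 qz0] : 0 <= Cz * w z /\ 0 <= C1 * r ^- 3 * w z ^+ 3.
    by split; rewrite !mulr_ge0 ?invr_ge0 ?exprn_ge0 ?(ltW r0)// ltW.
  have prod_le (x y X Y : R) : `|x| <= X -> `|y| <= Y -> `|x * y| <= X * Y.
    by move=> xX yY; rewrite normrM ler_pM.
  apply: (@le_trans _ _ (r ^+ 2 * (C1 * r ^- 3 * w z ^+ 3 * (Cz * w z) + Cz * w z * (C1 * r ^- 3 * w z ^+ 3)) +
     r * (Ca * w z * (C2 * r ^- 2 * w z ^+ 3) + C2 * r ^- 2 * w z ^+ 3 * (Ca * w z)) +
     r ^+ 2 * (C2 * r ^- 2 * w z ^+ 3 * (C2 * r ^- 2 * w z ^+ 3)))).
    apply: (le_trans (ler_normD _ _)); apply: lerD.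
      apply: (le_trans (ler_normD _ _)); apply: lerD.
        rewrite normrM ger0_norm ?exprn_ge0 ?(ltW r0)//.
        apply: ler_wpM2l; first by rewrite exprn_ge0// ltW.
        by apply: (le_trans (ler_normD _ _)); apply: lerD; exact: prod_le.
      rewrite normrM ger0_norm ?(ltW r0)//; apply: ler_wpM2l; first exact: ltW.
      by apply: (le_trans (ler_normD _ _)); apply: lerD; exact: prod_le.
    rewrite normrM ger0_norm ?exprn_ge0 ?(ltW r0)//.
    by apply: ler_wpM2l; [rewrite exprn_ge0// ltW|exact: prod_le].
  have sumE (c1 cz ca c2 x : R) : r ^+ 2 * (c1 * r ^- 3 * x ^+ 3 * (cz * x) + cz * x * (c1 * r ^- 3 * x ^+ 3)) +
     r * (ca * x * (c2 * r ^- 2 * x ^+ 3) + c2 * r ^- 2 * x ^+ 3 * (ca * x)) +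
     r ^+ 2 * (c2 * r ^- 2 * x ^+ 3 * (c2 * r ^- 2 * x ^+ 3)) =
     (2 * c1 * cz + 2 * ca * c2) / r * x ^+ 4 + c2 ^+ 2 / r ^+ 2 * x ^+ 6 by field.
  rewrite sumE.
  have -> : C3 / r * w z ^+ 6 = (2 * C1 * Cz + 2 * Ca * C2) / r * w z ^+ 6 + C2 ^+ 2 / r * w z ^+ 6.
    by rewrite /C3 -mulrDl -mulrDl.
  apply: lerD.
    apply: ler_wpM2l => //.
    by rewrite mulr_ge0 ?(ltW ir0)// addr_ge0 ?mulr_ge0// ltW.
  apply: ler_wpM2r; first by rewrite exprn_ge0// ltW.
  by apply: ler_wpM2l; [rewrite exprn_ge0// ltW|rewrite expr2 invfM ler_piMl// ltW].
have gi_rest : gint rest by apply: gint_le mrest rest_le _; exact: gintZ.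
have gi_main : gint main.
  apply: growth_gint; apply: growthD; last exact: growth_cst.
  by apply: growthD; apply: growthM; (exact: growth_hmul || exact: growth_crd).
have gi_lin : gint lin.
  apply: growth_gint; apply: growthM; first exact: growth_cst.
  by apply: growthD; apply: growthM; (exact: growth_cst || exact: growth_crd).
have gi_zz : gint (fun z => crd z k * crd z l).
  by apply: growth_gint; apply: growthM; exact: growth_crd.
have -> : (fun z => post_err r z k * post_err r z l) =
    (fun z => r ^- 2 * (r ^+ 2 * (crd z k * crd z l) + (lin z + (main z + rest z)))).
  by apply/funext => z; exact: WE.
have gi1 : gint (fun z => lin z + (main z + rest z)) by apply: gintD => //; exact: gintD.
have gi2 : gint (fun z => r ^+ 2 * (crd z k * crd z l) + (lin z + (main z + rest z))).
  by apply: gintD => //; exact: gintZ.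
split; first exact: gintZ.
rewrite gmeanZ// gmeanD//; last exact: gintZ.
rewrite gmeanZ// gmeanD//; last exact: gintD.
rewrite gmeanD// (gmean_odd gi_lin); last first.
  by move=> z; rewrite /lin /crd !mxE; ring.
have -> : gmean (fun z => crd z k * crd z l) = (k == l)%:R.
  have [<-|kl] := eqVneq k l; last exact: gmean_cross.
  by rewrite -[RHS](@gmean_sqr R n p k).
have sL i j : L i j = L j i by rewrite /L H_sym mulrC.
have -> : gmean main = 2 * L k l + a k * a l.
  have g1 : gint (fun z => crd z l * dot (L k) z).
    by apply: growth_gint; apply: growthM; [exact: growth_crd|exact: growth_dot].
  have g2 : gint (fun z => crd z k * dot (L l) z).
    by apply: growth_gint; apply: growthM; [exact: growth_crd|exact: growth_dot].
  have -> : main = fun z => (crd z l * dot (L k) z + crd z k * dot (L l) z) + a k * a l.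
    by apply/funext => z; rewrite /main mulrC.
  rewrite gmeanD; [|exact: gintD|exact: gint_cst].
  rewrite gmeanD// !gmean_crd_dot gmean_cst (sL l k); ring.
have cancel (D G Hkl ak al : R) : r ^+ 2 * (r ^- 2 *
    (r ^+ 2 * D + (0 + (2 * (Hkl - ak * al) + ak * al + G))) - D) - (2 * Hkl - ak * al) = G.
  by field.
rewrite cancel.
apply: (le_trans (gmean_norm_le mrest rest_le (gintZ _ gi6))).
rewrite gmeanZ// -/E6 mulrAC; apply: ler_wpM2r; first by rewrite invr_ge0 ltW.
by apply: ler_wpM2l; [exact: ltW|rewrite lerDl].
Qed.

End posterior_expansion.

(** * Expansion of the risk *)

Section lebmx_affine_integrable.
Variables (R : realType) (n p : nat).
Local Notation V := 'M[R]_(n, p).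
Local Notation lam := (lebmx R n p).

Lemma integrable_lebmx_affine (c : R) (u : V) (f : V -> \bar R) : c != 0 ->
  lam.-integrable setT f -> lam.-integrable setT (fun v => f (c *: v + u)).
Proof.
move=> c0 fi; have mf := measurable_int _ fi; apply/integrableP; split.
  exact: (measurableT_comp mf (measurable_mx_affine c u)).
have := @ge0_integral_lebmx_affine R n p c u (abse \o f) c0
  (measurableT_comp (@abse_measurable R setT) mf) (fun x => abse_ge0 _).
move=> ->; have /integrableP[_ foo] := fi.
by rewrite lte_mul_pinfty// lee_fin invr_ge0 exprn_ge0.
Qed.

Lemma integral_lebmx_affine (c : R) (u : V) (f : V -> \bar R) : c != 0 ->
  lam.-integrable setT f ->
  (\int[lam]_v f (c *: v + u)%R = (`|c| ^- (n * p))%:E * \int[lam]_v f v)%E.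
Proof.
move=> c0 fi; have mf := measurable_int _ fi.
have fp := integrable_pos_fin_num measurableT fi; have fn := integrable_neg_fin_num measurableT fi.
rewrite [in RHS]integralE muleBr//; last by rewrite fin_num_adde_defl// fin_numN.
rewrite -(@ge0_integral_lebmx_affine R n p c u _ c0 (measurable_funepos mf))//.
rewrite -(@ge0_integral_lebmx_affine R n p c u _ c0 (measurable_funeneg mf))//.
rewrite integralE; congr (_ - _)%E; apply: eq_integral => v _.
  by rewrite !funeposE.
by rewrite !funenegE.
Qed.

Lemma integral_gauss_density (r : R) (u : V) (F : V -> R) : 0 < r ->
  gint (fun v => F (r^-1 *: v + u)) ->
  lam.-integrable setT (fun M => (gauss_density (r ^+ 2) M u * F M)%:E) /\
  (\int[lam]_M (gauss_density (r ^+ 2) M u * F M)%:E =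
   (gmean (fun v => F (r^-1 *: v + u)))%:E)%E.
Proof.
move=> r0 gi; have rn0 : r != 0 by rewrite gt_eqF.
pose G (v : V) : \bar R := (F (r^-1 *: v + u) * gw v)%:E.
have E M : (gauss_density (r ^+ 2) M u * F M)%:E =
    ((r ^+ (n * p))%:E * G (r *: M + (- (r *: u)))%R)%E.
  rewrite /G -EFinM -scalerBr scalerA mulVf// scale1r subrK; congr EFin.
  rewrite [LHS]mulrC [RHS]mulrCA; congr (_ * _).
  rewrite /gauss_density /gw frob2Z mulrA -mulNr mulNr; congr (_ * _).
  rewrite powRM ?sqr_ge0 ?invr_ge0 ?mulr_ge0 ?pi_ge0//; congr (_ * _).
  rewrite -(powR_mulrn 2) ?ltW// -powRrM -powR_mulrn ?ltW//; congr powR.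
  by field.
have gi' := integrable_lebmx_affine (- (r *: u)) rn0 gi.
have E' : (fun M => (gauss_density (r ^+ 2) M u * F M)%:E) =
    (fun M => (r ^+ (n * p))%:E * G (r *: M + (- (r *: u)))%R)%E by apply/funext.
split; first by rewrite E'; exact: integrableZl.
rewrite E' integralZl// (integral_lebmx_affine _ rn0 gi) muleA -EFinM gtr0_norm//.
by rewrite mulfV ?expf_neq0// mul1e -gmeanE.
Qed.

Lemma gauss_densityC (N : R) (Y M : V) : gauss_density N Y M = gauss_density N M Y.
Proof. by rewrite /gauss_density -(frob2N (Y - M)) opprB. Qed.

End lebmx_affine_integrable.

Section risk.
Variables (R : realType) (n p : nat).
Local Notation V := 'M[R]_(n, p).
Local Notation I := ('I_n * 'I_p)%type.
Local Notation lam := (lebmx R n p).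

Variables (pr : V -> R) (M0 : V) (a : I -> R) (H : I -> I -> R) (C0 delta : R).
Hypothesis pr_ge0 : forall x, 0 <= pr x.
Hypothesis pr_M0 : 0 < pr M0.
Hypothesis mpr : measurable_fun setT pr.
Hypothesis pr_int : forall e, 0 < e ->
  (\int[lam]_x (expR (- (e * frob2 x)) * pr x)%:E < +oo)%E.
Hypothesis pr_lb : forall e, 0 < e -> exists2 c, 0 < c &
  {ae lam, forall x, c * expR (- (e * frob2 x)) <= pr x}.
Hypothesis H_sym : forall k l, H k l = H l k.
Hypothesis delta_gt0 : 0 < delta.
Let rho x := pr (M0 + x) / pr M0.
Hypothesis pr_taylor : forall x, nrm x <= delta ->
  `|rho x - (1 + dot a x + quad H x / 2)| <= C0 * nrm x ^+ 3.

Let rho_ge0 x : 0 <= rho x.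
Proof. by rewrite divr_ge0// ltW. Qed.

Let mshift : measurable_fun setT (fun x : V => M0 + x).
Proof.
have := measurable_mx_affine 1 M0; congr measurable_fun.
by apply/funext => v; rewrite scale1r addrC.
Qed.

Let mrho : measurable_fun setT rho.
Proof. by apply: measurable_funM => //; exact: (measurableT_comp mpr mshift). Qed.

Let rho_int (e : R) : 0 < e ->
  (\int[lam]_x (expR (- (e * frob2 x)) * rho x)%:E < +oo)%E.
Proof.
move=> e0; have e20 : 0 < e / 2 by rewrite divr_gt0.
pose f x := expR (- (e / 2 * frob2 x)) * pr x.
have f0 x : 0 <= f x by rewrite mulr_ge0 ?expR_ge0.
have mf : measurable_fun setT f.
  by apply: measurable_funM => //; under eq_fun do rewrite -mulNr; exact: measurable_expR_frob2.
have := pr_int e20; rewrite -/f => ffin.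
pose K := expR (e * frob2 M0) / pr M0.
have K0 : 0 <= K by rewrite divr_ge0 ?expR_ge0// ltW.
apply: (@le_lt_trans _ _ (\int[lam]_x (K%:E * (f (M0 + x))%:E))%E).
  apply: ge0_le_integral => //.
  - by move=> x _; rewrite lee_fin mulr_ge0 ?expR_ge0.
  - apply/measurable_EFinP; apply: measurable_funM => //.
    by under eq_fun do rewrite -mulNr; exact: measurable_expR_frob2.
  - by apply: emeasurable_funM => //; apply/measurable_EFinP; exact: (measurableT_comp mf mshift).
  - move=> x _; rewrite -EFinM lee_fin /f /rho /K.
    rewrite (_ : _ / _ * _ = expR (e * frob2 M0) * expR (- (e / 2 * frob2 (M0 + x))) * (pr (M0 + x) / pr M0)); last by ring.
    apply: ler_wpM2r; first exact: rho_ge0.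
    rewrite -expRD ler_expR.
    have := frob2_triangle (M0 + x) M0; rewrite [X in _ <= frob2 X]addrC addKr; nra.
rewrite ge0_integralZl//; last 2 first.
- by apply/measurable_EFinP; exact: (measurableT_comp mf mshift).
- by move=> x _; rewrite lee_fin.
have -> : (\int[lam]_x (f (M0 + x))%:E = \int[lam]_x (f x)%:E)%E.
  have := @ge0_integral_lebmx_affine R n p 1 M0 (fun x => (f x)%:E) (oner_neq0 R).
  rewrite normr1 expr1n invr1 mul1e => <-.
  - by apply: eq_integral => x _; rewrite scale1r addrC.
  - exact/measurable_EFinP.
  - by move=> x; rewrite lee_fin.
by rewrite lte_mul_pinfty.
Qed.

Let rho_lb (e : R) : 0 < e -> exists2 c, 0 < c &
  {ae lam, forall x, c * expR (- (e * frob2 x)) <= rho x}.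
Proof.
move=> e0; have e20 : 0 < e / 2 by rewrite divr_gt0.
have [c c0 ae_c] := pr_lb e20.
exists (c * expR (- (e * frob2 M0)) / pr M0).
  by rewrite divr_gt0// mulr_gt0// expR_gt0.
have := ae_lebmx_affine M0 (oner_neq0 R) ae_c; apply: filterS => x.
rewrite scale1r addrC => Hx; rewrite mulrAC; apply: ler_wpM2r.
  by rewrite invr_ge0 ltW.
apply: le_trans Hx; rewrite -mulrA -expRD; apply: ler_wpM2l; first exact: ltW.
by rewrite ler_expR; have := frob2D_le M0 x; nra.
Qed.

Let perr := post_err rho.
Let B r z := post_den rho r z.

Let B_gt0 r z : 1 <= r -> 0 < B r z.
Proof.
move=> r1; have [c c0 Hc] := post_den_lb rho_ge0 mrho rho_int rho_lb H_sym delta_gt0 pr_taylor (ltr01 : 0 < (1 : R)).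
by apply: lt_le_trans (Hc r z r1); rewrite mulr_gt0// expR_gt0.
Qed.

(** Substituting M = Y + v/r turns both posterior integrals into Gaussian means over [v], and the
    factor [pr M0] cancels in the quotient. *)
Lemma gen_bayes_post_err r z k : 1 <= r ->
  gen_bayes pr (r ^+ 2) (M0 + r^-1 *: z) k.1 k.2 = crd M0 k + perr r z k / r.
Proof.
move=> r1; have r0 : 0 < r by exact: lt_le_trans r1.
have rn0 : r != 0 by rewrite gt_eqF.
set Y := M0 + r^-1 *: z.
have rhoE v : pr (r^-1 *: v + Y) = pr M0 * rho (r^-1 *: (z + v)).
  rewrite /rho mulrC divfK ?gt_eqF// /Y scalerDr; congr pr.
  by rewrite addrC addrA.
have gi_den := gint_post_den rho_ge0 mrho rho_int H_sym delta_gt0 pr_taylor z r1.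
have gi_num := gint_post_num rho_ge0 mrho rho_int H_sym delta_gt0 pr_taylor z k r1.
have gd : gint (fun v => pr (r^-1 *: v + Y)).
  by apply: eq_gint (gintZ (pr M0) gi_den) => v; rewrite rhoE.
have gn : gint (fun v => crd (r^-1 *: v + Y) k * pr (r^-1 *: v + Y)).
  apply: eq_gint (gintD (gintZ (pr M0 * crd Y k) gi_den) (gintZ (pr M0 / r) gi_num)) => v.
  by rewrite rhoE /crd !mxE; ring.
have [d1 d2] := integral_gauss_density r0 gd.
have [n1 n2] := integral_gauss_density (F := fun M => crd M k * pr M) r0 gn.
rewrite /gen_bayes mxE.
have -> : (fun M : V => M k.1 k.2 * gauss_density (r ^+ 2) Y M * pr M) =
    (fun M => gauss_density (r ^+ 2) M Y * (crd M k * pr M)).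
  by apply/funext => M; rewrite gauss_densityC mulrAC mulrC mulrA.
have -> : (fun M : V => gauss_density (r ^+ 2) Y M * pr M) =
    (fun M => gauss_density (r ^+ 2) M Y * pr M).
  by apply/funext => M; rewrite gauss_densityC.
rewrite (mxintE d1) (mxintE n1) d2 n2 /=.
have -> : gmean (fun v => pr (r^-1 *: v + Y)) = pr M0 * B r z.
  by rewrite /B /post_den -gmeanZ//; congr gmean; apply/funext => v; rewrite rhoE.
have -> : gmean (fun v => crd (r^-1 *: v + Y) k * pr (r^-1 *: v + Y)) =
    pr M0 * crd Y k * B r z + pr M0 / r * post_num rho r z k.
  rewrite /B /post_den /post_num -!gmeanZ// -gmeanD; [|exact: gintZ|exact: gintZ].
  by congr gmean; apply/funext => v; rewrite rhoE /crd !mxE; ring.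
have Bn0 : B r z != 0 by rewrite gt_eqF// B_gt0.
have pn0 : pr M0 != 0 by rewrite gt_eqF.
have -> : crd Y k = crd M0 k + r^-1 * crd z k by rewrite /crd /Y !mxE.
rewrite /perr /post_err -/(B r z); field.
by rewrite rn0 Bn0 pn0.
Qed.

(** Entry (i, j) of the loss sums products of errors over rows. The term r^2 n delta_ij is the
    contribution of [z] alone, the same for every prior, and drops out of risk differences. *)
Lemma risk_expansion : exists2 C, 0 < C & forall r i j, 1 <= r ->
  `|r ^+ 2 ^+ 2 * risk_mx (gen_bayes pr (r ^+ 2)) (r ^+ 2) M0 i j -
    r ^+ 2 * n%:R * (i == j)%:R -
    \sum_(b < n) (2 * H (b, i) (b, j) - a (b, i) * a (b, j))| <= C / r.
Proof.
have [C C_gt0 HC] := post_err_expansion rho_ge0 mrho rho_int rho_lb H_sym delta_gt0 pr_taylor.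
exists (n%:R * C + 1) => [|r i j r1]; first by rewrite ltr_wpDl// mulr_ge0// ltW.
have r0 : 0 < r by exact: lt_le_trans r1.
have rn0 : r != 0 by rewrite gt_eqF.
pose F (Y : V) : R := (((gen_bayes pr (r ^+ 2) Y - M0)^T *m (gen_bayes pr (r ^+ 2) Y - M0)) i j).
have FE z : F (r^-1 *: z + M0) = \sum_(b < n) r ^- 2 * (perr r z (b, i) * perr r z (b, j)).
  rewrite /F (addrC (r^-1 *: z)).
  have h k := gen_bayes_post_err z k r1; move: (gen_bayes _ _ _) h => G h.
  rewrite mxE; apply: eq_bigr => b _; rewrite !mxE.
  have /= -> := h (b, i); have /= -> := h (b, j); rewrite /crd /=.
  by field.
have gi b : gint (fun z => perr r z (b, i) * perr r z (b, j)) := (HC r (b, i) (b, j) r1).1.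
have gF : gint (fun z => F (r^-1 *: z + M0)).
  apply: (@eq_gint _ _ _ (fun z => \sum_(b < n) r ^- 2 * (perr r z (b, i) * perr r z (b, j)))).
    by move=> z; rewrite FE.
  by apply: gint_sum => b; exact: gintZ.
have [i1 i2] := integral_gauss_density r0 gF.
rewrite /risk_mx mxE (mxintE i1) i2 /=.
have -> : gmean (fun z => F (r^-1 *: z + M0)) =
    \sum_(b < n) r ^- 2 * gmean (fun z => perr r z (b, i) * perr r z (b, j)).
  transitivity (gmean (fun z => \sum_(b < n) r ^- 2 * (perr r z (b, i) * perr r z (b, j)))).
    by congr gmean; apply/funext => z; exact: FE.
  rewrite gmean_sum; last by move=> b; exact: gintZ.
  by apply: eq_bigr => b _; rewrite gmeanZ.
have -> : r ^+ 2 * n%:R * (i == j)%:R = \sum_(b < n) r ^+ 2 * (i == j)%:R.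
  by rewrite sumr_const card_ord -[RHS]mulr_natr mulrAC.
rewrite mulr_sumr -!sumrB (le_trans (ler_norm_sum _ _ _))//.
apply: (@le_trans _ _ (\sum_(b < n) C / r)); last first.
  rewrite sumr_const card_ord -[leLHS]mulr_natl [leLHS]mulrA; apply: ler_wpM2r; first by rewrite invr_ge0 ltW.
  by rewrite lerDl.
apply: ler_sum => b _; have [_] := HC r (b, i) (b, j) r1.
rewrite xpair_eqE eqxx andTb => H1; apply: le_trans H1.
rewrite le_eqVlt; apply/orP; left; apply/eqP; congr (`|_ - _|).
by rewrite mulrBr; congr (_ - _); field.
Qed.

End risk.

(** * Second-order jets *)

Section powR_taylor.
Variable R : realType.

(** By the mean value theorem, each use gains one order of vanishing at 0. *)
Lemma derivative_bound (F F' : R -> R) (d K : R) m : F 0 = 0 ->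
  (forall t : R, `|t| <= d -> is_derive t 1 F (F' t)) ->
  (forall t : R, `|t| <= d -> `|F' t| <= K * `|t| ^+ m) -> 0 <= K ->
  forall t : R, `|t| <= d -> `|F t| <= K * `|t| ^+ m.+1.
Proof.
move=> F0 dF bF K0 t td.
have seg s : `|s| <= `|t| -> `|s| <= d by move=> st; exact: le_trans td.
have [b ba] : exists2 b, `|b| <= `|t| & F t = F' b * t.
  have [t0|t0] := leP 0 t.
    have tt : `|t| = t by rewrite ger0_norm.
    have [||b] := @MVT_segment R F F' 0 t t0.
    - move=> s; rewrite in_itv/= => /andP[/ltW s0 /ltW st].
      by apply: dF; apply: seg; rewrite tt ger0_norm.
    - apply: continuous_in_subspaceT => s; rewrite inE/= in_itv/= => /andP[s0 st].
      apply: differentiable_continuous; apply/derivable1_diffP.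
      by have [|] := dF s; first by apply: seg; rewrite tt ger0_norm.
    rewrite in_itv/= => /andP[b0 bt]; rewrite F0 !subr0 => ->.
    by exists b => //; rewrite tt ger0_norm.
  have tt : `|t| = - t by rewrite ltr0_norm.
  have [||b] := @MVT_segment R F F' t 0 (ltW t0).
  - move=> s; rewrite in_itv/= => /andP[/ltW s0 /ltW st].
    by apply: dF; apply: seg; rewrite tt ler0_norm// lerN2.
  - apply: continuous_in_subspaceT => s; rewrite inE/= in_itv/= => /andP[s0 st].
    apply: differentiable_continuous; apply/derivable1_diffP.
    by have [|] := dF s; first by apply: seg; rewrite tt ler0_norm// lerN2.
  rewrite in_itv/= => /andP[b0 bt]; rewrite F0 !sub0r => E.
  exists b; first by rewrite tt ler0_norm// lerN2.
  by rewrite -[LHS]opprK E mulrN opprK.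
move=> ->; rewrite normrM exprSr mulrA; apply: ler_wpM2r => //.
apply: (@le_trans _ _ (K * `|b| ^+ m)); first by apply: bF; exact: seg.
apply: ler_wpM2l => //.
by rewrite lerXn2r ?nnegrE.
Qed.

(** The power is monotone in its base, so one of the two endpoint values is a bound; their sum
    serves for either sign of [b]. *)
Lemma powR_bound (c b : R) : 0 < c -> exists2 K, 0 <= K &
  forall t, `|t| <= c / 2 -> (c + t) `^ b <= K.
Proof.
move=> c0; exists ((c / 2) `^ b + (c * 2) `^ b); first by rewrite addr_ge0 ?powR_ge0.
move=> t; rewrite ler_norml => /andP[t1 t2].
have c20 : 0 < c / 2 by rewrite divr_gt0.
have h1 : c / 2 <= c + t by lra.
have h2 : c + t <= c * 2 by lra.
have h0 : 0 < c + t by exact: lt_le_trans h1.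
have [b0|b0] := leP 0 b.
  apply: (@le_trans _ _ ((c * 2) `^ b)); last by rewrite lerDr powR_ge0.
  by apply: ge0_ler_powR => //; rewrite nnegrE ltW// mulr_gt0.
apply: (@le_trans _ _ ((c / 2) `^ b)); last by rewrite lerDl powR_ge0.
rewrite -[b]opprK [leLHS]powRN [leRHS]powRN lef_pV2 ?posrE ?powR_gt0//.
by apply: ge0_ler_powR; rewrite ?nnegrE ?oppr_ge0// ltW.
Qed.

Lemma is_derive_powR_shift (c b t : R) : 0 < c + t ->
  is_derive t 1 (fun s => (c + s) `^ b) (b * (c + t) `^ (b - 1)).
Proof.
move=> ct; have H := is_derive1_powR b ct.
have S : is_derive t 1 (cst c + id : R -> R) (0 + 1).
  exact: is_deriveD.
have := @is_derive1_comp R (fun x => x `^ b) (cst c + id : R -> R) t _ _ H S.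
by rewrite add0r mulr1.
Qed.

(** The derivative of a Taylor remainder for exponent [b] is [b] times the remainder, one order
    lower, for [b - 1]. Three uses of [derivative_bound] climb from a bounded derivative to order
    three; |t| <= c/2 keeps the base away from 0. *)
Lemma powR_taylor (c b : R) : 0 < c -> exists2 K, 0 <= K &
  forall t, `|t| <= c / 2 ->
  `|(c + t) `^ b - (c `^ b + b * c `^ (b - 1) * t + b * (b - 1) * c `^ (b - 2) * t ^+ 2 / 2)|
    <= K * `|t| ^+ 3.
Proof.
move=> c0.
have ct t : `|t| <= c / 2 -> 0 < c + t by rewrite ler_norml => /andP[t1 t2]; lra.
have [K0 K00 HK0] := powR_bound (b - 3) c0.
pose F2 t := (c + t) `^ (b - 2) - c `^ (b - 2).
pose F1 t := (c + t) `^ (b - 1) - (c `^ (b - 1) + (b - 1) * c `^ (b - 2) * t).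
pose F0 t := (c + t) `^ b - (c `^ b + b * c `^ (b - 1) * t + b * (b - 1) * c `^ (b - 2) * t ^+ 2 / 2).
have dlin (k0 k1 k2 t : R) : is_derive t 1 (fun s : R => k0 + k1 * s + k2 * s ^+ 2 / 2) (k1 + k2 * t).
  have -> : (fun s : R => k0 + k1 * s + k2 * s ^+ 2 / 2) =
      cst k0 + k1 *: (id : R -> R) + (k2 / 2) *: ((id : R -> R) * id).
    by apply/funext => s; rewrite !fctE /GRing.scale/=; field.
  have I := is_derive_id t (1 : R).
  apply: (is_derive_eq (is_deriveD (is_deriveD (is_derive_cst k0 t 1) (is_deriveZ k1 I))
    (is_deriveZ (k2 / 2) (is_deriveM I I)))).
  by rewrite /GRing.scale/=; field.
have b2 : forall t, `|t| <= c / 2 -> `|F2 t| <= `|b - 2| * K0 * `|t| ^+ 1.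
  apply: (@derivative_bound _ (fun s => (b - 2) * (c + s) `^ (b - 3))).
  - by rewrite /F2 addr0 subrr.
  - move=> s sc; have D := is_derive_powR_shift (b - 2) (ct s sc).
    have D2 := dlin (c `^ (b - 2)) (0 : R) (0 : R) s.
    have -> : F2 = (fun s => (c + s) `^ (b - 2)) - (fun s : R => c `^ (b - 2) + 0 * s + 0 * s ^+ 2 / 2).
      by apply/funext => u; rewrite /F2 !fctE !mul0r !addr0.
    apply: (is_derive_eq (is_deriveB D D2)); rewrite mul0r addr0 subr0; congr (_ * _ `^ _); ring.
  - move=> s sc; rewrite expr0 mulr1 normrM; apply: ler_wpM2l => //.
    by rewrite ger0_norm ?powR_ge0// HK0.
  - by rewrite mulr_ge0.
pose K1 := `|b - 1| * (`|b - 2| * K0).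
have K10 : 0 <= K1 by rewrite !mulr_ge0.
have b1 : forall t, `|t| <= c / 2 -> `|F1 t| <= K1 * `|t| ^+ 2.
  apply: (@derivative_bound _ (fun s => (b - 1) * F2 s)) => //.
  - by rewrite /F1 addr0 mulr0 addr0 subrr.
  - move=> s sc; have D := is_derive_powR_shift (b - 1) (ct s sc).
    have D2 := dlin (c `^ (b - 1)) ((b - 1) * c `^ (b - 2)) (0 : R) s.
    have -> : F1 = (fun s => (c + s) `^ (b - 1)) -
        (fun s : R => c `^ (b - 1) + (b - 1) * c `^ (b - 2) * s + 0 * s ^+ 2 / 2).
      by apply/funext => u; rewrite /F1 !fctE !mul0r !addr0.
    apply: (is_derive_eq (is_deriveB D D2)); rewrite /F2 mul0r addr0 mulrBr; congr (_ * _ `^ _ - _); ring.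
  - by move=> s sc; rewrite normrM /K1 -mulrA; apply: ler_wpM2l => //; exact: b2.
pose K2 := `|b| * K1.
exists K2; first by rewrite mulr_ge0.
move=> t tc; rewrite -/(F0 t).
apply: (@derivative_bound F0 (fun s => b * F1 s) (c / 2) K2 2) => //.
- by rewrite /F0 addr0 mulr0 expr0n/= mulr0 mul0r !addr0 subrr.
- move=> s sc; have D := is_derive_powR_shift b (ct s sc).
  have D2 := dlin (c `^ b) (b * c `^ (b - 1)) (b * (b - 1) * c `^ (b - 2)) s.
  have -> : F0 = (fun s => (c + s) `^ b) -
      (fun s : R => c `^ b + b * c `^ (b - 1) * s + b * (b - 1) * c `^ (b - 2) * s ^+ 2 / 2).
    by apply/funext => u; rewrite /F0 !fctE.
  by apply: (is_derive_eq (is_deriveB D D2)); rewrite /F1; ring.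
- by move=> s sc; rewrite normrM /K2 -mulrA; apply: ler_wpM2l => //; exact: b1.
- by rewrite mulr_ge0.
Qed.

End powR_taylor.

Section jets.
Variables (R : realType) (n p : nat).
Local Notation V := 'M[R]_(n, p).
Local Notation I := ('I_n * 'I_p)%type.
Implicit Types (f g : V -> R) (x : V) (a b : I -> R) (H G : I -> I -> R).

Definition bigO m f := exists C d, [/\ 0 <= C, 0 < d &
  forall x, nrm x <= d -> `|f x| <= C * nrm x ^+ m].

Lemma bigOD m f g : bigO m f -> bigO m g -> bigO m (fun x => f x + g x).
Proof.
move=> [C [d [C0 d0 HC]]] [D [e [D0 e0 HD]]].
exists (C + D), (Num.min d e); split; first exact: addr_ge0.
  by rewrite lt_min d0.
move=> x; rewrite le_min => /andP[xd xe].
by rewrite mulrDl (le_trans (ler_normD _ _))// lerD ?HC ?HD.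
Qed.

Lemma bigOM m k f g : bigO m f -> bigO k g -> bigO (m + k) (fun x => f x * g x).
Proof.
move=> [C [d [C0 d0 HC]]] [D [e [D0 e0 HD]]].
exists (C * D), (Num.min d e); split; first exact: mulr_ge0.
  by rewrite lt_min d0.
move=> x; rewrite le_min => /andP[xd xe].
by rewrite exprD mulrACA normrM ler_pM ?HC ?HD.
Qed.

Lemma bigO_le m k f : (k <= m)%N -> bigO m f -> bigO k f.
Proof.
move=> km [C [d [C0 d0 HC]]]; exists C, (Num.min d 1); split => //.
  by rewrite lt_min d0 ltr01.
move=> x; rewrite le_min => /andP[xd x1].
apply: (le_trans (HC x xd)); apply: ler_wpM2l => //.
by apply: ler_wiXn2l => //; exact: nrm_ge0.
Qed.

Lemma eq_bigO m f g : f =1 g -> bigO m f -> bigO m g.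
Proof. by move=> /funext ->. Qed.

Lemma bigO_cst (c : R) : bigO 0 (fun=> c).
Proof. by exists `|c|, 1; split=> // x _; rewrite expr0 mulr1. Qed.

Lemma bigOZ m (c : R) f : bigO m f -> bigO m (fun x => c * f x).
Proof. by move=> Of; have := bigOM (bigO_cst c) Of. Qed.

Lemma bigO_dot a : bigO 1 (dot a).
Proof.
have [C C0 HC] := norm_dot_le (n := n) (p := p) a.
by exists C, 1; split=> [||x _]; rewrite ?(ltW C0)// expr1.
Qed.

Lemma bigO_quad H : bigO 2 (quad H).
Proof.
have [C C0 HC] := norm_quad_le (n := n) (p := p) H.
by exists C, 1; split=> [||x _]; rewrite ?(ltW C0).
Qed.

(** An expansion with cubic remainder rather than derivatives: it is exactly what the posterior
    expansion consumes, and it is closed under sums, products and composition with a function of one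
    variable, which reaches powers of determinants. *)
Definition jet f (c : R) a H := (forall k l, H k l = H l k) /\
  bigO 3 (fun x => f x - (c + dot a x + quad H x / 2)).

Lemma quad_lin (s t : R) H G x :
  quad (fun k l => s * H k l + t * G k l) x = s * quad H x + t * quad G x.
Proof.
rewrite /quad !mulr_sumr -big_split/=; apply: eq_bigr => k _.
by rewrite !mulr_sumr -big_split/=; apply: eq_bigr => l _; ring.
Qed.

Lemma dot_lin (s t : R) a b x :
  dot (fun k => s * a k + t * b k) x = s * dot a x + t * dot b x.
Proof.
by rewrite /dot !mulr_sumr -big_split/=; apply: eq_bigr => k _; ring.
Qed.

Lemma quad_outer a b x : quad (fun k l => a k * b l) x = dot a x * dot b x.
Proof.
rewrite /quad /dot mulr_suml; apply: eq_bigr => k _.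
by rewrite mulr_sumr; apply: eq_bigr => l _; ring.
Qed.

Lemma quad_outer_sym a b x :
  quad (fun k l => a k * b l + b k * a l) x = 2 * dot a x * dot b x.
Proof.
have -> : (fun k l => a k * b l + b k * a l) =
    (fun k l => 1 * (a k * b l) + 1 * (b k * a l)) :> (I -> I -> R).
  by apply/funext => k; apply/funext => l; rewrite !mul1r.
by rewrite quad_lin !quad_outer; ring.
Qed.

Lemma nrm0 : nrm (0 : V) = 0.
Proof.
by rewrite /nrm frob2E big1 ?sqrtr0// => k _; rewrite /crd mxE expr0n.
Qed.

Lemma dot0 a : dot a (0 : V) = 0.
Proof. by rewrite /dot big1// => k _; rewrite /crd mxE mulr0. Qed.

Lemma quad0 H : quad H (0 : V) = 0.
Proof. by rewrite /quad big1// => k _; rewrite big1// => l _; rewrite /crd !mxE !mulr0. Qed.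

Lemma jet_at0 f c a H : jet f c a H -> f 0 = c.
Proof.
move=> [_ [C [d [C0 d0 HC]]]]; have := HC 0; rewrite nrm0 expr0n mulr0 ltW//.
by rewrite dot0 quad0 mul0r !addr0 normr_le0 subr_eq0 => /(_ isT)/eqP.
Qed.

Lemma jet_cst (c : R) : jet (fun=> c) c (fun=> 0) (fun _ _ => 0).
Proof.
split=> //; exists 0, 1; split=> // x _.
rewrite /dot /quad big1 => [|k _]; last by rewrite mul0r.
rewrite big1 => [|k _]; last by rewrite big1// => l _; rewrite !mul0r.
by rewrite mul0r !addr0 subrr normr0 mul0r.
Qed.

Lemma jet_crd (k : I) : jet (fun x => crd x k) 0 (fun l => (l == k)%:R) (fun _ _ => 0).
Proof.
split=> //; exists 0, 1; split=> // x _.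
rewrite /dot /quad (bigD1 k)//= eqxx mul1r big1 => [|l /negbTE->]; last by rewrite mul0r.
rewrite big1 => [|l _]; last by rewrite big1// => j _; rewrite !mul0r.
by rewrite mul0r !addr0 add0r subrr normr0 mul0r.
Qed.

(** The factors [1 *] (and [0 *] in later lemmas) keep coefficients in the literal shape handled by
    [dot_lin] and [quad_lin]. *)
Lemma jetD f g c e a b H G : jet f c a H -> jet g e b G ->
  jet (fun x => f x + g x) (c + e) (fun k => 1 * a k + 1 * b k)
    (fun k l => 1 * H k l + 1 * G k l).
Proof.
move=> [sH Of] [sG Og]; split=> [k l|]; first by rewrite sH sG.
apply: eq_bigO (bigOD Of Og) => x; rewrite dot_lin quad_lin; ring.
Qed.

Lemma jet_bigO1 f c a H : jet f c a H -> bigO 1 (fun x => f x - c).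
Proof.
move=> [_ Of].
have O2 : bigO 1 (fun x => 2^-1 * quad H x) by apply: bigOZ; exact: bigO_le (bigO_quad H).
apply: eq_bigO (bigOD (bigO_le (isT : (1 <= 3)%N) Of) (bigOD (bigO_dot a) O2)) => x.
ring.
Qed.

Lemma jet_bigO2 f c a H : jet f c a H -> bigO 2 (fun x => f x - (c + dot a x)).
Proof.
move=> [_ Of].
have O2 : bigO 2 (fun x => 2^-1 * quad H x) by apply: bigOZ; exact: bigO_quad.
apply: eq_bigO (bigOD (bigO_le (isT : (2 <= 3)%N) Of) O2) => x; ring.
Qed.

Lemma jetM f g c e a b H G : jet f c a H -> jet g e b G ->
  jet (fun x => f x * g x) (c * e) (fun k => c * b k + e * a k)
    (fun k l => 1 * (c * G k l + e * H k l) + 1 * (a k * b l + b k * a l)).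
Proof.
move=> jf jg; have [sH Of] := jf; have [sG Og] := jg; split=> [k l|].
  by rewrite sH sG (mulrC (a k)) (mulrC (b k)) [_ * a k + _]addrC.
(* Beyond the two remainders, the cubic error of the product is (f - c)(g - e - b.x) + (f - c -
   a.x)(b.x). *)
have O1 := bigOM (jet_bigO1 jf) (jet_bigO2 jg).
have O2 := bigOM (jet_bigO2 jf) (bigO_dot b).
apply: eq_bigO (bigOD (bigOZ e Of) (bigOD (bigOZ c Og) (bigOD O1 O2))) => x.
by rewrite dot_lin quad_lin quad_lin quad_outer_sym; field.
Qed.

Lemma jet_comp (h : R -> R) f (c : R) (h0 h1 h2 K d : R) a H : jet f c a H ->
  0 < d -> 0 <= K -> (forall t, `|t| <= d ->
    `|h (c + t) - (h0 + h1 * t + h2 * t ^+ 2 / 2)| <= K * `|t| ^+ 3) ->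
  jet (h \o f) h0 (fun k => h1 * a k + 0 * a k)
    (fun k l => h1 * H k l + h2 * (a k * a l)).
Proof.
move=> jf d0 K0 hT; have [sH Of] := jf; split=> [k l|]; first by rewrite sH (mulrC (a k)).
have [C [e [C0 e0 HC]]] := jet_bigO1 jf.
have O3 : bigO 3 (fun x => h (f x) - (h0 + h1 * (f x - c) + h2 * (f x - c) ^+ 2 / 2)).
  have dC : 0 < d / (C + 1) by rewrite divr_gt0// ltr_wpDl.
  exists (K * C ^+ 3), (Num.min e (d / (C + 1))); split.
  - by rewrite mulr_ge0 ?exprn_ge0.
  - by rewrite lt_min e0.
  - move=> x; rewrite le_min => /andP[xe xd].
    have hf := HC x xe; rewrite expr1 in hf.
    have hd : `|f x - c| <= d.
      apply: (le_trans hf); rewrite ler_pdivlMr ?ltr_wpDl// in xd.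
      by apply: le_trans xd; rewrite mulrC; apply: ler_wpM2l; [exact: nrm_ge0|rewrite lerDl].
    have := hT _ hd; rewrite [c + (f x - c)]addrC subrK => hh; apply: (le_trans hh).
    rewrite -mulrA -exprMn; apply: ler_wpM2l => //.
    by rewrite lerXn2r ?nnegrE// mulr_ge0// nrm_ge0.
(* This product is (f - c)^2 - (a.x)^2, the cost of replacing the increment by its linear part in
   the quadratic term. *)
have Oq : bigO 3 (fun x => (f x - (c + dot a x)) * (f x - c + dot a x)).
  apply: bigOM (jet_bigO2 jf) _; apply: bigOD (jet_bigO1 jf) _; exact: bigO_dot.
apply: eq_bigO (bigOD O3 (bigOD (bigOZ h1 Of) (bigOZ (h2 / 2) Oq))) => x.
by rewrite /= dot_lin quad_lin quad_outer; field.
Qed.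

Definition has_jet f := exists a H, jet f (f 0) a H.

Lemma has_jetP f c a H : jet f c a H -> has_jet f.
Proof. by move=> jf; exists a, H; rewrite (jet_at0 jf). Qed.

Lemma has_jet_cst (c : R) : has_jet (fun=> c).
Proof. exact: has_jetP (jet_cst c). Qed.

Lemma has_jet_crd (k : I) : has_jet (fun x => crd x k).
Proof. exact: has_jetP (jet_crd k). Qed.

Lemma has_jetD f g : has_jet f -> has_jet g -> has_jet (fun x => f x + g x).
Proof. by move=> [a [H jf]] [b [G jg]]; exact: has_jetP (jetD jf jg). Qed.

Lemma has_jetM f g : has_jet f -> has_jet g -> has_jet (fun x => f x * g x).
Proof. by move=> [a [H jf]] [b [G jg]]; exact: has_jetP (jetM jf jg). Qed.

Lemma has_jet_sum (J : Type) (s : seq J) (P : pred J) (f : J -> V -> R) :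
  (forall j, has_jet (f j)) -> has_jet (fun x => \sum_(j <- s | P j) f j x).
Proof.
move=> hf; elim: s => [|j s IH].
  by under eq_fun do rewrite big_nil; exact: has_jet_cst.
under eq_fun do rewrite big_cons.
by case: (P j) => //; exact: has_jetD.
Qed.

Lemma has_jet_prod (J : Type) (s : seq J) (P : pred J) (f : J -> V -> R) :
  (forall j, has_jet (f j)) -> has_jet (fun x => \prod_(j <- s | P j) f j x).
Proof.
move=> hf; elim: s => [|j s IH].
  by under eq_fun do rewrite big_nil; exact: has_jet_cst.
under eq_fun do rewrite big_cons.
by case: (P j) => //; exact: has_jetM.
Qed.

Lemma jet_powR f c a H (b : R) : 0 < c -> jet f c a H ->
  jet (fun x => f x `^ b) (c `^ b) (fun k => b * c `^ (b - 1) * a k + 0 * a k)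
    (fun k l => b * c `^ (b - 1) * H k l + b * (b - 1) * c `^ (b - 2) * (a k * a l)).
Proof.
move=> c0 jf; have [K K0 HK] := powR_taylor b c0.
have c20 : 0 < c / 2 by rewrite divr_gt0.
exact: (@jet_comp (fun t => t `^ b) f c _ _ _ K (c / 2) a H jf c20 K0 HK).
Qed.

Lemma has_jet_powR f (b : R) : 0 < f 0 -> has_jet f -> has_jet (fun x => f x `^ b).
Proof. by move=> f0 [a [H jf]]; exact: has_jetP (jet_powR b f0 jf). Qed.

Lemma has_jet_gram_det (M : V) : has_jet (fun x => gram_det (M + x)).
Proof.
apply: has_jet_sum => s; apply: has_jetM; first exact: has_jet_cst.
apply: has_jet_prod => i; under eq_fun do rewrite mxE.
apply: has_jet_sum => b; under eq_fun do rewrite !mxE.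
by apply: has_jetM; apply: has_jetD; [exact: has_jet_cst|exact: (has_jet_crd (b, _))
  |exact: has_jet_cst|exact: (has_jet_crd (b, _))].
Qed.

Lemma jet_frob2 (M : V) :
  jet (fun x => frob2 (M + x)) (frob2 M) (fun k => 2 * crd M k + 0 * crd M k)
    (fun k l => 2 * (k == l)%:R).
Proof.
split=> [k l|]; first by rewrite eq_sym.
exists 0, 1; split=> // x _; rewrite mul0r normr_le0 subr_eq0; apply/eqP.
rewrite dot_lin /quad /dot !frob2E mul0r addr0 mulr_sumr mulr_suml -!big_split/=.
apply: eq_bigr => k _; rewrite (bigD1 k)//= eqxx mulr1 big1 => [|l lk].
  by rewrite /crd !mxE; field.
by rewrite eq_sym (negbTE lk) mulr0 !mul0r.
Qed.

(** Reads a directional derivative off a jet whose coefficients are not explicit: two first-order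
    expansions along [t *: v] differ by O(t^2), so their slopes agree. *)
Lemma jet_unique1 f c a H v (s C d : R) : jet f c a H -> 0 < d ->
  (forall t, `|t| <= d -> `|f (t *: v) - (c + s * t)| <= C * t ^+ 2) -> dot a v = s.
Proof.
move=> jf d0 hf; have [K [e [K0 e0 HK]]] := jet_bigO2 jf.
apply/eqP; rewrite -subr_eq0 -normr_le0; apply/ler_addgt0Pl => y y0; rewrite addr0.
pose D := K * nrm v ^+ 2 + `|C|.
have D0 : 0 <= D by rewrite addr_ge0// mulr_ge0// exprn_ge0// nrm_ge0.
(* Small enough for both expansions to hold at [t *: v] and for the slope error [D * t] to be at
   most [y]. *)
pose t := Num.min d (Num.min (e / (nrm v + 1)) (y / (D + 1))).
have nv1 : 0 < nrm v + 1 by rewrite ltr_wpDl// nrm_ge0.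
have D1 : 0 < D + 1 by rewrite ltr_wpDl.
have t0 : 0 < t by rewrite !lt_min d0 !divr_gt0.
have td : t <= d by rewrite ge_min lexx.
have te : t * (nrm v + 1) <= e by rewrite -ler_pdivlMr// !ge_min lexx !orbT.
have ty : t * (D + 1) <= y by rewrite -ler_pdivlMr// !ge_min lexx !orbT.
have h1 : `|f (t *: v) - (c + s * t)| <= C * t ^+ 2 by apply: hf; rewrite gtr0_norm.
have ntv : nrm (t *: v) = t * nrm v by rewrite nrmZ// ltW.
have h2 : `|f (t *: v) - (c + t * dot a v)| <= K * (t * nrm v) ^+ 2.
  rewrite -ntv -dotZ; apply: HK; rewrite ntv.
  by apply: le_trans te; apply: ler_wpM2l; [exact: ltW|rewrite lerDl].
have h3 : t * `|dot a v - s| <= D * t ^+ 2.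
  rewrite -[t in t * _]gtr0_norm// -normrM.
  rewrite (_ : t * _ = (f (t *: v) - (c + s * t)) - (f (t *: v) - (c + t * dot a v))); last by ring.
  apply: (le_trans (ler_normB _ _)); apply: (le_trans (lerD h1 h2)).
  rewrite /D mulrDl addrC; apply: lerD; first by rewrite exprMn (mulrC (t ^+ 2)) mulrA.
  by apply: ler_wpM2r; [exact: sqr_ge0|exact: ler_norm].
have h4 : `|dot a v - s| <= D * t.
  by rewrite -(ler_pM2l t0) (le_trans h3)// expr2 mulrCA.
apply: (le_trans h4); apply: le_trans ty; rewrite mulrC; apply: ler_wpM2l; first exact: ltW.
by rewrite lerDl.
Qed.

End jets.

(** * The two priors *)

Section prior_local.
Variables (R : realType) (n p : nat).
Local Notation V := 'M[R]_(n, p).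
Local Notation I := ('I_n * 'I_p)%type.
Local Notation lam := (lebmx R n p).
Hypotheses (p_gt0 : (0 < p)%N) (pn : (p.+1 < n)%N).
Let s := (n - p.+1)%N.
Implicit Type M : V.

(** The Leibniz formula has p! terms, and each Gram entry is at most |M|^2. As the determinant
    enters the prior with a negative power, this bounds the prior from below. *)
Lemma gram_det_le M : gram_det M <= p`!%:R * frob2 M ^+ p.
Proof.
have entry i j : `|(M^T *m M) i j| <= frob2 M.
  rewrite mxE (le_trans (ler_norm_sum _ _ _))//; apply: ler_sum => a _.
  have sq k : M a k ^+ 2 <= \sum_i M a i ^+ 2.
    by rewrite (bigD1 k)//= lerDl; apply: sumr_ge0 => l _; exact: sqr_ge0.
  rewrite mxE ler_norml.
  have := sqr_ge0 (M a i - M a j); have := sqr_ge0 (M a i + M a j).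
  by have := sq i; have := sq j; nra.
apply: (le_trans (ler_norm _)); rewrite /gram_det /determinant.
apply: (le_trans (ler_norm_sum _ _ _)).
rewrite mulr_natl -perm.card_Sn -sumr_const; apply: ler_sum => u _.
rewrite normrM normrX normrN1 expr1n mul1r normr_prod.
rewrite -[X in _ ^+ X]card_ord -prodr_const; apply: ler_prod => i _.
by rewrite normr_ge0 entry.
Qed.

Lemma pi_MSVS1_frob2 gamma M :
  pi_MSVS1 gamma M = pi_SVS M * frob2 M `^ (- (gamma / 2)).
Proof.
rewrite /pi_MSVS1 -powR12_sqrt ?frob2_ge0// -powRrM; congr (_ * _ `^ _); ring.
Qed.

Lemma frob2_gt0 M : gram_det M != 0 -> 0 < frob2 M.
Proof.
move=> g0; rewrite lt_def frob2_ge0 andbT; apply: contraNneq g0 => f0.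
have := gram_det_le M; rewrite f0 expr0n gtn_eqF// mulr0 => gle.
by rewrite eq_le gle gram_det_ge0.
Qed.

(** Off the null set of singular Gram matrices the prior is at least a constant times a negative
    power of |M|^2, which decays more slowly than any Gaussian. *)
Lemma pi_MSVS1_lb gamma (e : R) : 0 <= gamma -> 0 < e -> exists2 c, 0 < c &
  {ae lam, forall x, c * expR (- (e * frob2 x)) <= pi_MSVS1 gamma x}.
Proof.
move=> g0 e0.
pose al : R := p%:R * (s%:R / 2) + gamma / 2.
have al0 : 0 <= al by rewrite addr_ge0 ?mulr_ge0 ?divr_ge0.
have [C C0 HC] := powR_le_expR al0 e0.
pose P : R := p`!%:R `^ (s%:R / 2).
have f0 : 0 < p`!%:R :> R by rewrite ltr0n fact_gt0.
have P0 : 0 < P by rewrite powR_gt0.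
exists (P * C)^-1; first by rewrite invr_gt0 mulr_gt0.
have := ae_gram_det_neq0 R p_gt0 pn; apply: filterS => x gx.
have fx := frob2_gt0 gx.
have gx0 : 0 < gram_det x by rewrite lt_def gx gram_det_ge0.
rewrite pi_MSVS1_frob2 pi_SVSE// -/s.
apply: (@le_trans _ _ (P * frob2 x `^ al)^-1).
  rewrite expRN -invfM lef_pV2 ?posrE ?mulr_gt0 ?powR_gt0 ?expR_gt0//.
  by rewrite -mulrA; apply: ler_wpM2l; [exact: ltW|exact: HC (ltW fx)].
rewrite /al powRD; last by rewrite (gt_eqF fx) implybT.
rewrite mulrA invfM !powRN; apply: ler_wpM2r; first by rewrite invr_ge0 powR_ge0.
rewrite lef_pV2 ?posrE ?mulr_gt0 ?powR_gt0//.
rewrite (powRrM (frob2 x) p%:R) powR_mulrn ?frob2_ge0// /P -powRM ?exprn_ge0 ?frob2_ge0// ?(ltW f0)//.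
apply: ge0_ler_powR; rewrite ?nnegrE ?divr_ge0 ?gram_det_ge0//.
  by rewrite mulr_ge0 ?exprn_ge0 ?frob2_ge0.
exact: gram_det_le.
Qed.

Variable M0 : V.
Hypothesis gM0 : gram_det M0 != 0.

Let g0 : 0 < gram_det M0. Proof. by rewrite lt_def gM0 gram_det_ge0. Qed.
Let t0 : 0 < frob2 M0. Proof. exact: frob2_gt0. Qed.

Let pi0_gt0 : 0 < pi_SVS M0. Proof. by rewrite pi_SVSE// powR_gt0. Qed.

(** Existence is all that is asked for; the contractions of [a] with [M0] come from invariance
    below. *)
Lemma jet_pi_SVS : exists a H, jet (fun x => pi_SVS (M0 + x) / pi_SVS M0) 1 a H.
Proof.
have hj : has_jet (fun x => pi_SVS (M0 + x) / pi_SVS M0).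
  apply: has_jetM; last exact: has_jet_cst.
  under eq_fun do rewrite pi_SVSE//.
  apply: has_jet_powR; last exact: has_jet_gram_det.
  by rewrite addr0.
have [a [H]] := hj; rewrite addr0 divff ?gt_eqF// => jf; by exists a, H.
Qed.

Lemma jet_frob2_powR (b : R) :
  jet (fun x => frob2 (M0 + x) `^ b / frob2 M0 `^ b) 1
    (fun k => 2 * b / frob2 M0 * crd M0 k)
    (fun k l => 2 * b / frob2 M0 * (k == l)%:R +
       4 * b * (b - 1) / frob2 M0 ^+ 2 * (crd M0 k * crd M0 l)).
Proof.
have := jetM (jet_powR b t0 (jet_frob2 M0)) (jet_cst n p (frob2 M0 `^ b)^-1).
have tn0 : frob2 M0 != 0 by rewrite gt_eqF.
have tb0 : frob2 M0 `^ b != 0 by rewrite gt_eqF ?powR_gt0.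
have e1 : frob2 M0 `^ (b - 1) = frob2 M0 `^ b / frob2 M0.
  by rewrite powRB ?tn0 ?implybT// powRr1// ltW.
have e2 : frob2 M0 `^ (b - 2) = frob2 M0 `^ b / frob2 M0 ^+ 2.
  by rewrite powRB ?tn0 ?implybT// powR_mulrn// ltW.
rewrite e1 e2 mulfV//.
congr jet; apply/funext => k.
  by field; rewrite ?tb0 ?tn0.
apply/funext => l; by move: (k == l)%:R => dl; field; rewrite tb0 tn0.
Qed.

(* [pi_SVS] is multiplied by [|det T|^(-s)] under [M -> M T]; differentiate
   at [T = 1]. *)
Lemma jet_pi_SVS_invariance a H (c d : 'I_p) :
  jet (fun x => pi_SVS (M0 + x) / pi_SVS M0) 1 a H ->
  \sum_b a (b, d) * M0 b c = - s%:R * (c == d)%:R.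
Proof.
move=> jf.
(* The direction M0 E_cd, with E_cd an elementary matrix: column [c] of [M0] placed in column
   [d]. *)
pose v : V := \matrix_(b, j) if j == d then M0 b c else 0.
have <- : dot a v = \sum_b a (b, d) * M0 b c.
  rewrite /dot.
  transitivity (\sum_(b < n) \sum_(j < p) a (b, j) * v b j).
    by rewrite pair_bigA; apply: eq_bigr => -[b j].
  apply: eq_bigr => b _; rewrite (bigD1 d)//= !mxE eqxx big1 ?addr0// => j jd.
  by rewrite mxE (negbTE jd) mulr0.
have half : (0 : R) < 1 / 2 by rewrite divr_gt0.
have gE (t : R) : gram_det (M0 + t *: v) = (1 + t * (c == d)%:R) ^+ 2 * gram_det M0.
  (* For c = d the perturbation rescales one column by 1 + t; otherwise it is a shear, which
     preserves the determinant. *)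
  have [cd|cd] := eqVneq c d.
    have -> : M0 + t *: v = colop d (1 + t) (fun=> 0) M0.
      apply/matrixP => b j; rewrite !mxE; case: ifP => [/eqP->|_]; last by rewrite mulr0 addr0.
      by rewrite cd big1 ?addr0 => [|k _]; [ring|rewrite mul0r].
    by rewrite gram_det_colop mulr1.
  have -> : M0 + t *: v = colop d 1 (fun k => t * (k == c)%:R) M0.
    apply/matrixP => b j; rewrite !mxE; case: ifP => [/eqP->|_]; last by rewrite mulr0 addr0.
    rewrite (bigD1 c)//= eqxx mulr1 big1 => [|k /andP[_ /negbTE->]]; last by rewrite mulr0 mul0r.
    by rewrite mul1r addr0.
  by rewrite gram_det_colop mulr0 addr0.
have [K K0 HK] := powR_taylor (- s%:R) (ltr01 : 0 < (1 : R)).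
pose b : R := - s%:R.
apply: (@jet_unique1 _ _ _ _ _ _ _ _ _ (K + `|b * (b - 1)|) (1 / 2) jf half) => t t2.
pose u := t * (c == d)%:R.
have ut : `|u| <= `|t|.
  by rewrite /u; case: (c == d); rewrite ?mulr1// mulr0 normr0.
have u2 : `|u| <= 1 / 2 by exact: le_trans ut t2.
have u1 : 0 < 1 + u by move: u2; rewrite ler_norml => /andP[h1 h2]; lra.
have -> : pi_SVS (M0 + t *: v) / pi_SVS M0 = (1 + u) `^ b.
  rewrite !pi_SVSE// -/s gE -/u powRM ?sqr_ge0 ?gram_det_ge0// mulfK; last first.
    by rewrite gt_eqF ?powR_gt0.
  by rewrite -(powR_mulrn 2) ?ltW// -powRrM; congr powR; rewrite /b; field.
have := HK u u2; rewrite !powR1 mulr1 mulr1 => h.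
have -> : - s%:R * (c == d)%:R * t = b * u by rewrite /u /b; ring.
have ut2 : `|u| ^+ 2 <= t ^+ 2.
  by rewrite -[t ^+ 2]real_normK ?num_real// lerXn2r ?nnegrE.
apply: (@le_trans _ _ (K * `|u| ^+ 3 + `|b * (b - 1)| * `|u| ^+ 2)).
  have -> : (1 + u) `^ b - (1 + b * u) =
    ((1 + u) `^ b - (1 + b * u + b * (b - 1) * u ^+ 2 / 2)) + b * (b - 1) * u ^+ 2 / 2 by ring.
  apply: (le_trans (ler_normD _ _)); apply: lerD => //.
  have h2 : `|2^-1 : R| = 2^-1 by rewrite gtr0_norm ?invr_gt0.
  rewrite normrM (normrM _ (u ^+ 2)) normrX h2; apply: ler_piMr; last by rewrite invf_le1 ?ler1n.
  by rewrite mulr_ge0 ?exprn_ge0.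
rewrite [leRHS]mulrDl; apply: lerD; last by apply: ler_wpM2l.
apply: ler_wpM2l => //; apply: le_trans ut2.
rewrite exprS; apply: ler_piMl; first by rewrite exprn_ge0.
by apply: (le_trans u2); lra.
Qed.

Lemma risk_expansion_jet (pr : V -> R) a H :
  (forall x, 0 <= pr x) -> 0 < pr M0 -> measurable_fun setT pr ->
  (forall e, 0 < e -> (\int[lam]_x (expR (- (e * frob2 x)) * pr x)%:E < +oo)%E) ->
  (forall e, 0 < e -> exists2 c, 0 < c &
    {ae lam, forall x, c * expR (- (e * frob2 x)) <= pr x}) ->
  jet (fun x => pr (M0 + x) / pr M0) 1 a H ->
  exists2 C, 0 < C & forall r i j, 1 <= r ->
  `|r ^+ 2 ^+ 2 * risk_mx (gen_bayes pr (r ^+ 2)) (r ^+ 2) M0 i j -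
    r ^+ 2 * n%:R * (i == j)%:R -
    \sum_(b < n) (2 * H (b, i) (b, j) - a (b, i) * a (b, j))| <= C / r.
Proof.
move=> pr0 prM mpr pri prlb [sH [C [d [C0 d0 HC]]]].
exact: (risk_expansion pr0 prM mpr pri prlb sH d0 HC).
Qed.

Lemma risk_diff_expansion gamma : 0 <= gamma -> gamma < (p ^ 2 + p)%:R ->
  exists2 C, 0 < C & forall r i j, 1 <= r ->
  `|r ^+ 2 ^+ 2 * (risk_mx (gen_bayes (@pi_MSVS1 R gamma n p) (r ^+ 2)) (r ^+ 2) M0 i j -
                  risk_mx (gen_bayes (@pi_SVS R n p) (r ^+ 2)) (r ^+ 2) M0 i j) -
    limit_mx gamma (M0^T *m M0) i j| <= C / r.
Proof.
move=> ga0 gap; have gap0 : (0 : R) < (p ^ 2 + p)%:R by rewrite ltr0n addn_gt0 p_gt0 orbT.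
have [a [H j0]] := jet_pi_SVS.
have [C1 C10 R0] : exists2 C, 0 < C & forall r i j, 1 <= r ->
  `|r ^+ 2 ^+ 2 * risk_mx (gen_bayes (@pi_SVS R n p) (r ^+ 2)) (r ^+ 2) M0 i j -
    r ^+ 2 * n%:R * (i == j)%:R -
    \sum_(b < n) (2 * H (b, i) (b, j) - a (b, i) * a (b, j))| <= C / r.
  apply: risk_expansion_jet => //.
  - by move=> x; exact: pi_SVS_ge0.
  - exact: measurable_pi_SVS.
  - by move=> e e0; rewrite -pi_MSVS1_0; exact: integral_gauss_pi_MSVS1.
  - by move=> e e0; rewrite -pi_MSVS1_0; exact: pi_MSVS1_lb.
pose q := - (gamma / 2).
have jq := jet_frob2_powR q.
pose b k := 2 * q / frob2 M0 * crd M0 k.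
pose G k l := 2 * q / frob2 M0 * (k == l)%:R +
  4 * q * (q - 1) / frob2 M0 ^+ 2 * (crd M0 k * crd M0 l).
have j1 : jet (fun x => pi_MSVS1 gamma (M0 + x) / pi_MSVS1 gamma M0) 1
    (fun k => 1 * b k + 1 * a k)
    (fun k l => 1 * (1 * G k l + 1 * H k l) + 1 * (a k * b l + b k * a l)).
  have := jetM j0 jq; rewrite mulr1; congr jet; apply/funext => x.
  by rewrite !pi_MSVS1_frob2 -/q invfM mulrACA.
have [C2 C20 R1] : exists2 C, 0 < C & forall r i j, 1 <= r ->
  `|r ^+ 2 ^+ 2 * risk_mx (gen_bayes (@pi_MSVS1 R gamma n p) (r ^+ 2)) (r ^+ 2) M0 i j -
    r ^+ 2 * n%:R * (i == j)%:R -
    \sum_(c < n) (2 * (1 * (1 * G (c, i) (c, j) + 1 * H (c, i) (c, j)) +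
        1 * (a (c, i) * b (c, j) + b (c, i) * a (c, j))) -
      (1 * b (c, i) + 1 * a (c, i)) * (1 * b (c, j) + 1 * a (c, j)))| <= C / r.
  apply: risk_expansion_jet j1.
  - exact: pi_MSVS1_ge0.
  - by rewrite pi_MSVS1_frob2 mulr_gt0// powR_gt0.
  - exact: measurable_pi_MSVS1.
  - by move=> e e0; exact: integral_gauss_pi_MSVS1.
  - by move=> e e0; exact: pi_MSVS1_lb.
exists (C2 + C1) => [|r i j r1]; first exact: addr_gt0.
have t_n0 : frob2 M0 != 0 by rewrite gt_eqF.
have KE : (M0^T *m M0) i j = \sum_c crd M0 (c, i) * crd M0 (c, j).
  by rewrite mxE; apply: eq_bigr => c _; rewrite mxE.
have tE : \tr (M0^T *m M0) = frob2 M0.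
  rewrite /mxtrace /frob2 exchange_big; apply: eq_bigr => k _; rewrite mxE.
  by apply: eq_bigr => c _; rewrite mxE -expr2.
have inv1 := jet_pi_SVS_invariance j i j0; have inv2 := jet_pi_SVS_invariance i j j0.
have sE : s%:R = n%:R - p%:R - 1 :> R by rewrite /s natrB 1?ltnW// -natr1; ring.
have -> : limit_mx gamma (M0^T *m M0) i j =
  \sum_(c < n) (2 * (1 * (1 * G (c, i) (c, j) + 1 * H (c, i) (c, j)) +
        1 * (a (c, i) * b (c, j) + b (c, i) * a (c, j))) -
      (1 * b (c, i) + 1 * a (c, i)) * (1 * b (c, j) + 1 * a (c, j))) -
  \sum_(c < n) (2 * H (c, i) (c, j) - a (c, i) * a (c, j)).
  rewrite -sumrB.
  (* The product jet has gradient a + b and Hessian H + G + a b^T + b a^T, so the difference of the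
     two expressions is 2 G + a b^T + b a^T - b b^T, free of [H]; [b] is a multiple of [M0]. *)
  rewrite (eq_bigr (fun c : 'I_n => 4 * q / frob2 M0 * (i == j)%:R +
     (8 * q * (q - 1) / frob2 M0 ^+ 2 - 4 * q ^+ 2 / frob2 M0 ^+ 2) * (crd M0 (c, i) * crd M0 (c, j)) +
     2 * q / frob2 M0 * (a (c, i) * M0 c j) + 2 * q / frob2 M0 * (a (c, j) * M0 c i))); last first.
    move=> c _; rewrite /b /G xpair_eqE eqxx andTb /crd /=.
    by move: ((i == j)%:R) => dl; field.
  (* The identity matrix collects 4 q n / t from [G] and -4 q s / t from invariance, with t =
     |M0|^2. Since n - s = p + 1 and q = -gamma/2, this is -2 gamma (p + 1) / t. *)
  rewrite !big_split/= -!mulr_sumr inv1 inv2 -KE sumr_const card_ord -mulr_natr.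
  rewrite /limit_mx tE [j == i]eq_sym !mxE -mulr_natr sE /q.
  move: ((i == j)%:R) (\sum_j0 _) => dl kk; field.
  exact: t_n0.
set S1 := \sum_(b < n) _; set S0 := \sum_(b < n) (2 * H _ _ - _).
have hR1 := R1 r i j r1; rewrite -/S1 in hR1.
have hR0 := R0 r i j r1; rewrite -/S0 in hR0.
rewrite [leRHS]mulrDl; apply: le_trans (lerD hR1 hR0); apply: le_trans (ler_normB _ _).
by rewrite le_eqVlt; apply/orP; left; apply/eqP; congr (`|_|); ring.
Qed.

End prior_local.

(** * Passage to the limit and negative definiteness *)

Section limit.
Variables (R : realType) (n p : nat).

Lemma cvg_risk_diff (f : R -> 'M[R]_p) (L : 'M[R]_p) (C : R) : 0 < C ->
  (forall r i j, 1 <= r -> `|f (r ^+ 2) i j - L i j| <= C / r) -> f N @[N --> +oo] --> L.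
Proof.
move=> C0 H; apply/cvg_ballP => e e0; near=> N.
have N1 : 1 <= N by near: N; apply: nbhs_pinfty_ge; exact: num_real.
have NC : (C / e) ^+ 2 < N by near: N; apply: nbhs_pinfty_gt; exact: num_real.
have N0 : 0 <= N by exact: le_trans N1.
pose r := Num.sqrt N.
have rE : r ^+ 2 = N by rewrite sqr_sqrtr.
have r1 : 1 <= r by rewrite -sqrtr1 ler_wsqrtr.
have r0 : 0 < r by exact: lt_le_trans r1.
split=> [|i j]; first exact: e0.
rewrite /ball/= distrC -rE; apply: le_lt_trans (H r i j r1) _.
rewrite ltr_pdivrMr// mulrC -ltr_pdivrMr//.
have ce0 : 0 < C / e by rewrite divr_gt0.
by rewrite -(ltr_pXn2r (n := 2)) ?nnegrE// ?(ltW ce0) ?(ltW r0)// rE.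
Unshelve. all: by end_near. Qed.

(** Cauchy-Schwarz, through Lagrange's identity. *)
Lemma sqr_sum_le (I : finType) (x y : I -> R) :
  (\sum_i x i * y i) ^+ 2 <= (\sum_i x i ^+ 2) * (\sum_i y i ^+ 2).
Proof.
have H : 0 <= \sum_i \sum_j (x i * y j - x j * y i) ^+ 2.
  by apply: sumr_ge0 => i _; apply: sumr_ge0 => j _; exact: sqr_ge0.
suff E : \sum_i \sum_j (x i * y j - x j * y i) ^+ 2 =
    2 * ((\sum_i x i ^+ 2) * (\sum_i y i ^+ 2) - (\sum_i x i * y i) ^+ 2).
  by move: H; rewrite E pmulr_rge0// subr_ge0.
transitivity (\sum_i (x i ^+ 2 * (\sum_j y j ^+ 2) + y i ^+ 2 * (\sum_j x j ^+ 2) -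
    2 * (x i * y i * \sum_j x j * y j))).
  apply: eq_bigr => i _; rewrite !mulr_sumr -big_split/= -sumrB.
  by apply: eq_bigr => j _; ring.
rewrite sumrB big_split/= -!mulr_sumr -!mulr_suml; ring.
Qed.

(** By Cauchy-Schwarz in each row |M v|^2 <= |M|^2 |v|^2, so the bracket evaluated at [v] is at most
    (gamma + 4 - 2 (p + 1)) |M|^2 |v|^2, which is negative for gamma < 2 p - 2. *)
Lemma neg_def_limit_mx (gamma : R) (M : 'M[R]_(n, p)) :
  0 < gamma -> gamma < (2 * p - 2)%:R -> 0 < frob2 M ->
  neg_def (limit_mx gamma (M^T *m M)).
Proof.
move=> g0 gp t0 v v0; set K := M^T *m M.
(* For p = 0 the truncated bound 2 p - 2 is 0 and contradicts gamma > 0; from p >= 1 on the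
   subtraction is exact. *)
have p1 : (1 <= p)%N.
  by case: (p) gp => [|//]; rewrite muln0 => /(lt_trans g0); rewrite ltxx.
have tE : \tr K = frob2 M.
  rewrite /mxtrace /frob2 exchange_big; apply: eq_bigr => k _; rewrite mxE.
  by apply: eq_bigr => b _; rewrite mxE -expr2.
pose w := \sum_i v i 0 ^+ 2.
have w0 : 0 < w.
  rewrite lt_def sumr_ge0 ?andbT => [|i _]; last exact: sqr_ge0.
  apply: contraNneq v0 => /eqP; rewrite psumr_eq0 => [/allP h|i _]; last exact: sqr_ge0.
  apply/eqP/colP => i; rewrite mxE.
  by have := h i; rewrite mem_index_enum sqrf_eq0 => /(_ isT)/eqP.
have vv : (v^T *m 1%:M *m v) 0 0 = w.
  by rewrite mulmx1 mxE; apply: eq_bigr => i _; rewrite mxE -expr2.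
have vK : (v^T *m K *m v) 0 0 = \sum_a (\sum_i M a i * v i 0) ^+ 2.
  have -> : v^T *m K *m v = (M *m v)^T *m (M *m v) by rewrite trmx_mul !mulmxA.
  rewrite mxE; apply: eq_bigr => a _; rewrite !mxE -expr2; congr (_ ^+ 2).
have vK_le : (v^T *m K *m v) 0 0 <= frob2 M * w.
  rewrite vK /frob2 mulr_suml; apply: ler_sum => a _.
  exact: sqr_sum_le.
rewrite /limit_mx -scalemxAr -scalemxAl mxE tE.
have kpos : 0 < gamma * frob2 M ^- 2 by rewrite mulr_gt0// invr_gt0 exprn_gt0.
rewrite pmulr_rlt0// mulmxDr mulmxDl mxE mulmxN mulNmx mxE.
rewrite -!scalemxAr -!scalemxAl mxE vv mxE.
have gp' : gamma + 4 < 2 * (p%:R + 1).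
  by move: gp; rewrite natrB ?natrM; [lra|lia].
set X := (v^T *m K *m v) 0 0 in vK_le *.
have X0 : 0 <= X by rewrite /X vK; apply: sumr_ge0 => a _; exact: sqr_ge0.
have tw0 : 0 < frob2 M * w by rewrite mulr_gt0.
by nra.
Qed.

End limit.

Theorem theorem3 (R : realType) (n p : nat) (gamma : R) :
  (0 < p)%N -> (p.+1 < n)%N -> 0 <= gamma -> gamma < (p ^ 2 + p)%:R ->
  (forall M : 'M[R]_(n, p), (M^T *m M) \in unitmx ->
     ((N : R) ^+ 2 *: (risk_mx (gen_bayes (@pi_MSVS1 R gamma n p) N) N M
                 - risk_mx (gen_bayes (@pi_SVS R n p) N) N M))
       @[N --> +oo] --> limit_mx gamma (M^T *m M))
  /\
  ((2 <= p)%N -> 0 < gamma -> gamma < (2 * p - 2)%:R ->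
     forall M : 'M[R]_(n, p), (M^T *m M) \in unitmx ->
       neg_def (limit_mx gamma (M^T *m M))).
Proof.
move=> p_gt0 pn ga0 gap.
have gdet (M : 'M[R]_(n, p)) : (M^T *m M) \in unitmx -> gram_det M != 0.
  by rewrite unitmxE unitfE.
split=> [M /gdet gM|_ g0 gp M /gdet gM].
  have [C C0 HC] := risk_diff_expansion p_gt0 pn gM ga0 gap.
  apply: (cvg_risk_diff C0) => r i j r1.
  by have := HC r i j r1; rewrite !mxE.
by apply: neg_def_limit_mx => //; exact: frob2_gt0.
Qed.
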